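(* Let $s\in(0,1)$ and $\Omega=\mathbb{R}^n$. For $\varepsilon>0$ and a measurable set $E\subset\mathbb{R}^n$ with $\chi_E\in L^1(\mathbb{R}^n)$, let $\phi_E^\varepsilon$ be the unique bounded solution of $\phi+\varepsilon^s(-\Delta)^{s/2}\phi=\chi_E$ in $\mathbb{R}^n$, and let $$\mathscr{J}^s_\varepsilon(E)=\varepsilon^{-s}\int_{\mathbb{R}^n}\chi_E(1-\phi_E^\varepsilon)\,dx .$$ (i) For every set $E$ with $\chi_E\in L^1(\mathbb{R}^n)$ and $P_s(E)<\infty$, $$\lim_{\varepsilon\to0}\mathscr{J}^s_\varepsilon(E)=c_{n,s}P_s(E).$$ (ii) For any family $\{E_\varepsilon\}_{\varepsilon>0}$ that converges to $E$ in $L^1(\mathbb{R}^n)$, $$\liminf_{\varepsilon\to0}\mathscr{J}^s_\varepsilon(E_\varepsilon)\ge c_{n,s}P_s(E).$$ In particular, $\mathscr{J}^s_\varepsilon$ $\Gamma$-converges to $c_{n,s}P_s$ as $\varepsilon\to0$.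
   Context: $\chi_E$ is the characteristic function of $E$. Convergence of sets in $L^1$ means convergence of characteristic functions in $L^1$. The fractional Laplacian is $$(-\Delta)^{s/2}u(x)=c_{n,s}\,\mathrm{P.V.}\int_{\mathbb{R}^n}\frac{u(x)-u(y)}{|x-y|^{n+s}}\,dy,\qquad c_{n,s}=\frac{2^s\Gamma\left(\frac{n+s}{2}\right)}{\pi^{n/2}|\Gamma(-\frac s2)|},$$ and the $s$-perimeter is $$P_s(E)=\frac12\int_{\mathbb{R}^n}\int_{\mathbb{R}^n}\frac{|\chi_E(x)-\chi_E(y)|}{|x-y|^{n+s}}\,dx\,dy\in[0,+\infty].$$ $\Gamma$-convergence of $\mathscr{J}_\varepsilon$ to $\mathscr{J}_0$ (with respect to $L^1$ convergence of sets) means: for every family $E_\varepsilon\to E$ in $L^1$, $\liminf_{\varepsilon\to0}\mathscr{J}_\varepsilon(E_\varepsilon)\ge\mathscr{J}_0(E)$; and for every $E$ there is a family $E_\varepsilon\to E$ in $L^1$ with $\limsup_{\varepsilon\to0}\mathscr{J}_\varepsilon(E_\varepsilon)\le\mathscr{J}_0(E)$. *)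

(* Defs.v *)
From HB Require Import structures.
From mathcomp Require Import all_boot all_order all_algebra.
From mathcomp Require Import all_classical all_reals all_analysis.

Set Implicit Arguments.
Unset Strict Implicit.
Unset Printing Implicit Defensive.

Import Order.TTheory GRing.Theory Num.Theory.
Import numFieldNormedType.Exports.

Local Open Scope classical_set_scope.
Local Open Scope ring_scope.

Section measurable_rV.
Context {R : realType} (n : nat).

Let coord (i : 'I_n) (x : 'rV[R]_n) : measurableTypeR R := x ord0 i.

Let rV_set0 : g_sigma_preimage coord set0.
Proof. exact: sigma_algebra0. Qed.

Let rV_setC A : g_sigma_preimage coord A -> g_sigma_preimage coord (~` A).
Proof. exact: sigma_algebraC. Qed.

Let rV_bigcup (F : (set 'rV[R]_n)^nat) :
  (forall i, g_sigma_preimage coord (F i)) ->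
  g_sigma_preimage coord (\bigcup_i F i).
Proof. exact: sigma_algebra_bigcup. Qed.

Definition rV_display : measure_display := default_measure_display.

(* The Borel sets of [R^n], generated by the coordinate maps. *)
HB.instance Definition _ := @isMeasurable.Build rV_display 'rV[R]_n
  (g_sigma_preimage coord) rV_set0 rV_setC rV_bigcup.

Lemma measurable_coord (i : 'I_n) :
  measurable_fun setT (fun x : 'rV[R]_n => x ord0 i : measurableTypeR R).
Proof.
move=> _ Y mY; rewrite setTI; apply: sub_sigma_algebra => /=.
rewrite -bigcup_seq/=; exists i => /=; first by rewrite mem_index_enum.
by exists Y => //; rewrite setTI.
Qed.

Lemma measurable_fun_rVP d (T : measurableType d) (f : T -> 'rV[R]_n) :
  measurable_fun setT f <->
  forall i, measurable_fun setT (fun t => f t ord0 i : measurableTypeR R).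
Proof.
split=> [mf i|mf].
  exact: (measurableT_comp (measurable_coord i) mf).
have : g_sigma_preimage (fun i => coord i \o f) `<=` measurable.
  apply: smallest_sub; first exact: sigma_algebra_measurable.
  rewrite -bigcup_seq => A [i _ [B mB <-]].
  exact: mf.
rewrite g_sigma_preimage_comp => h _ A mA.
by apply: h; exists A.
Qed.

End measurable_rV.

Section lebesgue_rV.
Context {R : realType}.

Definition rV_cons n (p : measurableTypeR R * 'rV[R]_n) : 'rV[R]_n.+1 :=
  row_mx p.1%:M p.2.

Lemma measurable_rV_cons n : measurable_fun setT (@rV_cons n).
Proof.
apply/measurable_fun_rVP => i.
rewrite -(@splitK 1 n i); case: (fintype.split (i : 'I_(1 + n))) => j.
  rewrite (_ : (fun _ => _) = fst)//.
  by apply/funext => -[t y] /=; rewrite (row_mxEl (t%:M : 'rV_1)) mxE (ord1 j).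
rewrite (_ : (fun _ => _) = (fun y : 'rV[R]_n => y ord0 j) \o snd).
  exact: (measurableT_comp (measurable_coord j) measurable_snd).
by apply/funext => -[t y] /=; rewrite (row_mxEr (t%:M : 'rV_1)).
Qed.

Section lebesgue_step.
Context n (mu : {sigma_finite_measure set 'rV[R]_n -> \bar R}).

(* The product of the Lebesgue measure on the first coordinate and of [mu] on
   the remaining ones. *)
Definition lebesgue_step : set 'rV[R]_n.+1 -> \bar R :=
  pushforward (lebesgue_measure \x mu)%E (@rV_cons n).

HB.instance Definition _ := @isMeasurableFun.Build _ _ _ _ (@rV_cons n)
  (@measurable_rV_cons n).

Let lebesgue_step0 : lebesgue_step set0 = 0%E.
Proof. exact: measure0. Qed.

Let lebesgue_step_ge0 A : (0 <= lebesgue_step A)%E.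
Proof. exact: measure_ge0. Qed.

Let lebesgue_step_sigma_additive : semi_sigma_additive lebesgue_step.
Proof. exact: measure_semi_sigma_additive. Qed.

HB.instance Definition _ := isMeasure.Build _ _ _ lebesgue_step
  lebesgue_step0 lebesgue_step_ge0 lebesgue_step_sigma_additive.

Let lebesgue_step_sigma_finite : sigma_finite setT lebesgue_step.
Proof.
have /sigma_finiteP[F [TF ndF Foo]] := sigma_finiteT (@lebesgue_measure R).
have /sigma_finiteP[G [TG ndG Goo]] := sigma_finiteT mu.
pose g (x : 'rV[R]_n.+1) : measurableTypeR R * 'rV[R]_n :=
  (x ord0 ord0, \row_j x ord0 (lift ord0 j)).
have mg : measurable_fun setT g.
  apply/measurable_fun_pairP; split; first exact: measurable_coord.
  apply/measurable_fun_rVP => j /=.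
  rewrite (_ : (fun _ => _) = (fun x : 'rV[R]_n.+1 => x ord0 (lift ord0 j))).
    exact: measurable_coord.
  by apply/funext => x; rewrite mxE.
have gK p : g (rV_cons p) = p.
  case: p => t y; rewrite /g /rV_cons /=; congr pair.
    rewrite (_ : ord0 = lshift n (ord0 : 'I_1)); last exact/val_inj.
    by rewrite (row_mxEl (t%:M : 'rV_1)) mxE.
  apply/rowP => j; rewrite mxE.
  rewrite (_ : lift ord0 j = rshift 1 j); last exact/val_inj.
  by rewrite (row_mxEr (t%:M : 'rV_1)).
exists (fun i => g @^-1` (F i `*` G i)).
  apply/esym; rewrite -subTset => x _.
  have [k _ Fk] : (\bigcup_i F i) (g x).1 by rewrite -TF.
  have [l _ Gl] : (\bigcup_i G i) (g x).2 by rewrite -TG.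
  exists (maxn k l) => //; split => /=.
    by move: Fk; apply/subsetPset/ndF/leq_maxl.
  by move: Gl; apply/subsetPset/ndG/leq_maxr.
move=> i; have [mF Fi] := Foo i; have [mG Gi] := Goo i; split.
  by rewrite -[X in measurable X]setTI; apply: mg => //; exact: measurableX.
rewrite /lebesgue_step /pushforward -comp_preimage.
rewrite (_ : g \o _ = id) ?preimage_id; last by apply/funext => p; exact: gK.
by rewrite product_measure1E// lte_mul_pinfty// ge0_fin_numE.
Qed.

HB.instance Definition _ := Measure_isSigmaFinite.Build _ _ _ lebesgue_step
  lebesgue_step_sigma_finite.

End lebesgue_step.

Fixpoint lebesgue_rV n : {sigma_finite_measure set 'rV[R]_n -> \bar R} :=
  match n with
  | 0%N => \d_(0 : 'rV[R]_0)
  | m.+1 => lebesgue_step (lebesgue_rV m)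
  end.

End lebesgue_rV.

Section constants.
Context {R : realType}.

Definition gamma_integral (z : R) : R :=
  \int[lebesgue_measure]_(t in `]0, +oo[) (t `^ (z - 1) * expR (- t)).

(* Euler's integral, continued to negative non-integers by
   [Gamma (z + 1) = z * Gamma z]. *)
Definition Gamma (z : R) : R :=
  let k := if 0 < z then 0%N else (Num.truncn (- z)).+1 in
  gamma_integral (z + k%:R) / \prod_(i < k) (z + i%:R).

Definition c_ns (n : nat) (s : R) : R :=
  2 `^ s * Gamma ((n%:R + s) / 2) / (pi `^ (n%:R / 2) * `|Gamma (- (s / 2))|).

(* The norm [`|x|] of the library is the maximum norm. *)
Definition enorm n (x : 'rV[R]_n) : R :=
  Num.sqrt (\sum_(i < n) x ord0 i ^+ 2).

Definition frac_kernel n (s : R) (x y : 'rV[R]_n) : R :=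
  (enorm (x - y) `^ (n%:R + s))^-1.

End constants.

Section fractional.
Context {R : realType} {n : nat}.
Implicit Types (s : R) (u : 'rV[R]_n -> R) (E : set 'rV[R]_n).
Notation mu := (lebesgue_rV n).

(* [frac_laplacian s] is (-Delta)^(s/2). *)
Definition frac_laplacian s u (x : 'rV[R]_n) : R :=
  c_ns n s * lim ((\int[mu]_(y in [set y | (r <= enorm (x - y))%R])
                     ((u x - u y) * frac_kernel s x y)) @[r --> 0^'+]).

Definition s_perimeter s E : \bar R :=
  (2^-1%:E * \int[mu]_x \int[mu]_y
    (`|\1_E x - \1_E y| * frac_kernel s x y)%:E)%E.

(* [measurable] is Borel measurability. Integrals of functions built on a
   Lebesgue measurable set are still the intended ones, since the integral of a
   nonnegative function is a supremum over the simple functions below it, which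
   does not change when the function is modified on a negligible set. *)
Definition lebesgue_measurable E :=
  exists2 A, measurable A & mu.-negligible (A `+` E).

Definition indicator_L1 E :=
  lebesgue_measurable E /\ (\int[mu]_x (\1_E x : R)%:E < +oo)%E.

Definition cvg_L1 (F : R -> set 'rV[R]_n) E :=
  (\int[mu]_x (`|\1_(F e) x - \1_E x|)%:E)%E @[e --> 0^'+] --> 0%E.

Definition Gamma_converges (J : R -> set 'rV[R]_n -> \bar R)
    (J0 : set 'rV[R]_n -> \bar R) :=
  (forall (F : R -> set 'rV[R]_n) E,
     (forall e, 0 < e -> indicator_L1 (F e)) -> indicator_L1 E ->
     cvg_L1 F E ->
     (J0 E <= limf_einf (fun e => J e (F e)) 0^'+)%E) /\
  (forall E, indicator_L1 E ->
     exists F : R -> set 'rV[R]_n,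
       [/\ forall e, 0 < e -> indicator_L1 (F e), cvg_L1 F E &
        (limf_esup (fun e => J e (F e)) 0^'+ <= J0 E)%E]).

Definition partial (i : 'I_n) u (x : 'rV[R]_n) : R := 'D_(delta_mx ord0 i) u x.

Fixpoint is_Ck (k : nat) u : Prop :=
  match k with
  | 0%N => continuous u
  | m.+1 => continuous u /\ forall i : 'I_n,
      (forall x, derivable u x (delta_mx ord0 i)) /\ is_Ck m (partial i u)
  end.

Definition test_function u :=
  (forall k, is_Ck k u) /\ compact (closure [set x | u x != 0]).

(* A bounded solution of [phi + eps^s (-Delta)^(s/2) phi = 1_E], the equation
   being understood in the sense of distributions: for a discontinuous
   right-hand side the principal value need not exist everywhere, and requiring
   the equation almost everywhere would not determine [phi]. *)
Definition bounded_solution s (eps : R) E (phi : 'rV[R]_n -> R) :=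
  [/\ measurable_fun setT (phi : 'rV[R]_n -> measurableTypeR R),
      exists M : R, forall x, `|phi x| <= M &
      forall psi, test_function psi ->
        \int[mu]_x (phi x * (psi x + eps `^ s * frac_laplacian s psi x)) =
        \int[mu]_x (\1_E x * psi x)].

(* [phi_sol] is meaningful where a bounded solution exists; it is then unique up
   to a negligible set. *)
Definition phi_sol s (eps : R) E : 'rV[R]_n -> R :=
  xget (fun=> 0) [set phi | bounded_solution s eps E phi].

Definition J_functional s (eps : R) E : \bar R :=
  ((eps `^ (- s))%:E * \int[mu]_x (\1_E x * (1 - phi_sol s eps E x))%:E)%E.

End fractional.

(* Main.v *)
From HB Require Import structures.
Require Import Defs.
From mathcomp Require Import all_boot all_order all_algebra.
From mathcomp Require Import all_classical all_reals all_analysis.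
From mathcomp Require Import measurable_realfun ring lra.

Set Implicit Arguments.
Unset Strict Implicit.
Unset Printing Implicit Defensive.

Import Order.TTheory GRing.Theory Num.Theory.
Import numFieldNormedType.Exports.

Local Open Scope classical_set_scope.
Local Open Scope ring_scope.

(* Put [lam = eps^s c_ns] and let [K] be the fractional kernel. For an integrable
   bounded kernel [k] the resolvent equation [phi + lam L_k phi = 1_A] is solved by
   monotone iteration and gives the energy identity
     [\int (1_A - phi)^2 + (lam/2) energy k phi = \int 1_A (1 - phi)
        <= (lam/2) energy k 1_A].
   Truncations of [K] increase to [K] and the resolvents are Cauchy in [L^2], so a
   subsequence converges a.e. to a bounded solution for [K] satisfying the same
   inequalities. It is the only one: the convolution of the difference of two
   bounded solutions with a bump solves the homogeneous equation classically and
   vanishes by the maximum principle.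
   After division by [eps^s] the upper bound reads
   [J_functional s eps E <= c_ns P_s(E)]. Conversely, along a sequence [eps_j -> 0]
   on which [J_functional] stays bounded, [\int (1_(A_j) - phi_j)^2 = O(eps_j^s)],
   so [phi_j -> 1_E] a.e. when [A_j -> E], and Fatou's lemma applied to
   [(c_ns/2) energy K phi_j <= J_functional] gives the lower bound. *)

(** * Symmetric double integrals *)

(** The kernel is singular, so [L_K phi] has no pointwise meaning for a merely bounded [phi]; this
    is why truncated kernels come first. For these [L_k phi = m * phi - \int k phi] is a genuine
    integral operator, and the energy relations are written with nonnegative terms, so that Tonelli
    applies in [[0, +oo]] and no infinite quantities are subtracted. The Cauchy property has a
    variational source: the resolvent for [k] minimizes [\int u^2 + (lam/2) energy k u - 2 \int 1_A
    u], and the minimum is [- \int 1_A phi]. The minimum grows with [k], and the quadratic part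
    bounds the squared [L^2] distance of two minimizers by the difference of the minima. Since
    [s < 1], [min(|h|, 1) |h|^(-n-s)] is integrable; hence on test functions the principal value is
    an absolutely convergent integral, and Fubini moves the operator from one factor to the other.
    Uniqueness also serves the estimates: [phi_sol] is an arbitrary choice among the bounded
    solutions, and uniqueness transfers to it what is proved for the constructed one. *)

Section ge0_real_integral.
Context d (T : measurableType d) (R : realType).
Variable mu : {measure set T -> \bar R}.
Implicit Types (g h : T -> R).

Lemma ge0_integralD_EFin g h : measurable_fun setT g -> measurable_fun setT h ->
  (forall x, 0 <= g x) -> (forall x, 0 <= h x) ->
  (\int[mu]_x (g x + h x)%:E = \int[mu]_x (g x)%:E + \int[mu]_x (h x)%:E)%E.
Proof.
move=> mg mh g0 h0; rewrite -ge0_integralD//.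
- by move=> x _; rewrite lee_fin.
- exact/measurable_EFinP.
- by move=> x _; rewrite lee_fin.
- exact/measurable_EFinP.
Qed.

Lemma ge0_integralZ_EFin g c : measurable_fun setT g -> (forall x, 0 <= g x) ->
  0 <= c -> (\int[mu]_x (c * g x)%:E = c%:E * \int[mu]_x (g x)%:E)%E.
Proof.
move=> mg g0 c0; rewrite -ge0_integralZl ?lee_fin//.
- exact/measurable_EFinP.
- by move=> x _; rewrite lee_fin.
Qed.

Lemma ge0_le_integral_EFin g h : measurable_fun setT g -> measurable_fun setT h ->
  (forall x, 0 <= g x) -> (forall x, g x <= h x) ->
  (\int[mu]_x (g x)%:E <= \int[mu]_x (h x)%:E)%E.
Proof.
move=> mg mh g0 gh; apply: ge0_le_integral => //.
- by move=> x _; rewrite lee_fin.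
- exact/measurable_EFinP.
- exact/measurable_EFinP.
- by move=> x _; rewrite lee_fin.
Qed.

Lemma ge0_integral_EFin_ge0 g : (forall x, 0 <= g x) ->
  (0 <= \int[mu]_x (g x)%:E)%E.
Proof. by move=> g0; apply: integral_ge0 => x _; rewrite lee_fin. Qed.

End ge0_real_integral.

(** Locked, so that rewriting with the lemmas on single integrals cannot unfold it or match inside
    it. *)
HB.lock Definition dint d (T : measurableType d) (R : realType)
  (mu : {sigma_finite_measure set T -> \bar R}) (g : T -> T -> R) : \bar R :=
  (\int[mu]_x \int[mu]_y (g x y)%:E)%E.

Section double_integral.
Context d (T : measurableType d) (R : realType).
Variable mu : {sigma_finite_measure set T -> \bar R}.
Implicit Types (u v : T -> R) (g h : T -> T -> R).

(** Joint measurability wrapped in an inductive type: [g] stays visible in curried form, so that the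
    closure lemmas below apply by plain unification. *)
Variant measurable2 g : Prop :=
  Measurable2 of measurable_fun setT (fun p : T * T => g p.1 p.2).

Lemma measurable2P g :
  measurable2 g -> measurable_fun setT (fun p : T * T => g p.1 p.2).
Proof. by case. Qed.

Lemma measurable2_fst u : measurable_fun setT u -> measurable2 (fun x _ => u x).
Proof. by move=> mu'; split; exact: (measurableT_comp mu' measurable_fst). Qed.

Lemma measurable2_snd u : measurable_fun setT u -> measurable2 (fun _ y => u y).
Proof. by move=> mu'; split; exact: (measurableT_comp mu' measurable_snd). Qed.

Lemma measurable2_swap g : measurable2 g -> measurable2 (fun x y => g y x).
Proof.
by case=> mg; split; have := measurableT_comp mg (@measurable_swap _ _ T T); exact.
Qed.

Lemma measurable2_app g x : measurable2 g -> measurable_fun setT (g x).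
Proof. by case=> mg; exact: (measurableT_comp mg (measurable_pair1 x)). Qed.

Lemma measurable2M g h : measurable2 g -> measurable2 h ->
  measurable2 (fun x y => g x y * h x y).
Proof. by case=> mg [mh]; split; exact: measurable_funM. Qed.

Lemma measurable2D g h : measurable2 g -> measurable2 h ->
  measurable2 (fun x y => g x y + h x y).
Proof. by case=> mg [mh]; split; exact: measurable_funD. Qed.

Lemma measurable2B g h : measurable2 g -> measurable2 h ->
  measurable2 (fun x y => g x y - h x y).
Proof. by case=> mg [mh]; split; exact: measurable_funB. Qed.

Lemma measurable2X g n : measurable2 g -> measurable2 (fun x y => g x y ^+ n).
Proof. by case=> mg; split; exact: measurable_funX. Qed.

Lemma measurable2_norm g : measurable2 g -> measurable2 (fun x y => `|g x y|).
Proof. by case=> mg; split; exact: measurableT_comp. Qed.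

Lemma measurable2_cst c : measurable2 (fun _ _ => c).
Proof. by split; exact: measurable_cst. Qed.


Lemma measurable_inner g : measurable2 g -> (forall x y, 0 <= g x y) ->
  measurable_fun setT ((fun x => \int[mu]_y (g x y)%:E)%E : T -> \bar R).
Proof.
move=> mg g0.
apply: (measurable_fun_fubini_tonelli_F (fun p : T * T => (g p.1 p.2)%:E)).
  by apply/measurable_EFinP; exact: (measurable2P mg).
by move=> p; rewrite lee_fin.
Qed.

Lemma dint_ge0 g : (forall x y, 0 <= g x y) -> (0 <= dint mu g)%E.
Proof.
by move=> g0; rewrite dint.unlock; apply: integral_ge0 => x _; apply: integral_ge0 => y _; rewrite lee_fin.
Qed.

Lemma dint_swap g : measurable2 g -> (forall x y, 0 <= g x y) ->
  dint mu (fun x y => g y x) = dint mu g.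
Proof.
move=> mg g0; apply/esym; rewrite dint.unlock.
apply: (fubini_tonelli (fun p : T * T => (g p.1 p.2)%:E)).
  by apply/measurable_EFinP; exact: (measurable2P mg).
by move=> p; rewrite lee_fin.
Qed.

Lemma le_dint g h : measurable2 g -> measurable2 h -> (forall x y, 0 <= g x y) ->
  (forall x y, g x y <= h x y) -> (dint mu g <= dint mu h)%E.
Proof.
move=> mg mh g0 gh.
have h0 x y : 0 <= h x y by rewrite (le_trans (g0 x y)).
rewrite dint.unlock.
apply: ge0_le_integral => //=.
- by move=> x _; apply: integral_ge0 => y _; rewrite lee_fin.
- exact: measurable_inner.
- exact: measurable_inner.
- move=> x _; apply: ge0_le_integral => //=.
  + by move=> y _; rewrite lee_fin.
  + exact/measurable_EFinP/measurable2_app.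
  + exact/measurable_EFinP/measurable2_app.
  + by move=> y _; rewrite lee_fin.
Qed.

Lemma dintD g h : measurable2 g -> measurable2 h -> (forall x y, 0 <= g x y) ->
  (forall x y, 0 <= h x y) ->
  dint mu (fun x y => g x y + h x y) = (dint mu g + dint mu h)%E.
Proof.
move=> mg mh g0 h0; rewrite dint.unlock -ge0_integralD//=.
- apply: eq_integral => x _; rewrite -ge0_integralD//=.
  + by move=> y _; rewrite lee_fin.
  + exact/measurable_EFinP/measurable2_app.
  + by move=> y _; rewrite lee_fin.
  + exact/measurable_EFinP/measurable2_app.
- by move=> x _; apply: integral_ge0 => y _; rewrite lee_fin.
- exact: measurable_inner.
- by move=> x _; apply: integral_ge0 => y _; rewrite lee_fin.
- exact: measurable_inner.
Qed.

Lemma dintZ c g : measurable2 g -> (forall x y, 0 <= g x y) -> 0 <= c ->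
  dint mu (fun x y => c * g x y) = (c%:E * dint mu g)%E.
Proof.
move=> mg g0 c0; rewrite dint.unlock -ge0_integralZl//=.
- apply: eq_integral => x _; rewrite -ge0_integralZl//=.
  + exact/measurable_EFinP/measurable2_app.
  + by move=> y _; rewrite lee_fin.
- exact: measurable_inner.
- by move=> x _; apply: integral_ge0 => y _; rewrite lee_fin.
Qed.

(** The shape of an expanded square, [(u - v)^2 + (u v + u v) = u^2 + v^2], integrated without
    subtracting possibly infinite terms. *)
Lemma dint_sum_eq a b g h :
  [/\ measurable2 a, measurable2 b, measurable2 g & measurable2 h] ->
  [/\ forall x y, 0 <= a x y, forall x y, 0 <= b x y,
      forall x y, 0 <= g x y & forall x y, 0 <= h x y] ->
  (forall x y, a x y + (b x y + b x y) = g x y + h x y) ->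
  (dint mu a + (dint mu b + dint mu b) = dint mu g + dint mu h)%E.
Proof.
move=> [ma mb mg mh] [a0 b0 g0 h0] e.
rewrite -(dintD mb mb b0 b0) -(dintD mg mh g0 h0).
rewrite -dintD//; last 2 first.
- exact: measurable2D.
- by move=> x y; rewrite addr_ge0.
by congr (dint mu); apply/funext => x; apply/funext => y; rewrite e.
Qed.

Lemma dint_sum_le a b g h p q :
  [/\ measurable2 a, measurable2 b, measurable2 g & measurable2 h] ->
  measurable2 p -> measurable2 q ->
  [/\ forall x y, 0 <= a x y, forall x y, 0 <= b x y,
      forall x y, 0 <= g x y & forall x y, 0 <= h x y] ->
  (forall x y, 0 <= p x y) -> (forall x y, 0 <= q x y) ->
  (forall x y, 2 * (a x y + b x y) <= g x y + h x y + 2 * (p x y + q x y)) ->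
  (2%:E * (dint mu a + dint mu b) <= dint mu g + dint mu h + 2%:E * (dint mu p + dint mu q))%E.
Proof.
move=> [ma mb mg mh] mp mq [a0 b0 g0 h0] p0 q0 le2.
have mab := measurable2D ma mb; have mgh := measurable2D mg mh.
have mpq := measurable2D mp mq.
have ab0 x y : 0 <= a x y + b x y by rewrite addr_ge0.
have gh0 x y : 0 <= g x y + h x y by rewrite addr_ge0.
have pq0 x y : 0 <= p x y + q x y by rewrite addr_ge0.
have pq20 x y : 0 <= 2 * (p x y + q x y) by rewrite mulr_ge0.
have mpq2 := measurable2M (measurable2_cst 2) mpq.
rewrite -!dintD// -dintZ// -dintZ// -dintD//.
apply: le_dint => //.
- exact: measurable2M (measurable2_cst 2) mab.
- exact: measurable2D.
- by move=> x y; rewrite mulr_ge0.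
Qed.

End double_integral.


Lemma ge0_fin_EFin (R : realType) (x : \bar R) :
  (0 <= x)%E -> (x < +oo)%E -> exists2 r : R, 0 <= r & x = r%:E.
Proof.
move=> x0 xoo; exists (fine x); first exact: fine_ge0.
by rewrite fineK// ge0_fin_numE.
Qed.

Section bounded_kernel.
Context d (T : measurableType d) (R : realType).
Variable mu : {sigma_finite_measure set T -> \bar R}.
Variables (k : T -> T -> R) (m : R).
Hypotheses (k0 : forall x y, 0 <= k x y) (ksym : forall x y, k x y = k y x).
Hypothesis mk : measurable2 k.
Hypothesis m0 : 0 <= m.
Hypothesis km : forall x, (\int[mu]_y (k x y)%:E = m%:E)%E.
Implicit Types (u v : T -> R).

Let mk_app x : measurable_fun setT (k x).
Proof. exact: measurable2_app. Qed.

Lemma dint_kernel_fst u : measurable_fun setT u -> (forall x, 0 <= u x) ->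
  dint mu (fun x y => k x y * u x) = (m%:E * \int[mu]_x (u x)%:E)%E.
Proof.
move=> mu' u0; rewrite dint.unlock -ge0_integralZl//=; last 2 first.
- exact/measurable_EFinP.
- by move=> x _; rewrite lee_fin.
apply: eq_integral => x _; rewrite -(km x) -ge0_integralZr//=.
- exact/measurable_EFinP.
- by move=> y _; rewrite lee_fin.
- by rewrite lee_fin.
Qed.

Lemma dint_kernel_snd u : measurable_fun setT u -> (forall x, 0 <= u x) ->
  dint mu (fun x y => k x y * u y) = (m%:E * \int[mu]_x (u x)%:E)%E.
Proof.
move=> mu' u0; rewrite -(dint_kernel_fst mu' u0) -[RHS]dint_swap.
- by congr (dint _ _); apply/funext => x; apply/funext => y; rewrite ksym.
- by apply: measurable2M; [exact: mk|exact: measurable2_fst].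
- by move=> x y; rewrite mulr_ge0.
Qed.

Definition cross u v := dint mu (fun x y => k x y * (u x * v y)).
(** Taken without the factor [1/2] of the Dirichlet form: on an indicator function it is twice the
    perimeter attached to [k]. *)
Definition energy u := dint mu (fun x y => k x y * (u x - u y) ^+ 2).

Let m_cross u v : measurable_fun setT u -> measurable_fun setT v ->
  measurable2 (fun x y => k x y * (u x * v y)).
Proof.
move=> mu1 mv; apply: measurable2M => //.
by apply: measurable2M; [exact: measurable2_fst|exact: measurable2_snd].
Qed.

Let m_energy u : measurable_fun setT u ->
  measurable2 (fun x y => k x y * (u x - u y) ^+ 2).
Proof.
move=> mu1; apply: measurable2M => //.
have : measurable2 (fun x y => u x - u y).
  by apply: measurable2B; [exact: measurable2_fst|exact: measurable2_snd].
exact: measurable2X.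
Qed.

Lemma energy_ge0 u : (0 <= energy u)%E.
Proof. by apply: (dint_ge0 mu) => x y; rewrite mulr_ge0// sqr_ge0. Qed.

Lemma crossC u v : measurable_fun setT u -> measurable_fun setT v ->
  (forall x, 0 <= u x) -> (forall x, 0 <= v x) -> cross u v = cross v u.
Proof.
move=> mu1 mv u0 v0; rewrite /cross -[RHS]dint_swap; last 2 first.
- exact: m_cross.
- by move=> x y; rewrite !mulr_ge0.
congr (dint _ _); apply/funext => x; apply/funext => y.
by rewrite ksym [u x * _]mulrC.
Qed.

(** Expand [(u x - u y)^2]; each of the two squares integrates to [m * \int u^2], by the constant
    mass and the symmetry of [k]. *)
Lemma energy_cross u : measurable_fun setT u -> (forall x, 0 <= u x) ->
  (energy u + 2%:E * cross u u =
   2%:E * (m%:E * \int[mu]_x (u x ^+ 2)%:E))%E.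
Proof.
move=> mu1 u0.
have mu2 : measurable_fun setT (fun x => u x ^+ 2) by exact: measurable_funX.
have u20 x : 0 <= u x ^+ 2 by rewrite sqr_ge0.
have mc := m_cross mu1 mu1; have me := m_energy mu1.
have c0 x y : 0 <= k x y * (u x * u y) by rewrite !mulr_ge0.
have e0 x y : 0 <= k x y * (u x - u y) ^+ 2 by rewrite mulr_ge0// sqr_ge0.
have mf2 : measurable2 (fun x y => k x y * u x ^+ 2).
  by apply: measurable2M; [exact: mk|exact: measurable2_fst mu2].
have ms2 : measurable2 (fun x y => k x y * u y ^+ 2).
  by apply: measurable2M; [exact: mk|exact: measurable2_snd mu2].
have f0 x y : 0 <= k x y * u x ^+ 2 by rewrite mulr_ge0.
have s0 x y : 0 <= k x y * u y ^+ 2 by rewrite mulr_ge0.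
have twoe (z : \bar R) : (0 <= z)%E -> (2%:E * z = z + z)%E.
  by move=> z0; rewrite (_ : 2%:E = (1 + 1)%:E)// EFinD ge0_muleDl ?lee_fin// mul1e.
rewrite !twoe.
- rewrite -{1}(dint_kernel_fst mu2 u20) -(dint_kernel_snd mu2 u20).
  apply: dint_sum_eq => //.
  by move=> x y; ring.
- by rewrite mule_ge0// ?lee_fin//; apply: integral_ge0 => x _; rewrite lee_fin.
- exact: dint_ge0.
Qed.

(** This is [0 <= energy (u - v)], expanded and with the negative terms moved to the left; [u - v]
    itself may change sign. *)
Lemma energy_cross_le u v : measurable_fun setT u -> (forall x, 0 <= u x) ->
  measurable_fun setT v -> (forall x, 0 <= v x) ->
  (2%:E * (2%:E * (m%:E * \int[mu]_x (u x * v x)%:E)) <=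
   energy u + energy v + 2%:E * (2%:E * cross u v))%E.
Proof.
move=> mu1 u0 mv v0.
have -> : (2%:E * cross u v = cross u v + cross v u)%E.
  rewrite (_ : 2%:E = (1 + 1)%:E)// EFinD ge0_muleDl ?lee_fin// mul1e.
  by rewrite (crossC mv).
have muv : measurable_fun setT (fun x => u x * v x) by exact: measurable_funM.
have uv0 x : 0 <= u x * v x by rewrite mulr_ge0.
have -> : (2%:E * (m%:E * \int[mu]_x (u x * v x)%:E) =
   m%:E * \int[mu]_x (u x * v x)%:E + m%:E * \int[mu]_x (u x * v x)%:E)%E.
  rewrite (_ : 2%:E = (1 + 1)%:E)// EFinD ge0_muleDl ?lee_fin// mul1e.
  by [].
have mf1 : measurable2 (fun x y => k x y * (u x * v x)).
  by apply: measurable2M => //; exact: measurable2_fst.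
have ms1 : measurable2 (fun x y => k x y * (u y * v y)).
  by apply: measurable2M => //; exact: (measurable2_snd muv).
have f0 x y : 0 <= k x y * (u x * v x) by rewrite mulr_ge0.
have s0 x y : 0 <= k x y * (u y * v y) by rewrite mulr_ge0.
have c0 x y : 0 <= k x y * (u x * v y) by rewrite !mulr_ge0.
have d0 x y : 0 <= k x y * (v x * u y) by rewrite !mulr_ge0.
have e0 x y : 0 <= k x y * (u x - u y) ^+ 2 by rewrite mulr_ge0// sqr_ge0.
have g0 x y : 0 <= k x y * (v x - v y) ^+ 2 by rewrite mulr_ge0// sqr_ge0.
have mc := m_cross mu1 mv; have md := m_cross mv mu1.
have me := m_energy mu1; have mg := m_energy mv.
rewrite -{1}(dint_kernel_fst muv uv0) -(dint_kernel_snd muv uv0).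
apply: dint_sum_le => // x y; rewrite -subr_ge0.
have -> : k x y * (u x - u y) ^+ 2 + k x y * (v x - v y) ^+ 2 +
  2 * (k x y * (u x * v y) + k x y * (v x * u y)) -
  2 * (k x y * (u x * v x) + k x y * (u y * v y)) =
  k x y * ((u x - u y) - (v x - v y)) ^+ 2 by ring.
by rewrite mulr_ge0// sqr_ge0.
Qed.

Section resolvent.
Variables (lam : R) (A : set T).
Hypotheses (lam0 : 0 <= lam) (mA : measurable A) (Aoo : (mu A < +oo)%E).
Let f : T -> R := \1_A.

Let mf : measurable_fun setT f. Proof. exact: measurable_indic. Qed.
Let f0 x : 0 <= f x. Proof. by rewrite /f indicE. Qed.
Let f1 x : f x <= 1. Proof. by rewrite /f indicE; case: (x \in A). Qed.

Let c := (1 + lam * m)^-1.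
Let c1 : 0 < 1 + lam * m. Proof. by rewrite ltr_pwDl// mulr_ge0. Qed.
Let c0 : 0 <= c. Proof. by rewrite invr_ge0 ltW. Qed.

Local Open Scope ereal_scope.

(** The equation [(1 + lam * m) U = f + lam * \int k U] solved for its diagonal term. The map
    preserves order, so the iterates from [0] increase, and it maps the constant [1] below
    itself. *)
Let step (U : T -> \bar R) : T -> \bar R := fun x =>
  c%:E * ((f x)%:E + lam%:E * \int[mu]_y ((k x y)%:E * U y)).

Let U_ (j : nat) : T -> \bar R := iter j step (cst 0).

Let U_S j x : U_ j.+1 x =
  c%:E * ((f x)%:E + lam%:E * \int[mu]_y ((k x y)%:E * U_ j y)).
Proof. by []. Qed.

Let mkU (U : T -> \bar R) : measurable_fun setT U -> (forall x, 0 <= U x) ->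
  measurable_fun setT (fun p : T * T => (k p.1 p.2)%:E * U p.2).
Proof.
move=> mU U0; apply: emeasurable_funM.
  by apply/measurable_EFinP; exact: (measurable2P mk).
exact: (measurableT_comp mU measurable_snd).
Qed.

Let U_prop j : measurable_fun setT (U_ j) /\ (forall x, 0 <= U_ j x).
Proof.
elim: j => [|j [mU U0]]; first by split => //; exact: measurable_cst.
split => [|x]; last first.
  rewrite mule_ge0 ?lee_fin// adde_ge0 ?lee_fin// mule_ge0 ?lee_fin//.
  by apply: integral_ge0 => y _; rewrite mule_ge0 ?lee_fin.
rewrite /= /step; apply: measurable_funeM; apply: emeasurable_funD.
  exact/measurable_EFinP.
apply: measurable_funeM.
apply: (measurable_fun_fubini_tonelli_F (fun p : T * T => (k p.1 p.2)%:E * U_ j p.2)).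
  exact: mkU.
by move=> p; rewrite mule_ge0 ?lee_fin.
Qed.

Let mU j : measurable_fun setT (U_ j). Proof. by case: (U_prop j). Qed.
Let U0 j x : 0 <= U_ j x. Proof. by case: (U_prop j). Qed.

Let mkUx x j : measurable_fun setT (fun y => (k x y)%:E * U_ j y).
Proof. by apply: emeasurable_funM => //; exact/measurable_EFinP. Qed.

Let U_nd x : nondecreasing_seq (U_ ^~ x).
Proof.
apply/nondecreasing_seqP => j; elim: j x => [|j IH] x; first exact: U0.
rewrite 2!U_S lee_wpmul2l ?lee_fin// leeD2l// lee_wpmul2l ?lee_fin//.
apply: ge0_le_integral => //.
- by move=> y _; rewrite mule_ge0 ?lee_fin//; exact: U0.
- by move=> y _; rewrite lee_wpmul2l ?lee_fin//; exact: IH.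
Qed.

Let U1 j x : U_ j x <= 1.
Proof.
elim: j x => [|j IH] x; first by rewrite /= lee01.
have : \int[mu]_y ((k x y)%:E * U_ j y) <= m%:E.
  rewrite -(km x); apply: ge0_le_integral => //.
  - by move=> y _; rewrite mule_ge0 ?lee_fin//; exact: U0.
  - exact/measurable_EFinP.
  - by move=> y _; rewrite -[leRHS]mule1 lee_wpmul2l ?lee_fin//; exact: IH.
rewrite U_S => h.
apply: (@le_trans _ _ (c * (1 + lam * m))%:E).
  rewrite EFinM EFinD EFinM.
  by rewrite lee_wpmul2l ?lee_fin// leeD ?lee_fin// lee_wpmul2l ?lee_fin.
by rewrite lee_fin /c mulVf// gt_eqF.
Qed.

Let int_f : \int[mu]_x (f x)%:E = mu A.
Proof. by rewrite integral_indic// setIT. Qed.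

(** By Tonelli and the symmetry of [k], [\int \int k U = m * \int U]. Hence [step] preserves the
    bound, as [c * (mu A + lam * m * mu A) = mu A]. *)
Let intU j : \int[mu]_x U_ j x <= mu A.
Proof.
elim: j => [|j IH]; first by rewrite /= integral0.
have [a a0 aE] := ge0_fin_EFin (measure_ge0 mu A) Aoo.
have swapU : \int[mu]_x \int[mu]_y ((k x y)%:E * U_ j y) =
             m%:E * \int[mu]_x U_ j x.
  rewrite (fubini_tonelli (fun p : T * T => (k p.1 p.2)%:E * U_ j p.2))/=.
  - rewrite -ge0_integralZl ?lee_fin//.
    apply: eq_integral => y _; rewrite ge0_integralZr//.
    + by congr (_ * _); rewrite -(km y); apply: eq_integral => x _; rewrite ksym.
    + by apply/measurable_EFinP; exact: (measurable2_app y (measurable2_swap mk)).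
    + by move=> x _; rewrite lee_fin.
  - exact: mkU.
  - by move=> p; rewrite mule_ge0 ?lee_fin.
have mI : measurable_fun setT (fun x => \int[mu]_y ((k x y)%:E * U_ j y)).
  apply: (measurable_fun_fubini_tonelli_F (fun p : T * T => (k p.1 p.2)%:E * U_ j p.2)).
    exact: mkU.
  by move=> p; rewrite mule_ge0 ?lee_fin.
have I0 x : 0 <= \int[mu]_y ((k x y)%:E * U_ j y).
  by apply: integral_ge0 => y _; rewrite mule_ge0 ?lee_fin.
under eq_integral do rewrite U_S.
have mlI : measurable_fun setT
    (fun x => lam%:E * \int[mu]_y ((k x y)%:E * U_ j y)).
  exact: measurable_funeM.
have lI0 x : 0 <= lam%:E * \int[mu]_y ((k x y)%:E * U_ j y).
  by rewrite mule_ge0 ?lee_fin.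
have mEf : measurable_fun setT (EFin \o f) by exact/measurable_EFinP.
have Ef0 x : 0 <= (f x)%:E by rewrite lee_fin.
rewrite ge0_integralZl ?lee_fin//; last 2 first.
- exact: emeasurable_funD.
- by move=> x _; rewrite adde_ge0.
rewrite ge0_integralD//.
rewrite ge0_integralZl ?lee_fin// swapU int_f.
apply: (@le_trans _ _ (c%:E * (mu A + lam%:E * (m%:E * mu A)))).
  rewrite lee_wpmul2l ?lee_fin// leeD2l// lee_wpmul2l ?lee_fin//.
  by rewrite lee_wpmul2l ?lee_fin.
rewrite aE -[leLHS]/((c * (a + lam * (m * a)))%:E) lee_fin.
have -> : (c * (a + lam * (m * a)) = a * (c * (1 + lam * m)))%R by ring.
by rewrite /c mulVf ?mulr1// gt_eqF.
Qed.

Let V x := limn (U_ ^~ x).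

Let U_V x : U_ ^~ x @ \oo --> V x.
Proof. exact: ereal_nondecreasing_is_cvgn. Qed.

Let V0 x : 0 <= V x.
Proof. by apply: lime_ge; [exact: U_V|apply: nearW => j; exact: U0]. Qed.

Let V1 x : V x <= 1.
Proof. by apply: lime_le; [exact: U_V|apply: nearW => j; exact: U1]. Qed.

Let mV : measurable_fun setT V.
Proof. by apply: (emeasurable_fun_cvg U_) => // x _; exact: U_V. Qed.

Let V_fin x : V x \is a fin_num.
Proof. by rewrite ge0_fin_numE// (le_lt_trans (V1 x))// ltry. Qed.

Let V_fix x : V x = step V x.
Proof.
have hI : \int[mu]_y ((k x y)%:E * U_ j y) @[j --> \oo] -->
    \int[mu]_y ((k x y)%:E * V y).
  rewrite (_ : \int[mu]_y _ = \int[mu]_y limn (fun j => (k x y)%:E * U_ j y)).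
    apply: cvg_monotone_convergence => //.
    - by move=> j y _; rewrite mule_ge0 ?lee_fin.
    - by move=> y _ i j ij; rewrite lee_wpmul2l ?lee_fin//; exact: U_nd.
  apply: eq_integral => y _; apply/esym/cvg_lim => //.
  by apply: cvgeZl => //; exact: U_V.
have h : (fun j => U_ j.+1 x) @ \oo --> step V x.
  rewrite (_ : (fun j => U_ j.+1 x) = (fun j => c%:E * ((f x)%:E +
    lam%:E * \int[mu]_y ((k x y)%:E * U_ j y))))//.
  apply: cvgeZl => //; apply: cvgeD.
  - by rewrite ge0_adde_def// inE ?lee_fin// mule_ge0 ?lee_fin//;
      apply: integral_ge0 => y _; rewrite mule_ge0 ?lee_fin.
  - exact: cvg_cst.
  - exact: cvgeZl.
have h' : (fun j => U_ j.+1 x) @ \oo --> V x.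
  by have := @U_V x; rewrite -(cvg_shiftS (U_ ^~ x)).
exact: (cvg_unique _ h' h).
Qed.

Lemma resolvent_exists : exists phi : T -> R,
  [/\ measurable_fun setT phi, (forall x, 0 <= phi x <= 1)%R,
      \int[mu]_x (phi x)%:E <= mu A &
      forall x, ((1 + lam * m) * phi x)%:E =
        (\1_A x)%:E + lam%:E * \int[mu]_y (k x y * phi y)%:E].
Proof.
exists (fine \o V); have fV x : (fine (V x))%:E = V x by rewrite fineK.
split => /=.
- exact: measurableT_comp.
- by move=> x; rewrite -!lee_fin fV V0 V1.
- under eq_integral do rewrite fV.
  rewrite (_ : \int[mu]_x V x = limn (fun j => \int[mu]_x U_ j x)).
    apply: lime_le; last by apply: nearW => j; exact: intU.
    apply: ereal_nondecreasing_is_cvgn => i j ij.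
    by apply: ge0_le_integral => // x _; exact: U_nd.
  by rewrite /V monotone_convergence// => x _; exact: U_nd.
move=> x; rewrite EFinM fV {1}V_fix /step muleA -EFinM mulfV ?gt_eqF// mul1e.
by under [in RHS]eq_integral do rewrite EFinM fV.
Qed.

End resolvent.
End bounded_kernel.

(** * Energy estimates for bounded kernels *)

Section jump_kernel.
Context d (T : measurableType d) (R : realType).
Variable mu : {sigma_finite_measure set T -> \bar R}.
Implicit Types (k : T -> T -> R) (m : R) (u v phi : T -> R) (A : set T).
Local Open Scope ereal_scope.

Definition jump_kernel k m :=
  [/\ forall x y, (0 <= k x y)%R, forall x y, k x y = k y x, measurable2 k, (0 <= m)%R
    & forall x, \int[mu]_y (k x y)%:E = m%:E].

(** The equation [phi + lam * L_k phi = 1_A] with the diagonal part [m * phi] of [L_k phi] kept on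
    the left, so that both sides are nonnegative extended reals. The a priori bounds of the
    iteration are part of the package. *)
Definition resolvent k m (lam : R) A phi :=
  [/\ measurable_fun setT phi, (forall x, 0 <= phi x <= 1)%R,
      \int[mu]_x (phi x)%:E <= mu A &
      forall x, ((1 + lam * m) * phi x)%:E =
        (\1_A x)%:E + lam%:E * \int[mu]_y (k x y * phi y)%:E].

Lemma integral_sq_dist u v : measurable_fun setT u -> measurable_fun setT v ->
  (forall x, 0 <= u x)%R -> (forall x, 0 <= v x)%R ->
  \int[mu]_x ((u x - v x) ^+ 2)%:E +
    (\int[mu]_x (u x * v x)%:E + \int[mu]_x (u x * v x)%:E) =
  \int[mu]_x (u x ^+ 2)%:E + \int[mu]_x (v x ^+ 2)%:E.
Proof.
move=> mu1 mv u0 v0.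
have muv : measurable_fun setT (fun x => u x * v x)%R by exact: measurable_funM.
have mu2 : measurable_fun setT (fun x => u x ^+ 2)%R by exact: measurable_funX.
have mv2 : measurable_fun setT (fun x => v x ^+ 2)%R by exact: measurable_funX.
have md : measurable_fun setT (fun x => (u x - v x) ^+ 2)%R.
  by apply: measurable_funX; exact: measurable_funB.
have uv0 x : (0 <= u x * v x)%R by rewrite mulr_ge0.
rewrite -!ge0_integralD_EFin//.
- by apply: eq_integral => x _; congr (_%:E); ring.
- by move=> x; rewrite sqr_ge0.
- by move=> x; rewrite sqr_ge0.
- exact: measurable_funD.
- by move=> x; rewrite sqr_ge0.
- by move=> x; rewrite addr_ge0.
Qed.

Lemma integral_01_fin A u v : mu A < +oo -> measurable_fun setT u ->
  measurable_fun setT v -> \int[mu]_x (u x)%:E <= mu A ->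
  (forall x, 0 <= u x)%R -> (forall x, 0 <= v x <= 1)%R ->
  exists2 r, (0 <= r)%R & \int[mu]_x (u x * v x)%:E = r%:E.
Proof.
move=> Aoo mu1 mv iu u0 v01; apply: ge0_fin_EFin.
  by apply: integral_ge0 => x _; rewrite lee_fin mulr_ge0//; case/andP: (v01 x).
apply: le_lt_trans Aoo; apply: le_trans iu; apply: ge0_le_integral => //.
- by move=> x _; rewrite lee_fin mulr_ge0//; case/andP: (v01 x).
- by apply/measurable_EFinP; exact: measurable_funM.
- exact/measurable_EFinP.
- by move=> x _; rewrite lee_fin ler_piMr//; case/andP: (v01 x).
Qed.

Lemma cross_fin k m A u v : jump_kernel k m -> mu A < +oo ->
  measurable_fun setT u ->
  measurable_fun setT v -> \int[mu]_x (u x)%:E <= mu A ->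
  (forall x, 0 <= u x)%R -> (forall x, 0 <= v x <= 1)%R ->
  exists2 r, (0 <= r)%R & cross mu k v u = r%:E.
Proof.
move=> [k0 ksym mk m0 km] Aoo mu1 mv iu u0 v01.
have v0 x : (0 <= v x)%R by case/andP: (v01 x).
apply: ge0_fin_EFin.
  by apply: dint_ge0 => x y; rewrite !mulr_ge0.
apply: (@le_lt_trans _ _ (m%:E * \int[mu]_x (u x)%:E)).
  rewrite -(dint_kernel_snd k0 ksym mk m0 km mu1 u0); apply: le_dint.
  - apply: measurable2M mk _.
    exact: measurable2M (measurable2_fst mv) (measurable2_snd mu1).
  - exact: measurable2M mk (measurable2_snd mu1).
  - by move=> x y; rewrite !mulr_ge0.
  - by move=> x y; rewrite ler_wpM2l// ler_piMl//; case/andP: (v01 x).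
by apply: lte_mul_pinfty => //; exact: le_lt_trans iu Aoo.
Qed.

Lemma energy_fin k m u r : jump_kernel k m -> measurable_fun setT u ->
  (forall x, 0 <= u x)%R -> \int[mu]_x (u x ^+ 2)%:E = r%:E ->
  exists2 e, (0 <= e)%R & energy mu k u = e%:E.
Proof.
move=> [k0 ksym mk m0 km] mu1 u0 ur.
have := energy_cross k0 ksym mk m0 km mu1 u0; rewrite ur => e.
apply: ge0_fin_EFin; first exact: energy_ge0.
apply: (@le_lt_trans _ _ (energy mu k u + 2%:E * cross mu k u u)).
  rewrite leeDl// mule_ge0//; apply: dint_ge0 => x y; by rewrite !mulr_ge0.
by rewrite e -!EFinM ltry.
Qed.

(** Multiply the equation by [v], integrate and use Tonelli; with [v >= 0] all terms live in
    [[0, +oo]]. *)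
Lemma resolvent_test k m lam A phi v : jump_kernel k m -> (0 <= lam)%R ->
  measurable A -> resolvent k m lam A phi ->
  measurable_fun setT v -> (forall x, 0 <= v x)%R ->
  (1 + lam * m)%:E * \int[mu]_x (phi x * v x)%:E =
  \int[mu]_x (\1_A x * v x)%:E + lam%:E * cross mu k v phi.
Proof.
move=> [k0 ksym mk m0 km] lam0 mA [mphi phi01 iphi eq] mv v0.
have phi0 x : (0 <= phi x)%R by case/andP: (phi01 x).
have c0 : (0 <= 1 + lam * m)%R by rewrite addr_ge0// mulr_ge0.
have mkphi : measurable2 (fun x y => k x y * phi y)%R.
  exact: measurable2M mk (measurable2_snd mphi).
have kphi0 x y : (0 <= k x y * phi y)%R by rewrite mulr_ge0.
have I0 x : 0 <= \int[mu]_y (k x y * phi y)%:E.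
  by apply: integral_ge0 => y _; rewrite lee_fin.
have mI : measurable_fun setT (fun x => \int[mu]_y (k x y * phi y)%:E).
  exact: measurable_inner.
have -> : cross mu k v phi =
    \int[mu]_x ((v x)%:E * \int[mu]_y (k x y * phi y)%:E).
  rewrite /cross dint.unlock; apply: eq_integral => x _.
  rewrite -ge0_integralZl ?lee_fin//.
  - by apply: eq_integral => y _; rewrite -EFinM; congr (_%:E); ring.
  - by apply/measurable_EFinP; exact: (measurable2_app x mkphi).
  - by move=> y _; rewrite lee_fin.
have mvI : measurable_fun setT
    (fun x => (v x)%:E * \int[mu]_y (k x y * phi y)%:E).
  by apply: emeasurable_funM => //; exact/measurable_EFinP.
have vI0 x : 0 <= (v x)%:E * \int[mu]_y (k x y * phi y)%:E.
  by rewrite mule_ge0// lee_fin.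
have mlvI : measurable_fun setT
    (fun x => lam%:E * ((v x)%:E * \int[mu]_y (k x y * phi y)%:E)).
  exact: measurable_funeM.
have lvI0 x : 0 <= lam%:E * ((v x)%:E * \int[mu]_y (k x y * phi y)%:E).
  by rewrite mule_ge0// lee_fin.
have mAv : measurable_fun setT (fun x => (\1_A x * v x)%:E).
  by apply/measurable_EFinP; apply: measurable_funM => //; exact: measurable_indic.
have Av0 x : 0 <= (\1_A x * v x)%:E.
  by rewrite lee_fin mulr_ge0// indicE.
rewrite -ge0_integralZl ?lee_fin//; last 2 first.
- by apply/measurable_EFinP; exact: measurable_funM.
- by move=> x _; rewrite lee_fin mulr_ge0.
rewrite -ge0_integralZl ?lee_fin// -ge0_integralD//.
apply: eq_integral => x _.
rewrite (_ : _ * _ = ((1 + lam * m) * phi x)%:E * (v x)%:E); last first.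
  by rewrite -[LHS]/(((1 + lam * m) * (phi x * v x))%:E) mulrA.
have A0 : 0 <= (\1_A x)%:E :> \bar R by rewrite lee_fin indicE.
have lI0 : 0 <= lam%:E * \int[mu]_y (k x y * phi y)%:E.
  by rewrite mule_ge0// lee_fin.
rewrite eq ge0_muleDl//.
by congr (_ + _); rewrite -muleA; congr (_ * _); rewrite muleC.
Qed.

Section resolvent_theory.
Variables (lam : R) (A : set T).
Hypotheses (lam0 : (0 <= lam)%R) (mA : measurable A) (Aoo : mu A < +oo).

Let indic01 (x : T) : (0 <= (\1_A x : R) <= 1)%R.
Proof. by rewrite indicE; case: (x \in A); rewrite ?lexx ?ler01. Qed.

Let indic0 (x : T) : (0 <= (\1_A x : R))%R.
Proof. by case/andP: (indic01 x). Qed.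

Let mindic : measurable_fun setT (\1_A : T -> R).
Proof. exact: measurable_indic. Qed.

Let iindic : \int[mu]_x (\1_A x)%:E <= mu A.
Proof. by rewrite integral_indic// setIT. Qed.

Let indic_sq (x : T) : (\1_A x * \1_A x = \1_A x :> R)%R.
Proof. by rewrite indicE; case: (x \in A); rewrite ?mulr1 ?mulr0. Qed.

Let integral_indic_sq :
  \int[mu]_x ((\1_A x : R) ^+ 2)%:E = \int[mu]_x (\1_A x)%:E.
Proof. by apply: eq_integral => x _; rewrite expr2 indic_sq. Qed.

Let integral_indic_compl phi : measurable_fun setT phi ->
  (forall x, 0 <= phi x <= 1)%R ->
  \int[mu]_x (\1_A x * (1 - phi x))%:E + \int[mu]_x (\1_A x * phi x)%:E =
  \int[mu]_x (\1_A x)%:E.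
Proof.
move=> mphi phi01; rewrite -ge0_integralD//=.
- by apply: eq_integral => x _; congr (_%:E); ring.
- by move=> x _; rewrite lee_fin mulr_ge0// subr_ge0; case/andP: (phi01 x).
- apply/measurable_EFinP; apply: measurable_funM => //.
  exact: measurable_funB.
- by move=> x _; rewrite lee_fin mulr_ge0//; case/andP: (phi01 x).
- by apply/measurable_EFinP; exact: measurable_funM.
Qed.

(* The resolvent equation tested against [phi] itself. *)
Lemma resolvent_self k m phi : jump_kernel k m -> resolvent k m lam A phi ->
  exists a e i : R, [/\ (0 <= e)%R, \int[mu]_x (phi x ^+ 2)%:E = a%:E,
    energy mu k phi = e%:E, \int[mu]_x (\1_A x * phi x)%:E = i%:E &
    i = (a + lam * e / 2)%R].
Proof.
move=> Kk Rphi; have [mphi phi01 iphi _] := Rphi.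
have phi0 x : (0 <= phi x)%R by case/andP: (phi01 x).
have [a a0 aE] := integral_01_fin Aoo mphi mphi iphi phi0 phi01.
have aE2 : \int[mu]_x (phi x ^+ 2)%:E = a%:E by rewrite -aE.
have [e e0 eE] := energy_fin Kk mphi phi0 aE2.
have [i i0 iE] := integral_01_fin Aoo mindic mphi iindic indic0 phi01.
have [s s0 sE] := cross_fin Kk Aoo mphi mphi iphi phi0 phi01.
exists a, e, i; split => //.
have := resolvent_test Kk lam0 mA Rphi mphi phi0.
case: (Kk) => [k0 ksym mk m0 km].
have := energy_cross k0 ksym mk m0 km mphi phi0.
rewrite eE sE aE2 ?aE iE -!EFinM -!EFinD => -[h1] [h2].
(* The test with [phi] reads [(1 + lam * m) * a = i + lam * s]; the cross term [s] is eliminated by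
   [e + 2 * s = 2 * (m * a)], multiplied by [lam] to make the combination linear. *)
have : (lam * (e + 2 * s) = lam * (2 * (m * a)))%R by rewrite h1.
lra.
Qed.

(** Test the equation for [phi] with [phi']. By [energy_cross_le] the mixed energy is at most the
    half sum of the energies for [k], and [energy k phi' <= energy k' phi']. With [resolvent_self]
    for both functions the energies cancel, and the drop of [\int 1_A phi] from [k] to [k'] controls
    the distance. *)
Lemma resolvent_cauchy k m k' m' phi phi' :
  jump_kernel k m -> jump_kernel k' m' -> (forall x y, k x y <= k' x y)%R ->
  resolvent k m lam A phi -> resolvent k' m' lam A phi' ->
  \int[mu]_x ((phi x - phi' x) ^+ 2)%:E + \int[mu]_x (\1_A x * phi' x)%:E <=
  \int[mu]_x (\1_A x * phi x)%:E.
Proof.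
move=> Kk Kk' kk' Rphi Rphi'.
have [mphi phi01 iphi _] := Rphi; have [mphi' phi01' iphi' _] := Rphi'.
have phi0 x : (0 <= phi x)%R by case/andP: (phi01 x).
have phi0' x : (0 <= phi' x)%R by case/andP: (phi01' x).
have [a [e [i [e0 aE eE iE ie]]]] := resolvent_self Kk Rphi.
have [a' [e' [i' [e0' aE' eE' iE' ie']]]] := resolvent_self Kk' Rphi'.
have [p p0 pE] := integral_01_fin Aoo mphi mphi' iphi phi0 phi01'.
have [x x0 xE] := cross_fin Kk Aoo mphi mphi' iphi phi0 phi01'.
have [f f0 fE] := energy_fin Kk mphi' phi0' aE'.
have fe : (f <= e')%R.
  rewrite -lee_fin -fE -eE'; case: Kk => k0 _ mk _ _; case: Kk' => k0' _ mk' _ _.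
  have md : measurable2 (fun x y => (phi' x - phi' y) ^+ 2)%R.
    by apply/measurable2X/measurable2B; [exact: measurable2_fst|exact: measurable2_snd].
  apply: le_dint.
  - exact: measurable2M.
  - exact: measurable2M.
  - by move=> ? ?; rewrite mulr_ge0// sqr_ge0.
  - by move=> ? ?; rewrite ler_wpM2r// sqr_ge0.
have := integral_sq_dist mphi mphi' phi0 phi0'.
have := resolvent_test Kk lam0 mA Rphi mphi' phi0'.
case: (Kk) => [k0 ksym mk m0 km].
have := energy_cross_le k0 ksym mk m0 km mphi' phi0' mphi phi0.
under eq_integral do rewrite mulrC.
rewrite pE eE fE xE iE iE' aE aE' -!EFinM -!EFinD lee_fin => h1 [h2].
have [s s0 ->] : exists2 s, (0 <= s)%R &
    \int[mu]_x ((phi x - phi' x) ^+ 2)%:E = s%:E.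
  have := integral_sq_dist mphi mphi' phi0 phi0'.
  rewrite pE aE aE' => h; apply: ge0_fin_EFin.
    by apply: integral_ge0 => y _; rewrite lee_fin sqr_ge0.
  by move: h; case: (\int[mu]_x ((phi x - phi' x) ^+ 2)%:E) => [r _|//|_]; rewrite ?ltry ?ltNyr.
rewrite -!EFinD => -[h3]; rewrite lee_fin.
have h4 := ler_wpM2l lam0 h1.
have h5 := ler_wpM2l lam0 fe.
lra.
Qed.

Lemma resolvent_energy_eq k m phi : jump_kernel k m -> resolvent k m lam A phi ->
  \int[mu]_x ((\1_A x - phi x) ^+ 2)%:E + (lam / 2)%:E * energy mu k phi =
  \int[mu]_x (\1_A x * (1 - phi x))%:E.
Proof.
move=> Kk Rphi; have [mphi phi01 iphi _] := Rphi.
have phi0 x : (0 <= phi x)%R by case/andP: (phi01 x).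
have [a [e [i [e0 aE eE iE ie]]]] := resolvent_self Kk Rphi.
have := integral_sq_dist mindic mphi indic0 phi0.
have := integral_indic_compl mphi phi01.
have [f fE] : exists f, \int[mu]_x (\1_A x)%:E = f%:E.
  have [f f0 fE] := integral_01_fin Aoo mindic mindic iindic indic0 indic01.
  by exists f; rewrite -fE; apply: eq_integral => x _; rewrite indic_sq.
rewrite integral_indic_sq iE aE eE fE.
case: (\int[mu]_x (\1_A x * (1 - phi x))%:E) => [p||]//.
case: (\int[mu]_x ((\1_A x - phi x) ^+ 2)%:E) => [q||]//.
rewrite -!EFinM -!EFinD => -[h1] [h2]; congr (_%:E).
lra.
Qed.

(** Compares the resolvent with the competitor [\1_A]. Testing with [\1_A] and [energy_cross_le]
    bound the left side [p] by [lam / 4] times the sum of the energies of [\1_A] and [phi]; as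
    [lam / 2 * energy phi <= p] by the energy identity, the second contribution is at most [p / 2]
    and is absorbed. *)
Lemma resolvent_le_energy k m phi : jump_kernel k m -> resolvent k m lam A phi ->
  \int[mu]_x (\1_A x * (1 - phi x))%:E <= (lam / 2)%:E * energy mu k (\1_A).
Proof.
move=> Kk Rphi; have [mphi phi01 iphi _] := Rphi.
have phi0 x : (0 <= phi x)%R by case/andP: (phi01 x).
have [a [e [i [e0 aE eE iE ie]]]] := resolvent_self Kk Rphi.
have := integral_sq_dist mindic mphi indic0 phi0.
have := integral_indic_compl mphi phi01.
have [f fE] : exists f, \int[mu]_x (\1_A x)%:E = f%:E.
  have [f f0 fE] := integral_01_fin Aoo mindic mindic iindic indic0 indic01.
  by exists f; rewrite -fE; apply: eq_integral => x _; rewrite indic_sq.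
have [b b0 bE] : exists2 b, (0 <= b)%R & energy mu k \1_A = b%:E.
  by apply: (energy_fin Kk mindic indic0); rewrite integral_indic_sq fE.
have [x x0 xE] := cross_fin Kk Aoo mphi mindic iphi phi0 indic01.
have := resolvent_test Kk lam0 mA Rphi mindic indic0.
case: (Kk) => [k0 ksym mk m0 km].
have := energy_cross_le k0 ksym mk m0 km mindic indic0 mphi phi0.
have -> : \int[mu]_x (phi x * \1_A x)%:E = i%:E.
  by rewrite -iE; apply: eq_integral => y _; rewrite mulrC.
have -> : \int[mu]_x (\1_A x * \1_A x)%:E = f%:E.
  by rewrite -fE; apply: eq_integral => y _; rewrite indic_sq.
rewrite ?integral_indic_sq iE aE eE ?fE bE xE -!EFinM -!EFinD lee_fin => h1 [h2].
have : 0 <= \int[mu]_x ((\1_A x - phi x) ^+ 2)%:E.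
  by apply: integral_ge0 => y _; rewrite lee_fin sqr_ge0.
case: (\int[mu]_x (\1_A x * (1 - phi x))%:E) => [p||]//.
case: (\int[mu]_x ((\1_A x - phi x) ^+ 2)%:E) => [q||]//.
rewrite -!EFinD !lee_fin => q0 [h3] [h4].
have h5 := ler_wpM2l lam0 h1.
lra.
Qed.

End resolvent_theory.
End jump_kernel.

(** * Almost everywhere convergence *)

(** Either [|t| <= 1/p] or [|t| <= p t^2]. It trades a weighted square for a first power; with
    [p = 2^j] both terms become summable in [ae_cauchy_cvg]. *)
Lemma normr_le_weighted (R : realFieldType) (t p : R) : 0 < p ->
  `|t| <= p^-1 + p * t ^+ 2.
Proof.
move=> p0; rewrite -[t ^+ 2]real_normK ?num_real//; set n := `|t|.
have n0 : 0 <= n by rewrite /n.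
have -> : p^-1 + p * n ^+ 2 = (1 + (p * n) ^+ 2) / p by field; rewrite gt_eqF.
by rewrite ler_pdivlMr//; nra.
Qed.

Section ae_convergence.
Context d (T : measurableType d) (R : realType).
Variable mu : {measure set T -> \bar R}.
Local Open Scope ereal_scope.

(** The hypothesis is an inequality rather than a limit, so that the lemma applies to the inner
    integrals of a double integral, for which Fatou gives just that. *)
Lemma fatou_ae (g_ : nat -> T -> \bar R) (g : T -> \bar R) :
  (forall j, measurable_fun setT (g_ j)) -> measurable_fun setT g ->
  (forall j x, 0 <= g_ j x) -> (forall x, 0 <= g x) ->
  {ae mu, forall x, g x <= limn_einf (g_ ^~ x)} ->
  \int[mu]_x g x <= limn_einf (fun j => \int[mu]_x g_ j x).
Proof.
move=> mg_ mg g_0 g0 cvg.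
have mL : measurable_fun setT (fun x => limn_einf (g_ ^~ x)).
  apply: (emeasurable_fun_cvg (fun n x => einfs (g_ ^~ x) n)).
    by move=> n; exact: measurable_fun_einfs.
  by move=> x _; rewrite limn_einf_lim; exact: is_cvg_einfs.
have L0 x : 0 <= limn_einf (g_ ^~ x).
  rewrite limn_einf_lim; apply: lime_ge; first exact: is_cvg_einfs.
  by apply: nearW => n; apply: le_ereal_inf_tmp => _ [m _ <-].
apply: le_trans (fatou mu measurableT mg_ (fun j x _ => g_0 j x)).
apply: ae_ge0_le_integral => //.
by apply: filterS cvg.
Qed.

Lemma fatou_ae_cvg (g_ : nat -> T -> R) (g : T -> R) :
  (forall j, measurable_fun setT (g_ j)) -> measurable_fun setT g ->
  (forall j x, 0 <= g_ j x)%R -> (forall x, 0 <= g x)%R ->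
  {ae mu, forall x, g_ ^~ x @ \oo --> g x} ->
  \int[mu]_x (g x)%:E <= limn_einf (fun j => \int[mu]_x (g_ j x)%:E).
Proof.
move=> mg_ mg g_0 g0 cvg; apply: fatou_ae.
- by move=> j; exact/measurable_EFinP.
- exact/measurable_EFinP.
- by move=> j x; rewrite lee_fin.
- by move=> x; rewrite lee_fin.
apply: filterS cvg => x gx.
have h : (g_ j x)%:E @[j --> \oo] --> (g x)%:E.
  by apply: cvg_EFin; [exact: nearW|exact: gx].
by rewrite (cvg_limn_einf_sup h).1.
Qed.

Lemma limn_einf_le_cvg (u v : nat -> \bar R) (l : \bar R) :
  (forall j, u j <= v j) -> v @ \oo --> l -> limn_einf u <= l.
Proof.
move=> uv vl; rewrite -(cvg_limn_einf_sup vl).1 !limn_einf_lim.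
apply: lee_lim; [exact: is_cvg_einfs|exact: is_cvg_einfs|].
apply: nearW => n; apply: le_ereal_inf_tmp => _ [m nm <-].
by apply: le_trans (uv m); apply: ereal_inf_lbound; exists m.
Qed.

(** Termwise integration shows that the sum of the series is integrable, hence finite almost
    everywhere. *)
Lemma summable_ae (g_ : nat -> T -> R) :
  (forall j, measurable_fun setT (g_ j)) -> (forall j x, (0 <= g_ j x)%R) ->
  \sum_(j <oo) \int[mu]_x (g_ j x)%:E < +oo ->
  {ae mu, forall x, cvgn (series (g_ ^~ x))}.
Proof.
move=> mg g0; rewrite -integral_nneseries//; last 2 first.
- by move=> j; exact/measurable_EFinP.
- by move=> j x _; rewrite lee_fin.
move=> foo.
have sg0 x : 0 <= \sum_(j <oo) (g_ j x)%:E.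
  by apply: nneseries_ge0 => j _ _; rewrite lee_fin.
have : mu.-integrable setT (fun x => \sum_(j <oo) (g_ j x)%:E).
  apply/integrableP; split.
    apply: ge0_emeasurable_sum => //.
    - by move=> j x _ _; rewrite lee_fin.
    - by move=> j _; exact/measurable_EFinP.
  by under eq_integral do rewrite gee0_abs//.
move/integrable_ae => /(_ measurableT); apply: filterS => x /(_ I).
rewrite ge0_fin_numE// => sfin.
apply: nondecreasing_is_cvgn.
  apply/nondecreasing_seqP => j; rewrite seriesEnat/= big_nat_recr//= lerDl//.
exists (fine (\sum_(j <oo) (g_ j x)%:E)) => _ [j _ <-].
rewrite -lee_fin fineK ?ge0_fin_numE// seriesEnat/= -sumEFin.
by apply: nneseries_lim_ge => i _ _; rewrite lee_fin.
Qed.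

Lemma summable_ae_cvg0 (g_ : nat -> T -> R) :
  (forall j, measurable_fun setT (g_ j)) -> (forall j x, (0 <= g_ j x)%R) ->
  \sum_(j <oo) \int[mu]_x (g_ j x)%:E < +oo ->
  {ae mu, forall x, g_ ^~ x @ \oo --> 0%R}.
Proof.
move=> mg g0 foo; have := summable_ae mg g0 foo.
by apply: filterS => x /cvg_series_cvg_0.
Qed.

Lemma geometric_sum_lty (a : nat -> \bar R) (C rho : R) :
  (0 <= rho < 1)%R ->
  (forall j, 0 <= a j) -> (forall j, a j <= (C * rho ^+ j)%:E) ->
  \sum_(j <oo) a j < +oo.
Proof.
move=> /andP[rho0 rho1] a0 aC.
apply: (@le_lt_trans _ _ (\sum_(j <oo) (C * rho ^+ j)%:E)).
  by apply: lee_nneseries => // j _; exact: aC.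
have h : series (fun j => C * rho ^+ j)%R @ \oo --> (C / (1 - rho))%R.
  by apply: cvg_geometric_series; rewrite ger0_norm.
have -> : \sum_(j <oo) (C * rho ^+ j)%:E = (C / (1 - rho))%:E.
  apply/cvg_lim => //; rewrite (_ : (fun _ => _) =
    EFin \o series (fun j => C * rho ^+ j)%R).
    by apply: cvg_EFin; [exact: nearW|exact: h].
  by apply/funext => j /=; rewrite seriesEnat/= sumEFin.
exact: ltry.
Qed.

(** On a space of infinite measure the [L^2] bound gives no [L^1] bound on the increments. Instead
    [\sum 2^j (u_j - u_(j+1))^2] has an integral at most [\sum 2^-j], so it converges almost
    everywhere, and [|u_j - u_(j+1)| <= 2^-j + 2^j (u_j - u_(j+1))^2] is summable there. *)
Lemma ae_cauchy_cvg (u_ : nat -> T -> R) :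
  (forall j, measurable_fun setT (u_ j)) ->
  (forall j, \int[mu]_x ((u_ j x - u_ j.+1 x) ^+ 2)%:E <= (4^-1 ^+ j)%:E) ->
  {ae mu, forall x, cvgn (u_ ^~ x)}.
Proof.
move=> mu_ du.
pose g_ j x := (2 ^+ j * (u_ j x - u_ j.+1 x) ^+ 2)%R.
have md j : measurable_fun setT (fun x => (u_ j x - u_ j.+1 x) ^+ 2)%R.
  by apply: measurable_funX; exact: measurable_funB.
have mg j : measurable_fun setT (g_ j) by exact: measurable_funM.
have g0 j x : (0 <= g_ j x)%R by apply: mulr_ge0; rewrite ?sqr_ge0// exprn_ge0.
have := summable_ae mg g0.
have -> : \sum_(j <oo) \int[mu]_x (g_ j x)%:E < +oo.
  apply: (@geometric_sum_lty _ 1 2^-1) => [|j|j].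
    by rewrite invr_ge0 ler0n invf_lt1 ?ltr1n.
    by apply: integral_ge0 => x _; rewrite lee_fin.
  rewrite /g_ ge0_integralZ_EFin ?exprn_ge0//; last first.
    by move=> x; rewrite sqr_ge0.
  apply: (@le_trans _ _ ((2 ^+ j)%:E * (4^-1 ^+ j)%:E)).
    by rewrite lee_wpmul2l// lee_fin exprn_ge0.
  rewrite -EFinM lee_fin mul1r -exprMn_comm; last exact: mulrC.
  by rewrite (_ : 2 * 4^-1 = 2^-1)%R//; field.
move=> /(_ isT); apply: filterS => x cg.
have cgeo : cvgn (series (fun j => 2^-1 ^+ j : R)%R).
  rewrite (_ : (fun j => _) = geometric 1 2^-1); last first.
    by apply/funext => j; rewrite /geometric/= mul1r.
  by apply: is_cvg_geometric_series; rewrite ger0_norm ?invr_ge0// invf_lt1 ?ltr1n.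
have cd : cvgn (series (fun j => `|u_ j.+1 x - u_ j x|%R)).
  apply: (@series_le_cvg _ _ (fun j => 2^-1 ^+ j + g_ j x)%R).
  - by move=> j.
  - by move=> j; rewrite addr_ge0// exprn_ge0.
  - by move=> j; rewrite /g_ distrC exprVn; apply: normr_le_weighted; rewrite exprn_gt0.
  - exact: is_cvg_seriesD cgeo cg.
have : cvgn (series (telescope (u_ ^~ x))).
  exact: normed_cvg.
rewrite /= => ct.
have -> : u_ ^~ x = (fun j => u_ 0%N x + series (telescope (u_ ^~ x)) j)%R.
  by apply/funext => j; rewrite -eq_sum_telescope.
by apply: is_cvgD => //; exact: is_cvg_cst.
Qed.

End ae_convergence.

(** * Weak formulation *)

Section real_integrals.
Context d (T : measurableType d) (R : realType).
Variable mu : {measure set T -> \bar R}.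
Implicit Types (g h : T -> R).

Lemma EFin_Rintegral g : mu.-integrable setT (EFin \o g) ->
  (\int[mu]_x g x)%:E = (\int[mu]_x (g x)%:E)%E.
Proof. by move=> ig; rewrite fineK//; exact: integrable_fin_num. Qed.

Lemma integrableMl_bounded g h M : measurable_fun setT g ->
  (forall x, `|g x| <= M) -> mu.-integrable setT (EFin \o h) ->
  mu.-integrable setT (EFin \o (fun x => g x * h x)).
Proof.
move=> mg gM ih; have mh : measurable_fun setT h.
  by apply/measurable_EFinP; exact: measurable_int ih.
have := integrableZl measurableT (`|M|) ih.
apply: le_integrable => //.
- by apply/measurable_EFinP; exact: measurable_funM.
- move=> x _ /=; rewrite lee_fin !normrM normr_id.
  by rewrite ler_wpM2r// (le_trans (gM x))// ler_norm.
Qed.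

Lemma integrable_norm_lty g : measurable_fun setT g ->
  (\int[mu]_x (`|g x|)%:E < +oo)%E -> mu.-integrable setT (EFin \o g).
Proof. by move=> mg goo; apply/integrableP; split => //; exact/measurable_EFinP. Qed.

Lemma integrableB_real g h : mu.-integrable setT (EFin \o g) ->
  mu.-integrable setT (EFin \o h) ->
  mu.-integrable setT (EFin \o (fun x => g x - h x)).
Proof.
move=> ig ih; have -> : EFin \o (fun x => g x - h x) =
  ((EFin \o g) \- (EFin \o h))%E by apply/funext => x /=; rewrite EFinB.
exact: integrableB.
Qed.

Lemma integrableD_real g h : mu.-integrable setT (EFin \o g) ->
  mu.-integrable setT (EFin \o h) ->
  mu.-integrable setT (EFin \o (fun x => g x + h x)).
Proof.
move=> ig ih; have -> : EFin \o (fun x => g x + h x) =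
  ((EFin \o g) \+ (EFin \o h))%E by apply/funext => x /=; rewrite EFinD.
exact: integrableD.
Qed.

Lemma integrableZ_real g c : mu.-integrable setT (EFin \o g) ->
  mu.-integrable setT (EFin \o (fun x => c * g x)).
Proof.
move=> ig; have -> : EFin \o (fun x => c * g x) =
  (fun x => c%:E * (g x)%:E)%E by apply/funext => x /=; rewrite EFinM.
exact: integrableZl.
Qed.

End real_integrals.

Section jump_operator.
Context d (T : measurableType d) (R : realType).
Variable mu : {sigma_finite_measure set T -> \bar R}.
Implicit Types (k : T -> T -> R) (psi phi : T -> R).

(** The operator [L_k] as an ordinary integral: no principal value and no constant [c_ns]. *)
Definition jump_op k psi x : R := \int[mu]_y ((psi x - psi y) * k x y).

(** What makes [jump_op k psi] an absolutely convergent integral at every point and an integrable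
    function overall. For the singular kernel it holds on test functions. *)
Definition jump_integrable k psi :=
  [/\ measurable_fun setT psi, mu.-integrable setT (EFin \o psi),
      forall x, mu.-integrable setT (EFin \o (fun y => (psi x - psi y) * k x y)) &
      (dint mu (fun x y => `|psi x - psi y| * k x y)%R < +oo)%E].

Lemma measurable_jump_op k psi : measurable2 k ->
  (forall x y, 0 <= k x y) -> jump_integrable k psi ->
  measurable_fun setT (jump_op k psi).
Proof.
move=> mk k0 [mpsi _ _ foo].
apply: measurableT_comp => //.
apply: (measurable_fubini_F (f := fun p : T * T => ((psi p.1 - psi p.2) * k p.1 p.2)%:E)).
have md : measurable2 (fun x y => (psi x - psi y) * k x y).
  apply: measurable2M mk; apply: measurable2B.
    exact: measurable2_fst.
  exact: measurable2_snd.
apply/integrable12ltyP.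
  by apply/measurable_EFinP; exact: (measurable2P md).
move: foo; rewrite dint.unlock.
under eq_integral do under eq_integral do rewrite -[k _ _]ger0_norm// -normrM.
exact.
Qed.

(** With [L_k psi = m * psi - W] and the pointwise equation for [phi], the claim reduces to the
    self-adjointness [\int psi (\int k phi) = \int phi (\int k psi)], which is Fubini together with
    the symmetry of [k]. *)
Lemma resolvent_weak k m lam A phi psi : 0 <= lam -> measurable A ->
  jump_kernel mu k m -> resolvent mu k m lam A phi -> jump_integrable k psi ->
  \int[mu]_x (phi x * (psi x + lam * jump_op k psi x)) =
  \int[mu]_x (\1_A x * psi x).
Proof.
move=> lam0 mA [k0 ksym mk m0 km] [mphi phi01 iphi eq] [mpsi ipsi ijump _].
have mkx x : measurable_fun setT (k x) by exact: measurable2_app.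
have ik x : mu.-integrable setT (EFin \o k x).
  apply: integrable_norm_lty => //.
  by under eq_integral do rewrite ger0_norm//; rewrite km ltry.
have phiM x : `|phi x| <= 1.
  by case/andP: (phi01 x) => ? ?; rewrite ger0_norm.
have indM x : `|\1_A x : R| <= 1.
  by rewrite indicE ger0_norm//; case: (x \in A).
have ikpsi x : mu.-integrable setT (EFin \o (fun y => k x y * psi y)).
  have := integrableB_real (integrableZ_real (psi x) (ik x)) (ijump x).
  by congr (_.-integrable _ _); apply/funext => y /=; congr (_%:E); ring.
have ikphi x : mu.-integrable setT (EFin \o (fun y => k x y * phi y)).
  have := integrableMl_bounded mphi phiM (ik x).
  by congr (_.-integrable _ _); apply/funext => y /=; rewrite mulrC.
pose W x := \int[mu]_y (k x y * psi y).
pose V x := \int[mu]_y (k x y * phi y).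
have jE x : jump_op k psi x = m * psi x - W x.
  rewrite /jump_op /W.
  have -> : m * psi x = \int[mu]_y (psi x * k x y).
    by rewrite RintegralZl// mulrC /Rintegral km.
  rewrite -RintegralB//; last exact: integrableZ_real.
  by apply: eq_Rintegral => y _; ring.
have VE x : (1 + lam * m) * phi x = \1_A x + lam * V x.
  by apply: EFin_inj; rewrite eq EFinD EFinM EFin_Rintegral.
(* Absolutely integrable: [|phi| <= 1], and integrating out the second variable leaves
   [m * \int |psi|]. *)
pose F (p : T * T) := (k p.1 p.2 * (psi p.1 * phi p.2))%:E.
have mF2 : measurable2 (fun x y => k x y * (psi x * phi y)).
  by apply: measurable2M mk _; apply: measurable2M;
    [exact: measurable2_fst|exact: measurable2_snd].
have mF : measurable_fun setT F.
  by apply/measurable_EFinP; exact: (measurable2P mF2).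
have iF : (mu \x mu)%E.-integrable setT F.
  apply/integrable12ltyP => //.
  apply: (@le_lt_trans _ _ (dint mu (fun x y => k x y * `|psi x|))).
    rewrite dint.unlock; apply: ge0_le_integral => //.
    + by move=> x _; apply: integral_ge0 => y _; rewrite abse_ge0.
    + apply: (measurable_fun_fubini_tonelli_F (fun p => `|F p|%E)) => //.
      exact: measurableT_comp.
    + apply: measurable_inner.
        by apply: measurable2M mk _; apply: measurable2_fst; exact: measurableT_comp.
      by move=> x y; rewrite mulr_ge0.
    + move=> x _; apply: ge0_le_integral_EFin.
      * apply: measurableT_comp => //.
        exact: (measurable2_app x mF2).
      * apply: measurable_funM => //; exact: measurable_cst.
      * by move=> y.
      * move=> y; rewrite !normrM (ger0_norm (k0 _ _)) ler_wpM2l// ler_piMr//.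
  rewrite (dint_kernel_fst k0 mk m0 km)//; last exact: measurableT_comp.
  by case/integrableP: ipsi => _ /= foo; rewrite lte_mul_pinfty.
have FV x : fubini_F mu F x = (psi x * V x)%:E.
  rewrite /fubini_F EFinM EFin_Rintegral; last exact: ikphi.
  rewrite -integralZl; [|by []|exact: ikphi].
  by apply: eq_integral => y _; rewrite /F /= -EFinM; congr (_%:E); ring.
have FW z : fubini_G mu F z = (phi z * W z)%:E.
  rewrite /fubini_G EFinM EFin_Rintegral; last exact: ikpsi.
  rewrite -integralZl; [|by []|exact: ikpsi].
  by apply: eq_integral => t _; rewrite /F /= -EFinM ksym; congr (_%:E); ring.
have iV : mu.-integrable setT (EFin \o (fun x => psi x * V x)).
  have -> : EFin \o (fun x => psi x * V x) = fubini_F mu F.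
    by apply: funext => x; rewrite FV.
  exact: integrable_fubini_F.
have iW : mu.-integrable setT (EFin \o (fun x => phi x * W x)).
  have -> : EFin \o (fun x => phi x * W x) = fubini_G mu F.
    by apply: funext => x; rewrite FW.
  apply/integrableP; split; first exact: (measurable_fubini_G iF).
  apply: le_lt_trans ((integrable21ltyP _ _ mF).1 iF).
  apply: ge0_le_integral => //.
  - apply: measurableT_comp => //; exact: (measurable_fubini_G iF).
  - apply: (measurable_fun_fubini_tonelli_G (fun p => `|F p|%E)) => //.
    exact: measurableT_comp.
  - move=> y _; apply: le_abse_integral => //.
    by have := measurableT_comp mF (measurable_pair2 y); exact.
have VW : \int[mu]_x (psi x * V x) = \int[mu]_x (phi x * W x).
  rewrite /Rintegral; congr fine.
  transitivity (\int[mu]_x fubini_F mu F x)%E.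
    by apply: eq_integral => x _; rewrite FV.
  transitivity (\int[mu]_x fubini_G mu F x)%E; first exact: Fubini.
  by apply: eq_integral => x _; rewrite FW.
have iphipsi := integrableMl_bounded mphi phiM ipsi.
have iApsi := integrableMl_bounded (@measurable_indic _ _ _ setT A mA) indM ipsi.
transitivity (\int[mu]_x ((\1_A x * psi x + lam * (psi x * V x)) - lam * (phi x * W x))).
  apply: eq_Rintegral => x _; rewrite jE.
  have -> : phi x * (psi x + lam * (m * psi x - W x)) =
    ((1 + lam * m) * phi x) * psi x - lam * (phi x * W x) by ring.
  by rewrite VE; ring.
have ilV : mu.-integrable setT (EFin \o (fun x => lam * (psi x * V x))) by exact: integrableZ_real.
have ilW : mu.-integrable setT (EFin \o (fun x => lam * (phi x * W x))) by exact: integrableZ_real.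
rewrite RintegralB//; last exact: integrableD_real.
by rewrite RintegralD// !RintegralZl// VW addrK.
Qed.

End jump_operator.

(** * Passage to the limit in the kernel *)

Lemma dominated_cvg_Rintegral d (T : measurableType d) (R : realType)
    (mu : {measure set T -> \bar R}) (f_ : nat -> T -> R) (f g : T -> R) :
  (forall j, measurable_fun setT (f_ j)) -> measurable_fun setT f ->
  {ae mu, forall x, f_ ^~ x @ \oo --> f x} ->
  mu.-integrable setT (EFin \o g) -> (forall j x, `|f_ j x| <= g x) ->
  \int[mu]_x f_ j x @[j --> \oo] --> \int[mu]_x f x.
Proof.
move=> mf_ mf cvgf ig fg.
have intf_ j : mu.-integrable setT (EFin \o f_ j).
  apply: le_integrable ig => //; first exact/measurable_EFinP.
  by move=> x _ /=; rewrite lee_fin (le_trans (fg j x))// ler_norm.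
have [|||||intf _ cvgint] := @dominated_convergence _ _ _ mu _ measurableT
  (fun j x => (f_ j x)%:E) (EFin \o f) (EFin \o g).
- by move=> j; exact/measurable_EFinP.
- exact/measurable_EFinP.
- apply: filterS cvgf => x fx _.
  by apply: cvg_EFin; [exact: nearW|exact: fx].
- exact: ig.
- by apply: aeW => x j _; rewrite lee_fin.
move: cvgint; rewrite /= -EFin_Rintegral// => /fine_cvg; exact.
Qed.

Section energy_limit.
Context d (T : measurableType d) (R : realType).
Variable mu : {sigma_finite_measure set T -> \bar R}.
Implicit Types (k : T -> T -> R) (psi phi : T -> R).

Lemma measurable2_energy k (u : T -> R) : measurable2 k -> measurable_fun setT u ->
  measurable2 (fun x y => k x y * (u x - u y) ^+ 2).
Proof.
move=> mk mu1; apply: measurable2M mk _; apply: measurable2X.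
by apply: measurable2B; [exact: measurable2_fst|exact: measurable2_snd].
Qed.

Lemma le_energy k k' (u : T -> R) : measurable2 k -> measurable2 k' -> measurable_fun setT u ->
  (forall x y, 0 <= k x y) -> (forall x y, k x y <= k' x y) ->
  (energy mu k u <= energy mu k' u)%E.
Proof.
move=> mk mk' mu1 k0 kk'; apply: le_dint.
- exact: measurable2_energy.
- exact: measurable2_energy.
- by move=> x y; rewrite mulr_ge0// sqr_ge0.
- by move=> x y; rewrite ler_wpM2r// sqr_ge0.
Qed.

(** Fatou twice: at each good [x] for the inner integrals, then for the outer one, where the inner
    step supplies the inequality that [fatou_ae] asks for. *)
Lemma energy_fatou (k_ : nat -> T -> T -> R) k (u_ : nat -> T -> R) (u : T -> R) :
  (forall j, measurable2 (k_ j)) -> measurable2 k ->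
  (forall j x y, 0 <= k_ j x y) -> (forall x y, 0 <= k x y) ->
  (forall x y, k_ ^~ x ^~ y @ \oo --> k x y) ->
  (forall j, measurable_fun setT (u_ j)) -> measurable_fun setT u ->
  {ae mu, forall x, u_ ^~ x @ \oo --> u x} ->
  (energy mu k u <= limn_einf (fun j => energy mu (k_ j) (u_ j)))%E.
Proof.
move=> mk_ mk k_0 k0 cvgk mu_ mu1 cvgu; rewrite /energy dint.unlock.
have me_ j := measurable2_energy (mk_ j) (mu_ j).
have me := measurable2_energy mk mu1.
have e_0 j x y : 0 <= k_ j x y * (u_ j x - u_ j y) ^+ 2 by rewrite mulr_ge0// sqr_ge0.
have e0 x y : 0 <= k x y * (u x - u y) ^+ 2 by rewrite mulr_ge0// sqr_ge0.
apply: fatou_ae.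
- by move=> j; exact: measurable_inner.
- exact: measurable_inner.
- by move=> j x; exact: ge0_integral_EFin_ge0.
- by move=> x; exact: ge0_integral_EFin_ge0.
apply: filterS (cvgu) => x ux.
apply: fatou_ae_cvg => //.
- by move=> j; exact: (measurable2_app x (me_ j)).
- exact: (measurable2_app x me).
apply: filterS cvgu => y uy.
by apply: cvgM; [exact: cvgk|apply: cvgM; exact: cvgB].
Qed.

End energy_limit.

Section jump_limit.
Context d (T : measurableType d) (R : realType).
Variable mu : {sigma_finite_measure set T -> \bar R}.
Variables (K : T -> T -> R) (lam : R) (A : set T).
Hypotheses (K0 : forall x y, 0 <= K x y) (mK : measurable2 K).
Hypotheses (lam0 : 0 <= lam) (mA : measurable A) (Aoo : (mu A < +oo)%E).
Implicit Types (k : T -> T -> R) (psi phi : T -> R).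

Lemma jump_integrableS k psi : measurable2 k ->
  (forall x y, 0 <= k x y <= K x y) -> jump_integrable mu K psi ->
  jump_integrable mu k psi.
Proof.
move=> mk kK [mpsi ipsi iK foo].
have k0 x y : 0 <= k x y by case/andP: (kK x y).
have md : measurable2 (fun x y => psi x - psi y).
  by apply: measurable2B; [exact: measurable2_fst|exact: measurable2_snd].
have mn : measurable2 (fun x y => `|psi x - psi y|).
  exact: measurable2_norm.
split => //.
- move=> x; apply: le_integrable (iK x) => //.
    by apply/measurable_EFinP; exact: (measurable2_app x (measurable2M md mk)).
  move=> y _ /=; rewrite lee_fin !normrM ler_wpM2l// !ger0_norm//.
  by case/andP: (kK x y).
- apply: le_lt_trans foo; apply: le_dint.
  + exact: measurable2M.
  + exact: measurable2M.
  + by move=> x y; rewrite mulr_ge0.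
  + by move=> x y; rewrite ler_wpM2l//; case/andP: (kK x y).
Qed.

Variables (k_ : nat -> T -> T -> R) (m_ : nat -> R).
Hypotheses (Kk : forall j, jump_kernel mu (k_ j) (m_ j)).
Hypothesis k_le : forall j x y, k_ j x y <= K x y.
Hypothesis k_cvg : forall x y, k_ ^~ x ^~ y @ \oo --> K x y.

Let k_0 j x y : 0 <= k_ j x y. Proof. by case: (Kk j). Qed.
Let mk_ j : measurable2 (k_ j). Proof. by case: (Kk j). Qed.

(** Dominated convergence twice with one majorant. At fixed [x], [|psi x - psi y| * K x y] dominates
    the truncated integrands; its integral [G x] dominates all the [jump_op (k_ j) psi] and is
    integrable in [x]. *)
Lemma resolvent_weak_limit (phi_ : nat -> T -> R) phi psi :
  (forall j, resolvent mu (k_ j) (m_ j) lam A (phi_ j)) ->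
  measurable_fun setT phi ->
  {ae mu, forall x, phi_ ^~ x @ \oo --> phi x} -> jump_integrable mu K psi ->
  \int[mu]_x (phi x * (psi x + lam * jump_op mu K psi x)) =
  \int[mu]_x (\1_A x * psi x).
Proof.
move=> Rphi mphi cvgphi jK; have [mpsi ipsi iK foo] := jK.
have jk j : jump_integrable mu (k_ j) psi.
  by apply: jump_integrableS => // x y; rewrite k_0 k_le.
have mphi_ j : measurable_fun setT (phi_ j) by case: (Rphi j).
have md : measurable2 (fun x y => psi x - psi y).
  by apply: measurable2B; [exact: measurable2_fst|exact: measurable2_snd].
have mn : measurable2 (fun x y => `|psi x - psi y| * K x y).
  by apply: measurable2M mK; exact: measurable2_norm.
have cvgL x : jump_op mu (k_ j) psi x @[j --> \oo] --> jump_op mu K psi x.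
  apply: (@dominated_cvg_Rintegral _ _ _ _ _ _ (fun y => `|psi x - psi y| * K x y)).
  - by move=> j; exact: (measurable2_app x (measurable2M md (mk_ j))).
  - exact: (measurable2_app x (measurable2M md mK)).
  - by apply: aeW => y; apply: cvgM; [exact: cvg_cst|exact: k_cvg].
  - have := integrable_abse (iK x); congr (_.-integrable _ _); apply/funext => y /=.
    by rewrite normrM (ger0_norm (K0 _ _)).
  - by move=> j y; rewrite normrM (ger0_norm (k_0 _ _ _)) ler_wpM2l.
pose G x := \int[mu]_y (`|psi x - psi y| * K x y).
have iG x : mu.-integrable setT (EFin \o (fun y => `|psi x - psi y| * K x y)).
  have := integrable_abse (iK x); congr (_.-integrable _ _); apply/funext => y /=.
  by rewrite normrM (ger0_norm (K0 _ _)).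
have LG j x : `|jump_op mu (k_ j) psi x| <= G x.
  rewrite /jump_op; have [_ _ ik _] := jk j.
  apply: (le_trans (le_normr_Rintegral _ (ik x))) => //.
  apply: le_Rintegral => //.
    by have := integrable_abse (ik x).
  by move=> y _; rewrite normrM (ger0_norm (k_0 _ _ _)) ler_wpM2l.
have mG : measurable_fun setT G.
  apply: measurableT_comp => //; apply: measurable_inner => //.
  by move=> x y; rewrite mulr_ge0.
have intG : mu.-integrable setT (EFin \o G).
  apply: integrable_norm_lty => //; move: foo; rewrite dint.unlock.
  rewrite (_ : \int[mu]_x _ = \int[mu]_x (`|G x|)%:E)%E//.
  apply: eq_integral => x _; rewrite ger0_norm; first exact/esym/EFin_Rintegral.
  by apply: Rintegral_ge0 => y _; rewrite mulr_ge0.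
have h : \int[mu]_x (phi_ j x * (psi x + lam * jump_op mu (k_ j) psi x)) @[j --> \oo]
   --> \int[mu]_x (phi x * (psi x + lam * jump_op mu K psi x)).
  apply: (@dominated_cvg_Rintegral _ _ _ _ _ _ (fun x => `|psi x| + lam * G x)).
  - move=> j; apply: measurable_funM => //; apply: measurable_funD => //.
    by apply: measurable_funM => //; exact: measurable_jump_op.
  - apply: measurable_funM => //; apply: measurable_funD => //.
    by apply: measurable_funM => //; exact: measurable_jump_op.
  - apply: filterS cvgphi => x cx; apply: cvgM => //; apply: cvgD; first exact: cvg_cst.
    by apply: cvgM; [exact: cvg_cst|exact: cvgL].
  - apply: integrableD_real; first exact: (integrable_abse ipsi).
    exact: integrableZ_real.
  - move=> j x; rewrite normrM -[leRHS]mul1r ler_pM//.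
      by case: (Rphi j) => _ /(_ x) /andP[? ?] _ _; rewrite ger0_norm.
    rewrite (le_trans (ler_normD _ _))// lerD2l normrM (ger0_norm lam0).
    by rewrite ler_wpM2l.
have h' : \int[mu]_x (phi_ j x * (psi x + lam * jump_op mu (k_ j) psi x)) @[j --> \oo]
   --> \int[mu]_x (\1_A x * psi x).
  rewrite (_ : (fun j => _) = cst (\int[mu]_x (\1_A x * psi x))); first exact: cvg_cst.
  by apply/funext => j; exact: resolvent_weak (Kk j) (Rphi j) (jk j).
exact: (cvg_unique _ h h').
Qed.

End jump_limit.

Section measurable_limit.
Context d (T : measurableType d) (R : realType).
Variable mu : {measure set T -> \bar R}.

(** The sequence is set to [0] on a measurable null set containing the bad points, so that the limit
    exists, is measurable and stays in [[0, 1]] everywhere. *)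
Lemma ae_cvg_measurable_limit (u_ : nat -> T -> R) :
  (forall j, measurable_fun setT (u_ j)) -> (forall j x, 0 <= u_ j x <= 1) ->
  {ae mu, forall x, cvgn (u_ ^~ x)} ->
  exists u : T -> R, [/\ measurable_fun setT u, forall x, 0 <= u x <= 1 &
    {ae mu, forall x, u_ ^~ x @ \oo --> u x}].
Proof.
move=> mu_ u01 [N [mN N0 subN]].
pose v_ j x := u_ j x * \1_(~` N) x.
have v01 j x : 0 <= v_ j x <= 1.
  rewrite /v_ indicE; case: (_ \in _); rewrite ?mulr1 ?mulr0 ?lexx ?ler01//.
have cvgv x : cvgn (v_ ^~ x).
  rewrite /v_ indicE; case: (boolP (x \in ~` N)) => /= xN.
    under eq_fun do rewrite mulr1.
    rewrite inE in xN; apply: contrapT => h; apply: xN; exact: subN.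
  by under eq_fun do rewrite mulr0; exact: is_cvg_cst.
exists (fun x => limn (v_ ^~ x)); split.
- apply: (@measurable_fun_cvg _ _ _ _ v_) => //.
  move=> j; apply: measurable_funM => //.
  by apply: measurable_indic; exact: measurableC.
- move=> x; apply/andP; split.
    by apply: limr_ge; [exact: cvgv|apply: nearW => j; case/andP: (v01 j x)].
  by apply: limr_le; [exact: cvgv|apply: nearW => j; case/andP: (v01 j x)].
- exists N; split => // x /= h; apply: contrapT => xN; apply: h.
  have -> : u_ ^~ x = v_ ^~ x.
    by apply/funext => j; rewrite /v_ indicE mem_set// mulr1.
  exact: cvgv.
Qed.

End measurable_limit.

Section jump_resolvent.
Context d (T : measurableType d) (R : realType).
Variable mu : {sigma_finite_measure set T -> \bar R}.
Variables (K : T -> T -> R) (lam : R) (A : set T).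
Hypotheses (K0 : forall x y, 0 <= K x y) (mK : measurable2 K).
Hypotheses (lam0 : 0 <= lam) (mA : measurable A) (Aoo : (mu A < +oo)%E).
Variables (k_ : nat -> T -> T -> R) (m_ : nat -> R).
Hypotheses (Kk : forall j, jump_kernel mu (k_ j) (m_ j)).
Hypothesis k_nd : forall i j x y, (i <= j)%N -> k_ i x y <= k_ j x y.
Hypothesis k_le : forall j x y, k_ j x y <= K x y.
Hypothesis k_cvg : forall x y, k_ ^~ x ^~ y @ \oo --> K x y.

Let k_0 j x y : 0 <= k_ j x y. Proof. by case: (Kk j). Qed.
Let mk_ j : measurable2 (k_ j). Proof. by case: (Kk j). Qed.

Let mindic : measurable_fun setT (\1_A : T -> R).
Proof. exact: measurable_indic. Qed.

(** A nonincreasing sequence bounded below is within [4^-l] of its infimum from some index [N l] on.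
    The index map [f] is nondecreasing and tends to infinity because [l <= f l]. *)
Lemma fast_subsequence (a : nat -> R) : (forall i j, (i <= j)%N -> a j <= a i) ->
  (forall i, 0 <= a i) ->
  exists f : nat -> nat, [/\ forall l, (f l <= f l.+1)%N, forall l, (l <= f l)%N &
    forall l, a (f l) - a (f l.+1) <= 4^-1 ^+ l].
Proof.
move=> nia a0.
have lba : has_lbound (range a) by exists 0 => _ [i _ <-].
have [L La] : exists L, forall l : nat, exists i, (forall j, L <= a j) /\
    a i <= L + 4^-1 ^+ l.
  exists (inf (range a)) => l.
  have p0 : 0 < 4^-1 ^+ l :> R by rewrite exprn_gt0.
  have hi : has_inf (range a) by split => //; exists (a 0%N), 0%N.
  have [_ [i _ <-] ai] := inf_adherent p0 hi.
  exists i; split; last exact: ltW.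
  by move=> j; apply: ge_inf => //; exists j.
have [N NP] := choice La.
(* A sum of successors exceeds both [N l] and [l] and is monotone in [l]. *)
pose f l := (\sum_(i < l.+1) (N i).+1)%N.
have fN l : (N l <= f l)%N.
  by rewrite /f big_ord_recr/= -[leqLHS]add0n leq_add.
have fS l : (f l <= f l.+1)%N by rewrite {2}/f big_ord_recr/= leq_addr.
have fl l : (l <= f l)%N.
  elim: l => // l IH; rewrite /f big_ord_recr/= -/(f l).
  by rewrite -addn1 leq_add.
exists f; split => // l.
have [La' aN] := NP l.
by rewrite lerBlDr (le_trans (nia _ _ (fN l)))// (le_trans aN)// addrC lerD2l.
Qed.

(** The right side [\int 1_A (1 - phi)] is continuous along the subsequence, being dominated by
    [\1_A]. The two terms on the left of the energy identity are only lower semicontinuous, hence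
    the two separate inequalities in place of the identity. In the upper bound,
    [energy (k_ j) <= energy K]. *)
Theorem jump_resolvent_exists : exists phi : T -> R,
  [/\ measurable_fun setT phi, forall x, 0 <= phi x <= 1,
      forall psi, jump_integrable mu K psi ->
        \int[mu]_x (phi x * (psi x + lam * jump_op mu K psi x)) =
        \int[mu]_x (\1_A x * psi x) &
      [/\ (\int[mu]_x ((\1_A x - phi x) ^+ 2)%:E <=
             \int[mu]_x (\1_A x * (1 - phi x))%:E)%E,
          ((lam / 2)%:E * energy mu K phi <=
             \int[mu]_x (\1_A x * (1 - phi x))%:E)%E &
          (\int[mu]_x (\1_A x * (1 - phi x))%:E <=
             (lam / 2)%:E * energy mu K (\1_A))%E]].
Proof.
have /choice[phi_ Rphi] j : exists phi, resolvent mu (k_ j) (m_ j) lam A phi.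
  by case: (Kk j) => k0 ks mk m0 km; apply: resolvent_exists.
have mphi_ j : measurable_fun setT (phi_ j) by case: (Rphi j).
have phi01 j x : 0 <= phi_ j x <= 1 by case: (Rphi j).
have /choice[I IE] j : exists i : R, (\int[mu]_x (\1_A x * phi_ j x)%:E = i%:E)%E.
  by have [a [e [i [_ _ _ iE _]]]] := resolvent_self lam0 mA Aoo (Kk j) (Rphi j); exists i.
have I0 i : 0 <= I i.
  rewrite -lee_fin -IE; apply: ge0_integral_EFin_ge0 => x.
  by rewrite mulr_ge0 ?indicE//; case/andP: (phi01 i x).
have cauchy i j : (i <= j)%N ->
    (\int[mu]_x ((phi_ i x - phi_ j x) ^+ 2)%:E <= (I i - I j)%:E)%E.
  move=> ij; rewrite EFinB leeBrDr// -!IE.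
  by apply: (resolvent_cauchy lam0 mA Aoo (Kk i) (Kk j)) => // x y; exact: k_nd.
have nI i j : (i <= j)%N -> I j <= I i.
  move=> /cauchy; rewrite -subr_ge0 -lee_fin; apply: le_trans.
  by apply: ge0_integral_EFin_ge0 => x; rewrite sqr_ge0.
have [f [fS fl fI]] := fast_subsequence nI I0.
have cvgf : f @ \oo --> \oo.
  by apply/cvgnyPge => M; exists M => // l /= Ml; exact: leq_trans (fl l).
have [phi [mphi phi1 cvgphi]] : exists u : T -> R, [/\ measurable_fun setT u,
    forall x, 0 <= u x <= 1 & {ae mu, forall x, (fun l => phi_ (f l) x) @ \oo --> u x}].
  apply: (@ae_cvg_measurable_limit _ _ _ mu (fun l => phi_ (f l))) => //.
  apply: (@ae_cauchy_cvg _ _ _ mu (fun l => phi_ (f l))) => //.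
  move=> l; apply: le_trans (cauchy _ _ (fS l)) _.
  by rewrite lee_fin.
have kf_cvg x y : (fun l => k_ (f l) x y) @ \oo --> K x y.
  exact: (cvg_comp f (k_ ^~ x ^~ y) cvgf (@k_cvg x y)).
have phi0 x : 0 <= phi x by case/andP: (phi1 x).
have iA : mu.-integrable setT (EFin \o (\1_A : T -> R)).
  apply: integrable_norm_lty => //.
  under eq_integral do rewrite ger0_norm ?indicE//.
  by rewrite integral_indic// setIT.
have c0 (u : T -> R) x : 0 <= u x <= 1 -> 0 <= \1_A x * (1 - u x).
  by move=> /andP[_ u1]; rewrite mulr_ge0 ?indicE// subr_ge0.
have cvgZ : (\int[mu]_x (\1_A x * (1 - phi_ (f l) x))%:E @[l --> \oo] -->
    \int[mu]_x (\1_A x * (1 - phi x))%:E)%E.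
  have iu (u : T -> R) : measurable_fun setT u -> (forall x, 0 <= u x <= 1) ->
      mu.-integrable setT (EFin \o (fun x => \1_A x * (1 - u x))).
    move=> mu1 u01; under eq_fun do rewrite mulrC.
    apply: (@integrableMl_bounded _ _ _ _ _ _ 1) => //.
      exact: measurable_funB.
    by move=> x; have /andP[? ?] := u01 x; rewrite ger0_norm ?subr_ge0// lerBlDr lerDl.
  rewrite -EFin_Rintegral; last exact: iu.
  under eq_fun do rewrite -EFin_Rintegral ?iu//.
  apply: cvg_EFin; first exact: nearW.
  apply: (@dominated_cvg_Rintegral _ _ _ _ _ _ (\1_A : T -> R)) => //.
  - by move=> l; apply: measurable_funM => //; exact: measurable_funB.
  - by apply: measurable_funM => //; exact: measurable_funB.
  - apply: filterS cvgphi => x cx; apply: cvgM; first exact: cvg_cst.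
    by apply: cvgB => //; exact: cvg_cst.
  - move=> l x; rewrite ger0_norm ?c0// ler_piMr ?indicE//.
    by have /andP[? ?] := phi01 (f l) x; rewrite lerBlDr lerDl.
have Eeq l := resolvent_energy_eq lam0 mA Aoo (Kk (f l)) (Rphi (f l)).
have e0 k (u : T -> R) : (forall x y, 0 <= k x y) -> (0 <= (lam / 2)%:E * energy mu k u)%E.
  by move=> k0; rewrite mule_ge0 ?lee_fin ?divr_ge0//; exact: energy_ge0.
have s0 (u v : T -> R) : (0 <= \int[mu]_x ((u x - v x) ^+ 2)%:E)%E.
  by apply: ge0_integral_EFin_ge0 => x; rewrite sqr_ge0.
exists phi; split => //; last split.
- move=> psi jpsi.
  by apply: (resolvent_weak_limit K0 mK lam0 mA (fun l => Kk (f l)) _ kf_cvg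
    (fun l => Rphi (f l))).
- apply: (@le_trans _ _ (limn_einf (fun l =>
    \int[mu]_x ((\1_A x - phi_ (f l) x) ^+ 2)%:E)%E)).
    apply: fatou_ae_cvg.
    + by move=> l; apply: measurable_funX; exact: measurable_funB.
    + by apply: measurable_funX; exact: measurable_funB.
    + by move=> l x; rewrite sqr_ge0.
    + by move=> x; rewrite sqr_ge0.
    + apply: filterS cvgphi => x cx.
      by apply: cvgM; apply: cvgB => //; exact: cvg_cst.
  apply: limn_einf_le_cvg cvgZ => l.
  by rewrite -Eeq leeDl// e0.
(* The energy is bounded after division by [lam / 2], so [lam = 0] is set apart. *)
- have [->|lamN0] := eqVneq lam 0.
    rewrite mul0r mul0e; apply: ge0_integral_EFin_ge0 => x; exact: c0.
  have l20 : 0 < lam / 2 by rewrite divr_gt0// lt_neqAle eq_sym lamN0.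
  rewrite muleC -lee_pdivlMr//.
  apply: (@le_trans _ _ (limn_einf (fun l => energy mu (k_ (f l)) (phi_ (f l))))).
    exact: energy_fatou.
  apply: (@limn_einf_le_cvg _ _ (fun l =>
    (\int[mu]_x (\1_A x * (1 - phi_ (f l) x))%:E * ((lam / 2)^-1)%:E)%E)).
    move=> l; rewrite lee_pdivlMr// muleC -Eeq leeDr//.
  by apply: cvgeZr.
- have := cvgZ; apply: cvge_le; apply: nearW => l.
  apply: (le_trans (resolvent_le_energy lam0 mA Aoo (Kk (f l)) (Rphi (f l)))).
  rewrite lee_wpmul2l ?lee_fin ?divr_ge0//.
  exact: le_energy.
Qed.

End jump_resolvent.

(** * Lebesgue measure on R^n *)

Section measurability_rV.
Context {R : realType} {n : nat}.
Implicit Types (h : 'rV[R]_n) (u : 'rV[R]_n -> R).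

Lemma measurable_fun_coord d (T : measurableType d) (f : T -> 'rV[R]_n) i :
  measurable_fun setT f ->
  measurable_fun setT (fun t => f t ord0 i : measurableTypeR R).
Proof. by move=> mf; exact: (measurable_fun_rVP f).1. Qed.

Lemma measurable_fun_rVD d (T : measurableType d) (f g : T -> 'rV[R]_n) :
  measurable_fun setT f -> measurable_fun setT g ->
  measurable_fun setT (fun t => f t + g t).
Proof.
move=> mf mg; apply/measurable_fun_rVP => i.
under eq_fun do rewrite mxE.
by apply: measurable_funD; exact: measurable_fun_coord.
Qed.

Lemma measurable_fun_rVB d (T : measurableType d) (f g : T -> 'rV[R]_n) :
  measurable_fun setT f -> measurable_fun setT g ->
  measurable_fun setT (fun t => f t - g t).
Proof.
move=> mf mg; apply/measurable_fun_rVP => i.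
under eq_fun do rewrite !mxE.
by apply: measurable_funB; exact: measurable_fun_coord.
Qed.

Lemma measurable_addr h : measurable_fun setT (fun x : 'rV[R]_n => x + h).
Proof. by apply: measurable_fun_rVD; [exact: measurable_id|exact: measurable_cst]. Qed.

Lemma measurable_enorm : measurable_fun setT (@enorm R n).
Proof.
apply: measurableT_comp.
  exact: continuous_measurable_fun (@sqrt_continuous R).
by apply: measurable_sum => i; apply: measurable_funX; exact: measurable_coord.
Qed.

Lemma enorm_ge0 h : 0 <= enorm h.
Proof. exact: sqrtr_ge0. Qed.

Lemma le_coord_enorm h i : `|h ord0 i| <= enorm h.
Proof.
rewrite -sqrtr_sqr ler_wsqrtr// (bigD1 i)//= lerDl sumr_ge0// => j _.
exact: sqr_ge0.
Qed.

Lemma enormN h : enorm (- h) = enorm h.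
Proof. by rewrite /enorm; congr Num.sqrt; apply: eq_bigr => i _; rewrite mxE sqrrN. Qed.

Lemma enorm_frac_kernel s (x y : 'rV[R]_n) :
  frac_kernel s x y = enorm (x - y) `^ (- (n%:R + s)) :> R.
Proof. by rewrite /frac_kernel powRN. Qed.

Lemma frac_kernel_ge0 s (x y : 'rV[R]_n) : 0 <= frac_kernel s x y.
Proof. by rewrite enorm_frac_kernel powR_ge0. Qed.

Lemma measurable2_sub (g : 'rV[R]_n -> R) : measurable_fun setT g ->
  measurable2 (fun x y : 'rV[R]_n => g (x - y)).
Proof.
move=> mg; split; apply: (measurableT_comp mg).
by apply: measurable_fun_rVB; [exact: measurable_fst|exact: measurable_snd].
Qed.

Lemma measurable_kernel0 s :
  measurable_fun setT (fun h : 'rV[R]_n => enorm h `^ (- (n%:R + s)) : R).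
Proof.
apply: (measurableT_comp (measurable_powR (- (n%:R + s)))).
exact: measurable_enorm.
Qed.

Lemma measurable2_frac_kernel s : measurable2 (@frac_kernel R n s).
Proof.
have := measurable2_sub (measurable_kernel0 s).
by congr measurable2; apply/funext => x; apply/funext => y; rewrite enorm_frac_kernel.
Qed.

(** The measurable sets are generated by the coordinates, not by the topology. So [u] is written as
    a limit of functions of countably many values: [N k] rounds each coordinate down to a multiple
    of [1/(k+1)] and [q k] turns the integer vector back into a point. *)
Lemma continuous_measurable_rV u : continuous u ->
  measurable_fun setT (u : 'rV[R]_n -> measurableTypeR R).
Proof.
move=> cu.
pose N (k : nat) (x : 'rV[R]_n) : 'rV[int]_n := \row_i Num.floor (x ord0 i * k.+1%:R).
pose q k (M : 'rV[int]_n) : 'rV[R]_n := \row_i ((M ord0 i)%:~R / k.+1%:R).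
apply: (@measurable_fun_cvg _ _ _ _ (fun k x => u (q k (N k x)))).
  move=> k _ Y mY; rewrite setTI.
  rewrite (_ : _ @^-1` Y = \bigcup_(M in [set M | Y (u (q k M))]) [set x | N k x = M]).
    rewrite bigcup_mkcond; apply: countable_bigcupT_measurable => [|M]; first exact: countableP.
    case: ifPn => // _.
    rewrite (_ : [set x | _] = \bigcap_(i in [set: 'I_n])
        [set x : 'rV[R]_n | Num.floor (x ord0 i * k.+1%:R) = M ord0 i]).
      apply: fin_bigcap_measurable => // i _.
      rewrite (_ : [set x | _] = (fun x : 'rV[R]_n => x ord0 i * k.+1%:R) @^-1`
         `[(M ord0 i)%:~R, (M ord0 i + 1)%:~R[).
        rewrite -[X in measurable X]setTI; apply: measurable_funM => //.
        exact: measurable_coord.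
      apply/seteqP; split => x /=; rewrite in_itv/=.
        by move=> /eqP; rewrite floor_eq.
      by move=> h; apply/eqP; rewrite floor_eq.
    apply/seteqP; split => x /= => [eM i _|h]; first by rewrite /= -eM mxE.
    by apply/rowP => i; rewrite mxE h.
  apply/seteqP; split => x /=; first by move=> h; exists (N k x).
  by move=> [M YM /= eM]; rewrite eM.
move=> x _.
suff h : q k (N k x) @[k --> \oo] --> x by exact: (cvg_comp _ _ h (cu x)).
apply/cvg_ballP => e e0; near=> k; split => // i j; rewrite (ord1 i).
rewrite /ball/= mxE mxE.
set y := x ord0 j; have k0 : 0 < k.+1%:R :> R by [].
have /andP[f1 f2] := floor_itv (y * k.+1%:R).
have -> : y - (Num.floor (y * k.+1%:R))%:~R / k.+1%:R =
   (y * k.+1%:R - (Num.floor (y * k.+1%:R))%:~R) / k.+1%:R.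
  by field; rewrite lt0r_neq0.
rewrite ger0_norm ?divr_ge0 ?subr_ge0// ltr_pdivrMr//.
rewrite intrD in f2; apply: (@lt_le_trans _ _ 1).
  by rewrite ltrBlDl.
have : e^-1 <= k%:R.
  near: k; exact: nbhs_infty_ger.
rewrite -[e^-1]mul1r ler_pdivrMr// mulrC => /le_trans; apply.
by rewrite ler_wpM2l ?ler_nat// ltW.
Unshelve. all: by end_near. Qed.

End measurability_rV.

Section lebesgue_rV_theory.
Context {R : realType}.
Local Open Scope ereal_scope.
Local Notation leb := (@lebesgue_measure R).
Local Notation mu := (lebesgue_rV _).

(** The translated measure agrees with Lebesgue measure on half-open intervals, which determine
    it. *)
Lemma lebesgue_measure_shift (t : R) (A : set R) : measurable A ->
  pushforward leb (fun r : measurableTypeR R => (r + t)%R : measurableTypeR R) A = leb A.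
Proof.
move=> mA.
have mt : measurable_fun setT (fun r : measurableTypeR R => (r + t)%R : measurableTypeR R).
  by apply: measurable_funD => //; exact: measurable_cst.
pose phi0 := fun r : measurableTypeR R => (r + t)%R : measurableTypeR R.
pose mphi := isMeasurableFun.Build _ _ _ _ phi0 mt.
pose phi : {mfun measurableTypeR R >-> measurableTypeR R} := HB.pack phi0 mphi.
apply/esym; apply: (@lebesgue_measure_unique _ (pushforward leb phi)) => //.
move=> _ [[a b]] _ <-.
change (leb [set` `]a, b]] = leb (phi0 @^-1` [set` `]a, b]])).
rewrite (_ : phi0 @^-1` _ = [set` `](a - t)%R, (b - t)%R]]); last first.
  by apply/seteqP; split => x /=; rewrite !in_itv/= ltrBlDr lerBrDr.
rewrite !lebesgue_measure_itv/= !lte_fin ltrD2r.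
by case: ifP => // _; rewrite -!EFinD; congr (_%:E); ring.
Qed.

Lemma ge0_lebesgue_integral_shift (t : R) (f : R -> \bar R) :
  measurable_fun setT f -> (forall x, 0 <= f x) ->
  \int[leb]_x f (x + t)%R = \int[leb]_x f x.
Proof.
move=> mf f0.
have mt : measurable_fun setT (fun r : measurableTypeR R => (r + t)%R : measurableTypeR R).
  by apply: measurable_funD => //; exact: measurable_cst.
rewrite [RHS](eq_measure_integral (pushforward leb
  (fun r : measurableTypeR R => (r + t)%R : measurableTypeR R))).
  by rewrite ge0_integral_pushforward.
by move=> A mA _; apply/esym; exact: lebesgue_measure_shift.
Qed.

Lemma ge0_integral_rVS n (f : 'rV[R]_n.+1 -> \bar R) :
  measurable_fun setT f -> (forall x, 0 <= f x) ->
  \int[mu]_x f x = \int[leb]_t \int[mu]_y f (rV_cons (t, y)).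
Proof.
move=> mf f0.
rewrite -(fubini_tonelli1 (fun p => f (rV_cons p)))//; last first.
  by apply: measurableT_comp => //; exact: measurable_rV_cons.
exact: (@ge0_integral_pushforward _ _ _ _ _ _ (@measurable_rV_cons R n) _ setT).
Qed.

(** Induction on the dimension, because [lebesgue_rV] is built one coordinate at a time: translate
    the tail inside, then the first coordinate outside. *)
Lemma ge0_integral_rV_shift n (h : 'rV[R]_n) (f : 'rV[R]_n -> \bar R) :
  measurable_fun setT f -> (forall x, 0 <= f x) ->
  \int[mu]_x f (x + h)%R = \int[mu]_x f x.
Proof.
elim: n h f => [|n IH] h f mf f0.
  by apply: eq_integral => x _; rewrite [in LHS](thinmx0 h) addr0.
pose h0 := h ord0 ord0; pose h' : 'rV[R]_n := (\row_j h ord0 (lift ord0 j))%R.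
have mfh : measurable_fun setT (fun x : 'rV[R]_n.+1 => f (x + h)%R).
  exact: (measurableT_comp mf (measurable_addr h)).
rewrite (ge0_integral_rVS mf f0) (ge0_integral_rVS mfh (fun x => f0 _)).
have hE t y : (rV_cons (t, y) + h)%R = rV_cons ((t + h0)%R, (y + h')%R).
  apply/rowP => i; rewrite mxE -(@splitK 1 n i).
  case: (fintype.split (i : 'I_(1 + n))) => j.
    rewrite /rV_cons /= !(row_mxEl (_%:M : 'rV_1)) !mxE (ord1 j)/= !mulr1n.
    congr (_ + _)%R; rewrite /h0; congr (h _ _); exact/val_inj.
  rewrite /rV_cons /= !(row_mxEr (_%:M : 'rV_1)) !mxE.
  congr (_ + _)%R; congr (h _ _); exact/val_inj.
have mfc t : measurable_fun setT (fun y => f (rV_cons (t, y))).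
  have mfr := measurableT_comp mf (@measurable_rV_cons R n).
  exact: (measurableT_comp mfr (measurable_pair1 t)).
transitivity (\int[leb]_t \int[mu]_y f (rV_cons ((t + h0)%R, y))).
  apply: eq_integral => t _; under eq_integral do rewrite hE.
  exact: (IH h' (fun y => f (rV_cons ((t + h0)%R, y)))).
apply: (ge0_lebesgue_integral_shift h0 (f := fun t => \int[mu]_y f (rV_cons (t, y)))).
  apply: (measurable_fun_fubini_tonelli_F (fun p => f (rV_cons p))) => //.
  exact: (measurableT_comp mf (@measurable_rV_cons R n)).
by move=> t; exact: integral_ge0.
Qed.

(** Balls of the maximum norm stand in for Euclidean balls throughout: they contain them, and their
    measure is a plain product. *)
Definition rV_box n (r : R) : set 'rV[R]_n := [set x | forall i, (`|x ord0 i| <= r)%R].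

Lemma measurable_rV_box n r : measurable (@rV_box n r).
Proof.
rewrite (_ : rV_box _ = \bigcap_(i in [set: 'I_n]) [set x : 'rV[R]_n | (`|x ord0 i| <= r)%R]).
  apply: fin_bigcap_measurable => // i _.
  rewrite (_ : [set x | _] = (fun x : 'rV[R]_n => x ord0 i) @^-1` [set` `[(- r)%R, r]]).
    by rewrite -[X in measurable X]setTI; apply: measurable_coord.
  by apply/seteqP; split => x /=; rewrite in_itv/= ler_norml.
by apply/seteqP; split => x /= h i; [move=> _|]; exact: h.
Qed.

Lemma lebesgue_rV_box n (r : R) : (0 <= r)%R ->
  mu (@rV_box n r) = ((r *+ 2) ^+ n)%:E.
Proof.
move=> r0; elim: n => [|n IH].
  rewrite expr0 /= diracE mem_set// => -[]//.
rewrite /= /lebesgue_step /pushforward.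
have -> : @rV_cons R n @^-1` @rV_box n.+1 r = [set` `[(- r)%R, r]] `*` @rV_box n r.
  apply/seteqP; split => -[t y] /=.
    move=> h; split => [|i] /=.
      have := h (lshift n (ord0 : 'I_1)).
      by rewrite (row_mxEl (t%:M : 'rV_1)) mxE/= mulr1n in_itv/= ler_norml.
    by have := h (rshift 1 i); rewrite (row_mxEr (t%:M : 'rV_1)).
  rewrite in_itv/= -ler_norml => -[ht hy] i; rewrite -(@splitK 1 n i).
  case: (fintype.split (i : 'I_(1 + n))) => j.
    by rewrite (row_mxEl (t%:M : 'rV_1)) mxE (ord1 j) /= mulr1n.
  by rewrite (row_mxEr (t%:M : 'rV_1)).
have lE : leb [set` `[(- r)%R, r]] = (r *+ 2)%:E.
  rewrite lebesgue_measure_itv/= lte_fin.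
  case: ltP => h; first by rewrite opprK mulr2n.
  have -> : (r = 0)%R by apply/eqP; rewrite eq_le r0 andbT; lra.
  by rewrite mul0rn.
transitivity (leb [set` `[(- r)%R, r]] * mu (@rV_box n r)).
  by apply: product_measure1E => //; exact: measurable_rV_box.
by rewrite lE IH -EFinM exprS.
Qed.

End lebesgue_rV_theory.

(** * Integrability of the fractional kernel against [min(|h|, 1)] *)

Lemma dyadic_bracket (R : realType) (y : R) : 1 <= y ->
  exists j : nat, 2 ^+ j <= y < 2 ^+ j.+1.
Proof.
move=> y1.
have ex : exists j : nat, y < 2 ^+ j.
  have [j yj] : exists j : nat, y < j%:R by exists (Num.truncn y).+1; exact: truncnS_gt.
  exists j; apply: (lt_le_trans yj); rewrite -natrX ler_nat; exact/ltnW/ltn_expl.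
pose j := ex_minn ex.
have : y < 2 ^+ j by rewrite /j; case: ex_minnP.
have jmin i : y < 2 ^+ i -> (j <= i)%N by rewrite /j; case: ex_minnP => k _; exact.
case: j jmin => [_|j jmin yj]; first by rewrite expr0 ltNge y1.
exists j; rewrite yj andbT leNgt; apply/negP => /jmin.
by rewrite ltnn.
Qed.

Lemma powR_expr (R : realType) (a p : R) (j : nat) : 0 <= a ->
  (a ^+ j) `^ p = (a `^ p) ^+ j.
Proof.
move=> a0; elim: j => [|j IH]; first by rewrite !expr0 powR1.
by rewrite !exprS powRM ?exprn_ge0// IH.
Qed.

Lemma powR_lt1 (R : realType) (a p : R) : 1 < a -> p < 0 -> a `^ p < 1.
Proof.
move=> a1 p0; rewrite -[p]opprK powRN invf_lt1 ?powR_gt0 ?(lt_trans ltr01)//.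
rewrite -[ltLHS](congr1 (fun f => f (- p)) (@powR1 R)).
by rewrite gt0_ltr_powR ?oppr_gt0 ?nnegrE// ltW// (lt_trans ltr01).
Qed.

Section kernel_integrability.
Context {R : realType} (n : nat) (s : R).
Hypotheses (n0 : (0 < n)%N) (s0 : 0 < s) (s1 : s < 1).
Local Notation mu := (@lebesgue_rV R n).

(** The fractional kernel as a function of the difference [h = x - y]. Its value at the origin is
    [0] by the conventions of [powR] (see [kernel0_eq0]), so the diagonal contributes nothing. *)
Definition kernel0 (h : 'rV[R]_n) : R := enorm h `^ (- (n%:R + s)).

Let theta : R := n%:R + s - 1.
Let theta_gt0 : 0 < theta.
Proof. by rewrite /theta subr_gt0 (@le_lt_trans _ _ n%:R) ?ler1n// ltrDl. Qed.

(** Bounds on dyadic shells: [a j] for [|h| kernel0 h = (1/|h|)^theta] where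
    [2^j <= 1/|h| < 2^(j+1)], and [b j] for [kernel0 h] where [2^j <= |h| < 2^(j+1)]. *)
Let a j : R := (2 ^+ j.+1) `^ theta.
Let b j : R := (2 ^+ j) `^ (- (n%:R + s)).

Let box_indic r (h : 'rV[R]_n) : R := \1_(@rV_box R n r) h.

(** One index [j] serves an inner and an outer shell, so that a single series over [j] dominates the
    function; each shell is enlarged to a box of known measure. The first alternative is the
    origin. *)
Lemma kernel0_shell h : Num.min (enorm h) 1 * kernel0 h <=
  0 \/ exists j, Num.min (enorm h) 1 * kernel0 h <=
   a j * box_indic (2 ^- j) h + b j * box_indic (2 ^+ j.+1) h.
Proof.
have ind0 r x : 0 <= box_indic r x by rewrite /box_indic indicE.
have [h0|h0] := eqVneq (enorm h) 0.
  by left; rewrite h0 min_l// mul0r.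
have hp : 0 < enorm h by rewrite lt_neqAle eq_sym h0 enorm_ge0.
right; have [h1|h1] := leP 1 (enorm h).
  have [j /andP[j1 j2]] := dyadic_bracket h1; exists j.
  rewrite mul1r -[leLHS]add0r lerD ?mulr_ge0 ?powR_ge0//.
  have -> : box_indic (2 ^+ j.+1) h = 1.
    rewrite /box_indic indicE mem_set// => i.
    by rewrite (le_trans (le_coord_enorm _ _))// ltW.
  rewrite mulr1 /kernel0 /b !powRN lef_pV2 ?posrE ?powR_gt0 ?exprn_gt0//.
  by rewrite ge0_ler_powR ?nnegrE ?addr_ge0 ?exprn_ge0 ?enorm_ge0// ltW.
have h1' : 1 <= (enorm h)^-1 by rewrite invf_ge1// ltW.
have [j /andP[j1 j2]] := dyadic_bracket h1'; exists j.
rewrite -[leLHS]addr0 lerD ?mulr_ge0 ?powR_ge0//.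
have -> : box_indic (2 ^- j) h = 1.
  rewrite /box_indic indicE mem_set// => i.
  rewrite (le_trans (le_coord_enorm _ _))//.
  by rewrite -[enorm h]invrK lef_pV2 ?posrE ?invr_gt0 ?exprn_gt0.
rewrite mulr1 /kernel0 /a.
have -> : enorm h * enorm h `^ (- (n%:R + s)) = (enorm h)^-1 `^ theta.
  rewrite -[in RHS]powR_inv1 ?enorm_ge0// -powRrM.
  rewrite -{1}[enorm h]powRr1 ?enorm_ge0// -powRD; last by rewrite h0 implybT.
  by congr (_ `^ _); rewrite /theta; ring.
by rewrite ge0_ler_powR ?nnegrE ?invr_ge0 ?exprn_ge0 ?enorm_ge0// ltW.
Qed.

(** The measures [(2 * 2^-j)^n] and [(2 * 2^(j+1))^n] of the boxes turn the shell bounds into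
    geometric series. *)
Lemma kernel0_fin : (\int[mu]_h (Num.min (enorm h) 1 * kernel0 h)%:E < +oo)%E.
Proof.
pose g_ j (h : 'rV[R]_n) := a j * box_indic (2 ^- j) h + b j * box_indic (2 ^+ j.+1) h.
have ind0 r x : 0 <= box_indic r x by rewrite /box_indic indicE.
have mind r : measurable_fun setT (box_indic r).
  by apply: measurable_indic; exact: measurable_rV_box.
have g0 j h : 0 <= g_ j h by rewrite addr_ge0// mulr_ge0// powR_ge0.
have mg j : measurable_fun setT (g_ j).
  by apply: measurable_funD; apply: measurable_funM => //; exact: measurable_cst.
have int_ind r : 0 <= r -> (\int[mu]_h (box_indic r h)%:E = ((r *+ 2) ^+ n)%:E)%E.
  move=> r0; rewrite integral_indic//; last exact: measurable_rV_box.
  by rewrite setIT; exact: lebesgue_rV_box.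
apply: (@le_lt_trans _ _ (\int[mu]_h \sum_(j <oo) (g_ j h)%:E)%E).
  apply: ge0_le_integral => //.
  - by move=> h _; rewrite lee_fin mulr_ge0 ?powR_ge0// le_min enorm_ge0 ler01.
  - apply/measurable_EFinP; apply: measurable_funM; last exact: measurable_kernel0.
    by apply: measurable_minr; [exact: measurable_enorm|exact: measurable_cst].
  - apply: ge0_emeasurable_sum => //.
    + by move=> j x _ _; rewrite lee_fin.
    + by move=> j _; exact/measurable_EFinP.
  - move=> h _; have [le0|[j lej]] := kernel0_shell h.
      apply: (@le_trans _ _ 0%E); first by rewrite lee_fin.
      by apply: nneseries_ge0 => j _ _; rewrite lee_fin.
    apply: (@le_trans _ _ (g_ j h)%:E); first by rewrite lee_fin.
    rewrite (@nneseriesD1 _ _ j xpredT)//; last by move=> i _; rewrite lee_fin.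
    rewrite leeDl//; apply: nneseries_ge0 => i _ _; by rewrite lee_fin.
rewrite integral_nneseries//; last 2 first.
- by move=> j; exact/measurable_EFinP.
- by move=> j x _; rewrite lee_fin.
have intg j : (\int[mu]_h (g_ j h)%:E =
  (a j * ((2 ^- j) *+ 2) ^+ n + b j * (2 ^+ j.+1 *+ 2) ^+ n)%:E)%E.
  rewrite ge0_integralD_EFin//; last 4 first.
  - by apply: measurable_funM => //; exact: measurable_cst.
  - by apply: measurable_funM => //; exact: measurable_cst.
  - by move=> x; rewrite mulr_ge0// powR_ge0.
  - by move=> x; rewrite mulr_ge0// powR_ge0.
  rewrite !ge0_integralZ_EFin ?powR_ge0// !int_ind ?invr_ge0 ?exprn_ge0//.
have two0 : 0 <= 2 :> R by [].
(* The ratios of the two series: [r1 < 1] is the condition [s < 1] at the origin, [r2 < 1] is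
   [0 < s] at infinity. *)
pose r1 : R := 2 `^ (s - 1); pose r2 : R := 2 `^ (- s).
have aE j : a j * ((2 ^- j) *+ 2) ^+ n = (2 `^ theta * 2 ^+ n) * r1 ^+ j.
  have -> : ((2 ^- j) *+ 2) ^+ n = 2 ^+ n * (2 ^+ n)^-1 ^+ j :> R.
    by rewrite -[_ *+ 2]mulr_natl exprMn !exprVn -!exprM mulnC.
  have -> : r1 = 2 `^ theta * (2 ^+ n)^-1.
    rewrite -powR_mulrn// -powRN -powRD ?pnatr_eq0 ?implybT//.
    by congr (_ `^ _); rewrite /theta; ring.
  by rewrite /a powR_expr// exprS exprMn; ring.
have bE j : b j * (2 ^+ j.+1 *+ 2) ^+ n = 4 ^+ n * r2 ^+ j.
  have -> : (2 ^+ j.+1 *+ 2) ^+ n = 4 ^+ n * (2 ^+ n) ^+ j :> R.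
    rewrite -[_ *+ 2]mulr_natl exprS mulrA exprMn -natrM; congr (_ * _).
    by rewrite -!exprM mulnC.
  have -> : r2 = 2 `^ (- (n%:R + s)) * 2 ^+ n.
    rewrite -powR_mulrn// -powRD ?pnatr_eq0 ?implybT//.
    by congr (_ `^ _); ring.
  by rewrite /b powR_expr// exprMn; ring.
have r11 : 0 <= r1 < 1.
  by rewrite powR_ge0/= powR_lt1 ?ltr1n// subr_lt0.
have r21 : 0 <= r2 < 1.
  by rewrite powR_ge0/= powR_lt1 ?ltr1n// oppr_lt0.
pose r := Num.max r1 r2.
apply: (@geometric_sum_lty _ _ (2 `^ theta * 2 ^+ n + 4 ^+ n) r) => [|j|j].
- by rewrite le_max gt_max; move/andP: r11 => [-> ->]; move/andP: r21 => [_ ->].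
- by apply: ge0_integral_EFin_ge0.
- rewrite intg lee_fin aE bE mulrDl lerD//.
    rewrite ler_wpM2l ?mulr_ge0 ?powR_ge0 ?exprn_ge0//.
    by rewrite lerXn2r ?nnegrE ?le_max ?powR_ge0 ?lexx.
  rewrite ler_wpM2l ?exprn_ge0//.
  by rewrite lerXn2r ?nnegrE ?le_max ?powR_ge0 ?lexx ?orbT.
Qed.

End kernel_integrability.

(** * The fractional kernel *)

Section kernel_truncation.
Context {R : realType} (n : nat) (s : R).
Hypotheses (n0 : (0 < n)%N) (s0 : 0 < s) (s1 : s < 1).
Local Notation mu := (@lebesgue_rV R n).
Local Notation K := (@frac_kernel R n s).
Local Notation kernel0 := (@kernel0 R n s).
Implicit Types (h x y : 'rV[R]_n) (psi : 'rV[R]_n -> R).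

Lemma kernel0E x y : K x y = kernel0 (x - y).
Proof. by rewrite enorm_frac_kernel. Qed.

Lemma kernel0N h : kernel0 (- h) = kernel0 h.
Proof. by rewrite /kernel0 enormN. Qed.

Lemma kernel0_ge0 h : 0 <= kernel0 h.
Proof. exact: powR_ge0. Qed.

Lemma kernel0_eq0 h : enorm h = 0 -> kernel0 h = 0.
Proof.
move=> h0; rewrite /kernel0 h0 powR0// oppr_eq0 gt_eqF// ltr_wpDl//.
Qed.

Lemma integral_rV_shift h (f : 'rV[R]_n -> \bar R) : measurable_fun setT f ->
  (\int[mu]_x f (x + h)%R = \int[mu]_x f x)%E.
Proof.
move=> mf; rewrite [LHS]integralE [RHS]integralE; congr (_ - _)%E.
  have fp0 x : (0 <= f^\+ x)%E by [].
  rewrite -(ge0_integral_rV_shift h (measurable_funepos mf) fp0).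
  by apply: eq_integral => x _; rewrite !funeposE.
have fn0 x : (0 <= f^\- x)%E by [].
rewrite -(ge0_integral_rV_shift h (measurable_funeneg mf) fn0).
by apply: eq_integral => x _; rewrite !funenegE.
Qed.

Let trunc j h : R := kernel0 h * \1_[set h | j.+1%:R^-1 <= enorm h] h.

Let mtrunc j : measurable_fun setT (trunc j).
Proof.
apply: measurable_funM; first exact: measurable_kernel0.
apply: measurable_indic.
rewrite (_ : [set _ | _] = @enorm R n @^-1` `[j.+1%:R^-1, +oo[).
  by rewrite -[X in measurable X]setTI; exact: measurable_enorm.
by apply/seteqP; split => h /=; rewrite in_itv/= andbT.
Qed.

Let trunc_ge0 j h : 0 <= trunc j h.
Proof. by rewrite mulr_ge0 ?kernel0_ge0 ?indicE. Qed.

Let trunc_le j h : trunc j h <= kernel0 h.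
Proof.
by rewrite /trunc ler_piMr ?kernel0_ge0// indicE; case: (_ \in _).
Qed.

(** On the support [|h| >= 1/(j+1)] of the truncation, [1 <= (j+1) * min(|h|, 1)], so [kernel0_fin]
    applies. *)
Let trunc_fin j : exists2 m, 0 <= m & (\int[mu]_h (trunc j h)%:E = m%:E)%E.
Proof.
apply: ge0_fin_EFin; first exact: ge0_integral_EFin_ge0.
have mk := kernel0_fin n0 s0 s1.
have mm : measurable_fun setT (fun h : 'rV[R]_n => Num.min (enorm h) 1 * kernel0 h).
  apply: measurable_funM; last exact: measurable_kernel0.
  by apply: measurable_minr; [exact: measurable_enorm|exact: measurable_cst].
have m0 h : 0 <= Num.min (enorm h) 1 * kernel0 h.
  by rewrite mulr_ge0 ?kernel0_ge0// le_min enorm_ge0 ler01.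
apply: (@le_lt_trans _ _ (\int[mu]_h (j.+1%:R * (Num.min (enorm h) 1 * kernel0 h))%:E)%E).
  apply: ge0_le_integral_EFin => //.
    by apply: measurable_funM => //; exact: measurable_cst.
  move=> h; rewrite /trunc indicE; case: (boolP (h \in _)) => [|_]; last first.
    by rewrite mulr0 mulr_ge0.
  rewrite inE/= mulr1 mulrA => jh; rewrite ler_peMl ?kernel0_ge0//.
  rewrite mulrC -ler_pdivrMr// mul1r le_min jh/=.
  by rewrite invf_le1// ler1n.
rewrite ge0_integralZ_EFin//; exact: lte_mul_pinfty.
Qed.

Definition frac_kernel_trunc j x y : R :=
  K x y * \1_[set h : 'rV[R]_n | j.+1%:R^-1 <= enorm h] (x - y).

Let frac_truncE j x y : frac_kernel_trunc j x y = trunc j (x - y).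
Proof. by rewrite /frac_kernel_trunc kernel0E. Qed.

(** The mass does not depend on [x] because the truncated kernel is an even function of [x - y] and
    the measure is translation invariant. *)
Lemma frac_kernel_truncP : exists m_ : nat -> R,
  forall j, jump_kernel mu (frac_kernel_trunc j) (m_ j).
Proof.
have /choice[m_ mP] j : exists m, 0 <= m /\ (\int[mu]_h (trunc j h)%:E = m%:E)%E.
  by have [m m0 mE] := trunc_fin j; exists m.
exists m_ => j; have [m0 mE] := mP j; split => //.
- by move=> x y; rewrite frac_truncE.
- move=> x y; rewrite !frac_truncE -opprB /trunc kernel0N.
  by congr (_ * _); rewrite !indicE; congr (_%:R); congr (nat_of_bool _);
    apply/idP/idP; rewrite !inE/= enormN.
- have := measurable2_sub (mtrunc j); congr measurable2.
  by apply/funext => x; apply/funext => y; rewrite frac_truncE.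
- move=> x; rewrite -mE.
  rewrite -(ge0_integral_rV_shift (- x) (f := fun h => (trunc j h)%:E)).
  + apply: eq_integral => y _; rewrite frac_truncE -opprB /trunc kernel0N.
    by congr (_%:E); congr (_ * _); rewrite !indicE; congr (_%:R); congr (nat_of_bool _);
      apply/idP/idP; rewrite !inE/= enormN.
  + exact/measurable_EFinP.
  + by move=> h; rewrite lee_fin.
Qed.

Lemma frac_kernel_trunc_le j x y : frac_kernel_trunc j x y <= K x y.
Proof. by rewrite frac_truncE kernel0E. Qed.

Lemma frac_kernel_trunc_nd i j x y : (i <= j)%N ->
  frac_kernel_trunc i x y <= frac_kernel_trunc j x y.
Proof.
move=> ij; rewrite /frac_kernel_trunc ler_wpM2l ?frac_kernel_ge0// !indicE.
have [|//] := boolP (_ \in [set h | i.+1%:R^-1 <= enorm h]).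
rewrite inE/= => h; rewrite mem_set//= (le_trans _ h)//.
by rewrite lef_pV2 ?posrE// ler_nat.
Qed.

Lemma frac_kernel_trunc_cvg x y :
  frac_kernel_trunc ^~ x ^~ y @ \oo --> K x y.
Proof.
have [xy|xy] := eqVneq (enorm (x - y)) 0.
  rewrite (_ : (fun j => _) = cst (K x y)); first exact: cvg_cst.
  by apply/funext => j; rewrite /frac_kernel_trunc kernel0E kernel0_eq0// mul0r.
apply: (@cvg_near_cst _ _ _ _ _ _); near=> j.
rewrite /frac_kernel_trunc indicE mem_set ?mulr1//=.
have e0 : 0 < enorm (x - y) by rewrite lt_neqAle eq_sym xy enorm_ge0.
rewrite -[enorm _]invrK lef_pV2 ?posrE ?invr_gt0//.
have : (enorm (x - y))^-1 <= j%:R by near: j; exact: nbhs_infty_ger.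
by move=> /le_trans; apply; rewrite ler_nat.
Unshelve. all: by end_near. Qed.

Section frac_resolvent.
Variables (lam : R) (A : set 'rV[R]_n).
Hypotheses (lam0 : 0 <= lam) (mA : measurable A) (Aoo : (mu A < +oo)%E).

Lemma frac_resolvent_exists : exists phi : 'rV[R]_n -> R,
  [/\ measurable_fun setT phi, forall x, 0 <= phi x <= 1,
      forall psi, jump_integrable mu K psi ->
        \int[mu]_x (phi x * (psi x + lam * jump_op mu K psi x)) =
        \int[mu]_x (\1_A x * psi x) &
      [/\ (\int[mu]_x ((\1_A x - phi x) ^+ 2)%:E <=
             \int[mu]_x (\1_A x * (1 - phi x))%:E)%E,
          ((lam / 2)%:E * energy mu K phi <=
             \int[mu]_x (\1_A x * (1 - phi x))%:E)%E &
          (\int[mu]_x (\1_A x * (1 - phi x))%:E <=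
             (lam / 2)%:E * energy mu K (\1_A))%E]].
Proof.
have [m_ Km] := frac_kernel_truncP.
apply: (@jump_resolvent_exists _ _ _ mu K lam A _ _ lam0 mA Aoo frac_kernel_trunc m_ Km).
- exact: frac_kernel_ge0.
- exact: measurable2_frac_kernel.
- exact: frac_kernel_trunc_nd.
- exact: frac_kernel_trunc_le.
- exact: frac_kernel_trunc_cvg.
Qed.

End frac_resolvent.

(** The features of a test function on which the estimates rest. The modulus [min(|h|, 1)] is the
    weight for which the kernel is integrable, and the box bounds the support. *)
Definition lip_box psi (C r : R) :=
  [/\ measurable_fun setT psi, forall x, `|psi x| <= C,
      forall x h, `|psi (x + h) - psi x| <= C * Num.min (enorm h) 1 &
      forall x, psi x != 0 -> rV_box r x].

Lemma measurable_min_enorm :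
  measurable_fun setT (fun h : 'rV[R]_n => Num.min (enorm h) 1).
Proof. by apply: measurable_minr; [exact: measurable_enorm|exact: measurable_cst]. Qed.

Lemma min_enorm_ge0 h : 0 <= Num.min (enorm h) 1.
Proof. by rewrite le_min enorm_ge0 ler01. Qed.

Lemma integrable_kernel0_min :
  mu.-integrable setT (EFin \o (fun h : 'rV[R]_n => Num.min (enorm h) 1 * kernel0 h)).
Proof.
apply: integrable_norm_lty.
  by apply: measurable_funM; [exact: measurable_min_enorm|exact: measurable_kernel0].
under eq_integral do rewrite ger0_norm ?mulr_ge0 ?min_enorm_ge0 ?kernel0_ge0//.
exact: kernel0_fin.
Qed.

Section lip_box.
Variables (psi : 'rV[R]_n -> R) (C r : R).
Hypotheses (r0 : 0 <= r) (Hpsi : lip_box psi C r).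

Let mpsi : measurable_fun setT psi. Proof. by case: Hpsi. Qed.
Let psiC x : `|psi x| <= C. Proof. by case: Hpsi. Qed.
Let C0 : 0 <= C. Proof. by apply: le_trans (psiC 0). Qed.
Let psiL x h : `|psi (x + h) - psi x| <= C * Num.min (enorm h) 1.
Proof. by case: Hpsi. Qed.
Let S : set 'rV[R]_n := rV_box r.
Let mS : measurable S. Proof. exact: measurable_rV_box. Qed.
Let psiS x : ~ S x -> psi x = 0.
Proof. by move=> nS; apply/eqP/negPn/negP => p; apply: nS; case: Hpsi => _ _ _; exact. Qed.
Let int_S : (\int[mu]_x (\1_S x)%:E = ((r *+ 2) ^+ n)%:E)%E.
Proof. by rewrite integral_indic// setIT; exact: lebesgue_rV_box. Qed.
Let mindS : measurable_fun setT (\1_S : 'rV[R]_n -> R).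
Proof. exact: measurable_indic. Qed.

Let indS0 (x : 'rV[R]_n) : 0 <= \1_S x :> R. Proof. by rewrite indicE. Qed.

Lemma integrable_lip_box : mu.-integrable setT (EFin \o psi).
Proof.
apply: integrable_norm_lty => //.
apply: (@le_lt_trans _ _ (\int[mu]_x (C * \1_S x)%:E)%E).
  apply: ge0_le_integral_EFin => //.
  - exact: measurableT_comp.
  - by apply: measurable_funM => //; exact: measurable_cst.
  move=> x; rewrite indicE; case: (boolP (x \in S)) => [_|]; first by rewrite mulr1.
  by rewrite notin_setE => /psiS ->; rewrite normr0 mulr0.
rewrite (ge0_integralZ_EFin mu mindS indS0 C0).
by rewrite int_S -EFinM ltry.
Qed.

Lemma lip_box_diff_le x h : `|psi (x + h) - psi x| <=
  C * Num.min (enorm h) 1 * (\1_S x + \1_S (x + h)).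
Proof.
rewrite !indicE; have [xS|xS] := boolP (x \in S).
  rewrite (le_trans (psiL x h))// ler_peMr ?mulr_ge0 ?min_enorm_ge0//.
  by rewrite lerDl.
have [xhS|xhS] := boolP (x + h \in S); first by rewrite add0r mulr1.
move: xS xhS; rewrite !notin_setE => /psiS -> /psiS ->.
by rewrite subr0 normr0 addr0 mulr0.
Qed.

(** The difference vanishes unless [x] or [x + h] lies in the box; this accounts for twice the
    measure [(2 r)^n]. *)
Lemma integral_lip_box_diff h : (\int[mu]_x (`|psi (x + h) - psi x|)%:E <=
  (2 * (r *+ 2) ^+ n * C * Num.min (enorm h) 1)%:E)%E.
Proof.
have mSh : measurable_fun setT (fun x : 'rV[R]_n => \1_S (x + h) : R).
  exact: (measurableT_comp mindS (measurable_addr h)).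
have ind0 x : 0 <= \1_S x :> R by rewrite indicE.
have cm0 : 0 <= C * Num.min (enorm h) 1 by rewrite mulr_ge0 ?min_enorm_ge0.
apply: (@le_trans _ _ (\int[mu]_x (C * Num.min (enorm h) 1 * (\1_S x + \1_S (x + h)))%:E)%E).
  apply: ge0_le_integral_EFin => //.
  - apply: measurableT_comp => //; apply: measurable_funB => //.
    exact: (measurableT_comp mpsi (measurable_addr h)).
  - apply: measurable_funM; first exact: measurable_cst.
    exact: measurable_funD.
  - by move=> x; exact: (lip_box_diff_le x h).
have mss : measurable_fun setT (fun x => \1_S x + \1_S (x + h) : R).
  exact: measurable_funD.
have ss0 x : 0 <= \1_S x + \1_S (x + h) :> R by rewrite addr_ge0.
rewrite (ge0_integralZ_EFin mu mss ss0 cm0).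
rewrite (ge0_integralD_EFin mu mindS mSh indS0 (fun x => indS0 (x + h))).
have mES : measurable_fun setT (fun x => (\1_S x : R)%:E) by exact/measurable_EFinP.
have ES0 x : (0 <= (\1_S x : R)%:E)%E by rewrite lee_fin.
rewrite (ge0_integral_rV_shift h mES ES0).
rewrite int_S -EFinD -EFinM lee_fin.
by rewrite le_eqVlt; apply/orP; left; apply/eqP; ring.
Qed.

(** Substitute [y = x + h]. In the double integral [x] is integrated first: the [L^1] modulus of
    continuity of [psi] is a multiple of [min(|h|, 1)], and [kernel0_fin] does the rest. *)
Lemma jump_integrable_lip_box : jump_integrable mu K psi.
Proof.
have mpB : measurable2 (fun x y => psi x - psi y).
  by apply: measurable2B; [exact: measurable2_fst|exact: measurable2_snd].
have mK := @measurable2_frac_kernel R n s.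
have mps : measurable2 (fun x h : 'rV[R]_n => psi (x + h)).
  split; apply: (measurableT_comp mpsi).
  by apply: measurable_fun_rVD; [exact: measurable_fst|exact: measurable_snd].
have mk0 := @measurable_kernel0 R n s.
have mD : measurable2 (fun x h : 'rV[R]_n => `|psi (x + h) - psi x| * kernel0 h).
  apply: measurable2M; last exact: (measurable2_snd mk0).
  by apply/measurable2_norm/measurable2B => //; exact: measurable2_fst.
have shiftE x : (\int[mu]_y (`|psi x - psi y| * K x y)%:E =
    \int[mu]_h (`|psi (x + h) - psi x| * kernel0 h)%:E)%E.
  rewrite -(ge0_integral_rV_shift (- x)
    (f := fun h => (`|psi (x + h) - psi x| * kernel0 h)%:E)).
  - apply: eq_integral => y _; congr (_%:E).
    have -> : x + (y - x) = y by rewrite addrC subrK.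
    by rewrite distrC kernel0E -[kernel0 (x - y)]kernel0N opprB.
  - by apply/measurable_EFinP; exact: (measurable2_app x mD).
  - by move=> h; rewrite lee_fin mulr_ge0 ?kernel0_ge0.
split => //.
- exact: integrable_lip_box.
- move=> x; apply: integrable_norm_lty.
    exact: (measurable2_app x (measurable2M mpB mK)).
  under eq_integral do rewrite normrM (ger0_norm (frac_kernel_ge0 _ _ _)).
  rewrite shiftE.
  apply: (@le_lt_trans _ _ (\int[mu]_h (C * (Num.min (enorm h) 1 * kernel0 h))%:E)%E).
    apply: ge0_le_integral_EFin => //.
    + exact: (measurable2_app x mD).
    + apply: measurable_funM; first exact: measurable_cst.
      by apply: measurable_funM => //; exact: measurable_min_enorm.
    + by move=> h; rewrite mulr_ge0 ?kernel0_ge0.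
    + by move=> h; rewrite mulrA ler_wpM2r ?kernel0_ge0.
  rewrite ge0_integralZ_EFin//.
  + by apply: lte_mul_pinfty => //; exact: kernel0_fin.
  + by apply: measurable_funM => //; exact: measurable_min_enorm.
  + by move=> h; rewrite mulr_ge0 ?kernel0_ge0 ?min_enorm_ge0.
- have -> : dint mu (fun x y => `|psi x - psi y| * K x y) =
    dint mu (fun h x : 'rV[R]_n => `|psi (x + h) - psi x| * kernel0 h).
    rewrite -[RHS]dint_swap; last 2 first.
    + exact: (measurable2_swap mD).
    + by move=> h x; rewrite mulr_ge0 ?kernel0_ge0.
    by rewrite dint.unlock; apply: eq_integral => x _; exact: shiftE.
  rewrite dint.unlock.
  pose B : R := 2 * (r *+ 2) ^+ n * C.
  have B0 : 0 <= B by rewrite !mulr_ge0// exprn_ge0// mulrn_wge0.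
  apply: (@le_lt_trans _ _ (\int[mu]_h (B * (Num.min (enorm h) 1 * kernel0 h))%:E)%E).
    apply: ge0_le_integral => //.
    + move=> h _; apply: ge0_integral_EFin_ge0 => x.
      by rewrite mulr_ge0 ?kernel0_ge0.
    + apply: measurable_inner; first exact: (measurable2_swap mD).
      by move=> h x; rewrite mulr_ge0 ?kernel0_ge0.
    + apply/measurable_EFinP; apply: measurable_funM; first exact: measurable_cst.
      by apply: measurable_funM => //; exact: measurable_min_enorm.
    + move=> h _; under eq_integral do rewrite mulrC.
      rewrite ge0_integralZ_EFin ?kernel0_ge0//; last first.
        apply: measurableT_comp => //; apply: measurable_funB => //.
        exact: (measurableT_comp mpsi (measurable_addr h)).
      rewrite mulrA mulrC EFinM lee_wpmul2l ?lee_fin ?kernel0_ge0//.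
      exact: integral_lip_box_diff.
  rewrite ge0_integralZ_EFin//.
  + by apply: lte_mul_pinfty => //; exact: kernel0_fin.
  + by apply: measurable_funM => //; exact: measurable_min_enorm.
  + by move=> h; rewrite mulr_ge0 ?kernel0_ge0 ?min_enorm_ge0.
Qed.

(** The integrand is absolutely integrable, so the truncated integrals converge to the full one by
    dominated convergence along every sequence of radii tending to [0]. *)
Lemma frac_laplacian_lip_box x :
  frac_laplacian s psi x = c_ns n s * jump_op mu K psi x.
Proof.
have [_ _ ij _] := jump_integrable_lip_box.
rewrite /frac_laplacian; congr (_ * _); apply/cvg_lim => //.
apply/cvg_at_rightP => u [u0 ucvg].
pose g y := (psi x - psi y) * K x y.
have mg : measurable_fun setT g.
  by apply/measurable_EFinP; exact: measurable_int (ij x).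
have mD e : measurable [set y : 'rV[R]_n | e <= enorm (x - y)].
  rewrite (_ : [set _ | _] = (fun y => enorm (x - y)) @^-1` `[e, +oo[).
    rewrite -[X in measurable X]setTI.
    exact: (measurable2_app x (measurable2_sub (@measurable_enorm R n))).
  by apply/seteqP; split => h /=; rewrite in_itv/= andbT.
under eq_fun do rewrite Rintegral_mkcond.
apply: (@dominated_cvg_Rintegral _ _ _ mu
  (fun j => g \_ [set y | u j <= enorm (x - y)]) g (fun y => `|g y|)).
- move=> j.
  exact: ((measurable_restrictT g (mD (u j))).1 (measurable_funTS mg)).
- exact: mg.
- apply: aeW => y.
  have [xy|xy] := eqVneq (enorm (x - y)) 0.
    have gy0 : g y = 0 by rewrite /g kernel0E kernel0_eq0// mulr0.
    rewrite gy0 (_ : (fun j => _) = cst 0); first exact: cvg_cst.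
    by apply/funext => j; rewrite /patch; case: ifP.
  have e0 : 0 < enorm (x - y) by rewrite lt_neqAle eq_sym xy enorm_ge0.
  apply: (@cvg_near_cst _ _ _ _ _ _); near=> j.
  rewrite /patch mem_set//=; apply/ltW.
  by near: j; exact: (cvgr_lt _ ucvg _ e0).
- exact: (integrable_abse (ij x)).
- move=> j y; rewrite /patch; case: ifP => // _; by rewrite normr0.
Unshelve. all: by end_near. Qed.

End lip_box.

End kernel_truncation.

(** * Test functions *)

Lemma mean_value_bound (R : realType) (g dg : R -> R) (L a : R) :
  (forall t : R, is_derive t 1 g (dg t)) ->
  (forall t, `|t| <= `|a| -> `|dg t| <= L) ->
  `|g a - g 0| <= L * `|a|.
Proof.
move=> gd dgL.
have cg b c : {within `[b, c], continuous g}.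
  apply: continuous_subspaceT => t.
  by apply: differentiable_continuous; apply/derivable1_diffP; case: (gd t).
have [a0|a0|->] := ltgtP a 0; last by rewrite subrr normr0 mulr0.
- have [c] := MVT a0 (fun t _ => gd t) (cg a 0).
  rewrite in_itv/= => /andP[ac c0]; rewrite sub0r distrC => ->.
  rewrite normrM normrN ler_wpM2r// dgL//.
  by rewrite (ltr0_norm c0) (ltr0_norm a0) lerN2 ltW.
- have [c] := MVT a0 (fun t _ => gd t) (cg 0 a).
  rewrite in_itv/= subr0 => /andP[c0 ca] ->.
  rewrite normrM ler_wpM2r// dgL//.
  by rewrite (gtr0_norm c0) (gtr0_norm a0) ltW.
Qed.

Section test_functions.
Context {R : realType} (n : nat).
Implicit Types (u : 'rV[R]_n -> R) (x h : 'rV[R]_n).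

Lemma is_derive_line u (z e : 'rV[R]_n) (t : R) : (forall x, derivable u x e) ->
  is_derive t 1 (fun t : R => u (z + t *: e)) ('D_e u (z + t *: e)).
Proof.
move=> du.
have E : (fun h : R => h^-1 *: (((fun t : R => u (z + t *: e)) \o shift t) (h *: 1) -
    u (z + t *: e))) =
    (fun h : R => h^-1 *: ((u \o shift (z + t *: e)) (h *: e) - u (z + t *: e))).
  apply/funext => k /=; congr (_ *: (u _ - _)).
  by rewrite [k *: 1]mulr1 scalerDl addrCA addrA.
split; first by rewrite /derivable E; exact: du.
by rewrite /derive E.
Qed.

(** The first [k] coordinates of [x + h] and the others of [x]: the corners of a path from [x] to
    [x + h] along the axes, on which partial derivatives suffice. *)
Let path x h (k : nat) : 'rV[R]_n :=
  \row_i (x ord0 i + (if (i < k)%N then h ord0 i else 0)).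

(** One mean value estimate for each of the [n] legs of [path]. The legs start from a point of the
    box of radius [r] and move each coordinate by at most [m <= 1], so they stay in the box of
    radius [r + 1]. *)
Lemma box_mean_value u (L r m : R) x h :
  (forall i z, derivable u z (delta_mx ord0 i)) ->
  (forall i z, rV_box (r + 1) z -> `|partial i u z| <= L) ->
  rV_box r x -> 0 <= m <= 1 -> (forall i, `|h ord0 i| <= m) ->
  `|u (x + h) - u x| <= n%:R * (L * m).
Proof.
move=> du dL xr /andP[m0 m1] hm.
have [n0|n0] := posnP n.
  have nR0 : n%:R = 0 :> R by rewrite n0.
  have -> : x + h = x by apply/rowP => -[i i0]; exfalso; move: i0; rewrite n0.
  by rewrite nR0 mul0r subrr normr0.
have L0 : 0 <= L.
  by apply: le_trans (dL (Ordinal n0) x _) => // i; rewrite (le_trans (xr i))// lerDl.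
have step k : (k <= n)%N -> `|u (path x h k) - u x| <= k%:R * (L * m).
  elim: k => [|k IH] kn.
    rewrite mul0r (_ : path x h 0 = x) ?subrr ?normr0//.
    by apply/rowP => i; rewrite mxE/= addr0.
  pose j := Ordinal kn.
  have pS : path x h k.+1 = path x h k + h ord0 j *: delta_mx ord0 j.
    apply/rowP => i; rewrite !mxE eqxx/= ltnS -addrA; congr (_ + _).
    have [->|ij] := eqVneq i j.
      by rewrite /= leqnn ltnn mulr1 add0r.
    by rewrite mulr0 addr0 ltn_neqAle (_ : (i : nat) != k).
  rewrite -(subrKA (u (path x h k))) (le_trans (ler_normD _ _))//.
  rewrite -natr1 mulrDl mul1r addrC lerD ?IH// 1?ltnW//.
  have := mean_value_bound (fun t => is_derive_line (path x h k) t (du j)) (L := L)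
    (a := h ord0 j).
  rewrite -pS scale0r addr0 => /(_ _)/le_trans; apply; last by rewrite ler_wpM2l.
  move=> t ta; apply: dL => i; rewrite !mxE eqxx/=.
  have [->|ij] := eqVneq i j.
    rewrite /= ltnn addr0 mulr1 (le_trans (ler_normD _ _))// lerD//.
    by rewrite (le_trans ta)// (le_trans (hm _)).
  rewrite mulr0 addr0 (le_trans (ler_normD _ _))// lerD//.
  by case: ifP => _; rewrite ?normr0// (le_trans (hm _)).
have := step n (leqnn n); rewrite (_ : path x h n = x + h)//.
by apply/rowP => i; rewrite !mxE ltn_ord.
Qed.

Lemma compact_rV_box (r : R) : compact (@rV_box R n r).
Proof.
have := @rV_compact R n (fun=> [set` `[- r, r]]) (fun=> @segment_compact R _ _).
congr compact; apply/seteqP; split => x /= h i; have := h i; rewrite in_itv/= ler_norml//.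
Qed.

Lemma continuous_rV_box_bounded u (r : R) : continuous u ->
  exists2 M, 0 <= M & forall x, rV_box r x -> `|u x| <= M.
Proof.
move=> cu.
have [M [_ MP]] := compact_bounded (continuous_compact
  (continuous_subspaceT cu) (@compact_rV_box r)).
exists (`|M| + 1); first by rewrite addr_ge0.
move=> x xr; apply: (MP (`|M| + 1)); first by rewrite (le_lt_trans (ler_norm M))// ltrDl.
by exists x.
Qed.

Lemma test_function_lip_box u : test_function u ->
  exists C r, 0 <= r /\ lip_box u C r.
Proof.
move=> [Ck cpt].
have [cu /all_and2[du cd]] := Ck 1%N.
have [N [_ NP]] := compact_bounded cpt.
pose r := `|N| + 1.
have r0 : 0 <= r by rewrite addr_ge0.
have sr x : u x != 0 -> rV_box r x.
  move=> ux i; have : `|x| <= r.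
    apply: NP; first by rewrite (le_lt_trans (ler_norm N))// ltrDl.
    exact: subset_closure.
  apply: le_trans; rewrite -[`|x|]/(mx_norm x) mx_normrE.
  exact: (le_bigmax _ (fun ij => `|x ij.1 ij.2|) (ord0, i)).
have [M M0 MP] := continuous_rV_box_bounded r cu.
have MT x : `|u x| <= M.
  have [->|/sr/MP//] := eqVneq (u x) 0; by rewrite normr0.
have /choice[L LP] (i : 'I_n) : exists K : R,
    0 <= K /\ forall x, rV_box (r + 1) x -> `|partial i u x| <= K.
  have [K K0 KP] := continuous_rV_box_bounded (r + 1) (cd i).
  by exists K.
pose S := \sum_i L i.
have LS i z : rV_box (r + 1) z -> `|partial i u z| <= S.
  move=> zr; have [_ /(_ z zr) h] := LP i; rewrite (le_trans h)// /S (bigD1 i)//= lerDl.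
  by apply: sumr_ge0 => j _; case: (LP j).
have S0 : 0 <= S by apply: sumr_ge0 => i _; case: (LP i).
(* [n * S] serves [|h| <= 1] through the mean value bound, [2 * M] serves [|h| > 1]. *)
pose C := n%:R * S + 2 * M.
have nS0 : 0 <= n%:R * S by rewrite mulr_ge0.
exists C, r; split => //; split.
- exact: continuous_measurable_rV.
- by move=> x; rewrite (le_trans (MT x))// /C; lra.
- move=> x h; have [h1|h1] := leP (enorm h) 1; last first.
    rewrite mulr1 (le_trans (ler_normB _ _))// /C.
    have := MT x; have := MT (x + h); lra.
  have e01 : 0 <= enorm h <= 1 by rewrite enorm_ge0.
  have hm i : `|h ord0 i| <= enorm h by exact: le_coord_enorm.
  have le1 y k : rV_box r y -> enorm k = enorm h -> `|u (y + k) - u y| <= C * enorm h.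
    move=> yr kE; rewrite (le_trans (box_mean_value (fun i => du i) LS yr e01 _))//.
      by move=> i; rewrite -kE le_coord_enorm.
    by rewrite mulrA ler_wpM2r ?enorm_ge0// /C lerDl mulr_ge0.
  (* [le1] wants its base point in the box. If only [x + h] is known to be there, it is applied at
     [x + h] with the increment [- h]. *)
  have [ux|/sr xr] := eqVneq (u x) 0; last exact: le1.
  have [uxh|/sr xhr] := eqVneq (u (x + h)) 0.
    by rewrite ux uxh subrr normr0 mulr_ge0 ?enorm_ge0// /C addr_ge0// mulr_ge0.
  by have := le1 (x + h) (- h) xhr (enormN h); rewrite addrK distrC.
- exact: sr.
Qed.

End test_functions.

(** * Smooth bump functions *)

Section smooth_functions.
Context {R : realType}.
Implicit Types (f g : R -> R).

(** The class [C^k] on the line, with the derivative given as a witness, so that closure properties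
    are proved by exhibiting derivatives instead of computing limits. *)
Fixpoint smooth1 (k : nat) f : Prop :=
  match k with
  | 0%N => continuous f
  | m.+1 => continuous f /\
      exists df : R -> R, (forall t : R, is_derive t 1 f (df t)) /\ smooth1 m df
  end.

Lemma smooth1_continuous k f : smooth1 k f -> continuous f.
Proof. by case: k => // k []. Qed.

Lemma smooth1S k f : smooth1 k.+1 f -> smooth1 k f.
Proof.
elim: k f => [|k IH] f; first by case.
by move=> [cf [df [fdf sdf]]]; split => //; exists df; split => //; exact: IH.
Qed.

Lemma is_derive_ext f g (x a b : R) : is_derive x 1 f a -> f =1 g -> a = b ->
  is_derive x 1 g b.
Proof. by move=> h /funext <- <-. Qed.

Lemma derivable_continuous f : (forall t : R, derivable f t 1) -> continuous f.
Proof.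
by move=> df t; apply: differentiable_continuous; apply/derivable1_diffP.
Qed.

Lemma smooth1_cst k c : smooth1 k (fun=> c).
Proof.
elim: k c => [|k IH] c; first exact: cst_continuous.
split; first exact: cst_continuous.
by exists (fun=> 0); split => // t; exact: is_derive_cst.
Qed.

Lemma smooth1D k f g : smooth1 k f -> smooth1 k g ->
  smooth1 k (fun t => f t + g t).
Proof.
elim: k f g => [|k IH] f g.
  by move=> cf cg t; apply: cvgD; [exact: cf|exact: cg].
move=> [cf [df [fdf sdf]]] [cg [dg [gdg sdg]]]; split.
  by move=> t; apply: cvgD; [exact: cf|exact: cg].
exists (fun t => df t + dg t); split; last exact: IH.
by move=> t; apply: is_derive_ext (is_deriveD (fdf t) (gdg t)) _ _.
Qed.

Lemma smooth1M k f g : smooth1 k f -> smooth1 k g ->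
  smooth1 k (fun t => f t * g t).
Proof.
elim: k f g => [|k IH] f g.
  by move=> cf cg t; apply: cvgM; [exact: cf|exact: cg].
move=> sf sg; have := smooth1S sf; have := smooth1S sg.
move: sf sg => [cf [df [fdf sdf]]] [cg [dg [gdg sdg]]] sg sf; split.
  by move=> t; apply: cvgM; [exact: cf|exact: cg].
exists (fun t => f t * dg t + g t * df t); split.
  by move=> t; apply: is_derive_ext (is_deriveM (fdf t) (gdg t)) _ _.
by apply: smooth1D; exact: IH.
Qed.

Lemma smooth1_affine k f a b : smooth1 k f -> smooth1 k (fun t => f (a * t + b)).
Proof.
elim: k f => [|k IH] f.
  move=> cf t; apply: (@continuous_comp _ _ _ (fun t => a * t + b) f); last exact: cf.
  by apply: cvgD; [apply: cvgM; [exact: cvg_cst|exact: cvg_id]|exact: cvg_cst].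
move=> [cf [df [fdf sdf]]].
have d (t : R) : is_derive t 1 (fun t => f (a * t + b)) (a * df (a * t + b)).
  have da : is_derive t 1 (fun t : R => a * t + b) a.
    apply: is_derive_ext (is_deriveD (is_deriveZ a (is_derive_id t 1)) (is_derive_cst b t 1)) _ _ => //.
    by rewrite addr0 /GRing.scale/= mulr1.
  have dc := is_derive1_comp (g := fun t : R => a * t + b) (fdf (a * t + b)) da.
  by apply: (is_derive_ext dc) => //; rewrite mulrC.
split; first by apply: derivable_continuous => t; case: (d t).
exists (fun t => a * df (a * t + b)); split => //.
by apply: smooth1M; [exact: smooth1_cst|exact: IH].
Qed.

(** The functions [t^-m e^(-1/t)], extended by [0]. Their span is closed under differentiation, so
    smoothness of all of them follows by a single induction on the order. *)
Definition flat (m : nat) (t : R) : R :=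
  if 0 < t then (t^-1) ^+ m * expR (- t^-1) else 0.

Lemma flat_le0 m t : t <= 0 -> flat m t = 0.
Proof. by rewrite /flat ltNge => ->. Qed.

Lemma flat_ge0 m t : 0 <= flat m t.
Proof.
rewrite /flat; case: ltP => // t0.
by rewrite mulr_ge0 ?expR_ge0// exprn_ge0// invr_ge0 ltW.
Qed.

(** From [e^(1/t) >= (1/t)^(m+2) / (m+2)!]. The quadratic bound is what makes the derivative at [0]
    vanish. *)
Lemma flat_le_sqr m t : flat m t <= (m.+2)`!%:R * t ^+ 2.
Proof.
rewrite /flat; case: ltP => [t0|t0]; last by rewrite mulr_ge0// sqr_ge0.
have t1 : 0 <= t^-1 by rewrite invr_ge0 ltW.
have f0 : 0 < (m.+2)`!%:R :> R by rewrite ltr0n fact_gt0.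
have := expR_ge1Dxn m.+1 t1 => /(le_trans _) -/(_ (t^-1 ^+ m.+2 / (m.+2)`!%:R)).
rewrite lerDr ler01 => /(_ isT); rewrite ler_pdivrMr// => h.
rewrite expRN -ler_pdivrMr ?exprn_gt0// -[_ / t ^+ 2]mulrC.
have -> : (t ^+ 2)^-1 * (t^-1 ^+ m * (expR t^-1)^-1) = t^-1 ^+ m.+2 / expR t^-1.
  by rewrite -exprVn !exprS expr0; ring.
by rewrite ler_pdivrMr ?expR_gt0// mulrC.
Qed.

Lemma is_derive_flat m (t : R) :
  is_derive t 1 (flat m) (flat m.+2 t - m%:R * flat m.+1 t).
Proof.
have [t0|t0|->] := ltgtP t 0.
- rewrite !flat_le0 ?(ltW t0)// mulr0 subr0.
  apply: (near_eq_is_derive _ (is_derive_cst (0 : R) t (1 : R))).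
  near=> u; rewrite flat_le0//=; apply/ltW; near: u; exact: lt_nbhsl.
- apply: (@near_eq_is_derive _ _ _ (fun u : R => (u^-1) ^+ m * expR (- u^-1))).
    near=> u; rewrite /flat; case: ltP => // u0; exfalso; move: u0; apply/negP.
    by rewrite -ltNge; near: u; exact: lt_nbhsr.
  have tN0 : t != 0 by rewrite gt_eqF.
  have dV : is_derive t 1 (fun u : R => u^-1) (- t ^- 2).
    apply: is_derive_ext (is_deriveV (f := id) tN0 (is_derive_id t 1)) _ _ => //.
    by rewrite /GRing.scale/= mulr1.
  have dE : is_derive t 1 (fun u : R => expR (- u^-1)) (t ^- 2 * expR (- t^-1)).
    have dN : is_derive t 1 (fun u : R => - u^-1) (t ^- 2).
      by apply: (is_derive_ext (is_deriveN dV)) => //; rewrite opprK.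
    have dc := is_derive1_comp (g := fun u : R => - u^-1) (is_derive_expR (- t^-1)) dN.
    by apply: (is_derive_ext dc) => //; rewrite mulrC.
  have dm := is_deriveM (is_deriveX m dV) dE.
  apply: (is_derive_ext dm); first by move=> u; rewrite !fctE.
  rewrite /flat t0 /GRing.scale/= !fctE -!exprVn.
  by clear dm; case: m => [|m] /=; rewrite !exprS ?expr0; ring.
rewrite !flat_le0// mulr0 subr0.
have h : (fun h : R => h^-1 *: ((flat m \o shift 0) (h *: (1 : R)) - flat m 0)) @ 0^' --> (0 : R).
  have C0 : 0 < (m.+2)`!%:R :> R by rewrite ltr0n fact_gt0.
  apply/cvgr0Pnorm_le => e e0; near=> h.
  rewrite /= addr0 [h *: 1]mulr1 (flat_le0 m (lexx 0)) subr0 normrM normfV.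
  have h0 : h != 0 by near: h; exact: nbhs_dnbhs_neq.
  rewrite (ger0_norm (flat_ge0 m h)) mulrC ler_pdivrMr ?normr_gt0//.
  rewrite (le_trans (flat_le_sqr m h))// -[h ^+ 2]real_normK ?num_real// expr2 mulrA.
  rewrite ler_wpM2r//.
  rewrite mulrC -ler_pdivlMr//; near: h; apply: dnbhs0_le; exact: divr_gt0.
split; first by apply/cvg_ex; exists 0; exact: h.
by apply/cvg_lim; [|exact: h].
Unshelve. all: by end_near. Qed.

Lemma smooth1_flat k m : smooth1 k (flat m).
Proof.
have cf j : continuous (flat j).
  by apply: derivable_continuous => t; case: (is_derive_flat j t).
elim: k m => [|k IH] m; first exact: cf.
split; first exact: cf.
exists (fun t => flat m.+2 t - m%:R * flat m.+1 t); split; first exact: is_derive_flat.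
have -> : (fun t => flat m.+2 t - m%:R * flat m.+1 t) =
    (fun t => flat m.+2 t + (- m%:R) * flat m.+1 t).
  by apply/funext => t; rewrite mulNr.
by apply: smooth1D; [exact: IH|apply: smooth1M; [exact: smooth1_cst|exact: IH]].
Qed.

Lemma flat0_le1 t : flat 0 t <= 1.
Proof.
rewrite /flat; case: ltP => // t0.
by rewrite expr0 mul1r expR_le1 oppr_le0 invr_ge0 ltW.
Qed.

Lemma flat0_cvg1 (c : R) : 0 < c -> flat 0 (j.+1%:R * c) @[j --> \oo] --> (1 : R).
Proof.
move=> c0.
have -> : (fun j : nat => flat 0 (j.+1%:R * c)) = (fun j : nat => expR (- (c^-1 * j.+1%:R^-1))).
  apply/funext => j; rewrite /flat mulr_gt0// expr0 mul1r invfM.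
  by rewrite mulrC.
have h : - (c^-1 * j.+1%:R^-1) @[j --> \oo] --> (0 : R).
  rewrite -[X in _ --> X]oppr0; apply: cvgN.
  rewrite -[X in _ --> X](mulr0 c^-1); apply: cvgM; first exact: cvg_cst.
  exact: cvg_harmonic.
by have := cvg_comp _ _ h (@continuous_expR R 0); rewrite expR0.
Qed.

End smooth_functions.

Section bumps.
Context {R : realType} (n : nat).
Implicit Types (x a b : 'rV[R]_n).

Definition prodf (f : 'I_n -> R -> R) (x : 'rV[R]_n) : R := \prod_i f i (x ord0 i).

Lemma continuous_prodf (f : 'I_n -> R -> R) : (forall i, continuous (f i)) ->
  continuous (prodf f).
Proof.
move=> cf; rewrite /prodf.
have h (r : seq 'I_n) : continuous (fun x : 'rV[R]_n => \prod_(i <- r) f i (x ord0 i)).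
  elim: r => [|i r IH].
    rewrite (_ : (fun x : 'rV[R]_n => _) = cst 1); first exact: cst_continuous.
    by apply/funext => x; rewrite big_nil.
  rewrite (_ : (fun x : 'rV[R]_n => _) =
    (fun x => f i (x ord0 i) * \prod_(j <- r) f j (x ord0 j))); last first.
    by apply/funext => x; rewrite big_cons.
  have ci : continuous (fun x : 'rV[R]_n => f i (x ord0 i)).
    by move=> y; apply: continuous_comp; [exact: coord_continuous|exact: cf].
  by move=> x; have := cvgM (ci x) (IH x); exact.
exact: h.
Qed.

(** A partial derivative acts on one factor only, so it is again a product of functions of single
    coordinates; this closes the induction in [is_Ck_prodf]. *)
Lemma is_derive_prodf (f df : 'I_n -> R -> R) (i : 'I_n) x :
  (forall j (t : R), is_derive t 1 (f j) (df j t)) ->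
  is_derive x (delta_mx ord0 i) (prodf f)
    (prodf (fun j => if j == i then df j else f j) x).
Proof.
move=> fdf.
pose P := \prod_(j | j != i) f j (x ord0 j).
have E : (fun h : R => h^-1 *: ((prodf f \o shift x) (h *: delta_mx ord0 i) - prodf f x)) =
    (fun h : R => (h^-1 *: ((f i \o shift (x ord0 i)) (h *: 1) - f i (x ord0 i))) * P).
  apply/funext => h /=; rewrite /prodf (bigD1 i)//= [X in _ - X](bigD1 i)//=.
  have -> : \prod_(j < n | j != i) f j ((h *: delta_mx ord0 i + x) ord0 j) = P.
    apply: eq_bigr => j ji; congr (f j _).
    by rewrite !mxE eqxx/= (negbTE ji) mulr0 add0r.
  by rewrite !mxE !eqxx/= -mulrBl scalerAl.
have [di vi] := fdf i (x ord0 i).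
have cE : (fun h : R => h^-1 *: ((prodf f \o shift x) (h *: delta_mx ord0 i) - prodf f x))
    @ 0^' --> df i (x ord0 i) * P.
  by rewrite E; apply: cvgM; [rewrite -vi; exact: di|exact: cvg_cst].
have -> : prodf (fun j => if j == i then df j else f j) x = df i (x ord0 i) * P.
  rewrite /prodf (bigD1 i)//= eqxx; congr (_ * _).
  by apply: eq_bigr => j /negbTE ->.
split; first by apply/cvg_ex; eexists; exact: cE.
exact/cvg_lim.
Qed.

Lemma is_Ck_prodf k (f : 'I_n -> R -> R) : (forall i, smooth1 k (f i)) ->
  is_Ck k (prodf f).
Proof.
elim: k f => [|k IH] f sf; first exact: continuous_prodf.
split; first by apply: continuous_prodf => i; exact: smooth1_continuous (sf i).
have /choice[df dfP] (j : 'I_n) : exists dg : R -> R,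
    (forall t : R, is_derive t 1 (f j) (dg t)) /\ smooth1 k dg.
  by case: (sf j) => _ [dg [? ?]]; exists dg.
have fdf j (t : R) : is_derive t 1 (f j) (df j t) by case: (dfP j).
move=> i; split; first by move=> x; case: (is_derive_prodf i x fdf).
have -> : partial i (prodf f) = prodf (fun j => if j == i then df j else f j).
  by apply/funext => x; case: (is_derive_prodf i x fdf).
apply: IH => j; case: ifP => _; first by case: (dfP j).
exact: smooth1S.
Qed.

(** Equal to [e^(-1/(k(t-a))) e^(-1/(k(b-t)))] on the interval from [a] to [b] and to [0] elsewhere.
    As [k] grows it tends to the indicator of the open interval. *)
Definition bump1 (k a b t : R) : R := flat 0 (k * (t - a)) * flat 0 (k * (b - t)).

Definition bump (k : R) a b : 'rV[R]_n -> R :=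
  prodf (fun i => bump1 k (a ord0 i) (b ord0 i)).

Lemma smooth1_bump1 m k (a b : R) : smooth1 m (bump1 k a b).
Proof.
have -> : bump1 k a b = (fun t => flat 0 (k * t + (- (k * a))) * flat 0 ((- k) * t + k * b)).
  by apply/funext => t; rewrite /bump1; congr (flat 0 _ * flat 0 _); ring.
by apply: smooth1M; apply: smooth1_affine; exact: smooth1_flat.
Qed.

Lemma bump1_ge0 k (a b t : R) : 0 <= bump1 k a b t <= 1.
Proof.
rewrite mulr_ge0 ?flat_ge0//= -[leRHS]mulr1 ler_pM ?flat_ge0 ?flat0_le1//.
Qed.

Lemma bump_ge0 k a b x : 0 <= bump k a b x <= 1.
Proof.
apply: (big_ind (fun y : R => 0 <= y <= 1)) => [|y z|i _].
- by rewrite ler01 lexx.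
- move=> /andP[y0 y1] /andP[z0 z1]; rewrite mulr_ge0//=.
  by rewrite -[leRHS]mulr1 ler_pM.
- exact: bump1_ge0.
Qed.

Lemma bump_eq0 (k : R) a b x i : 0 < k ->
  ~~ (a ord0 i < x ord0 i < b ord0 i) -> bump k a b x = 0.
Proof.
move=> k0 h; apply/eqP; rewrite /bump /prodf prodf_seq_eq0; apply/hasP; exists i => //=.
  exact: mem_index_enum.
rewrite /bump1 mulf_eq0; move: h; rewrite negb_and -!leNgt => /orP[h|h]; apply/orP; [left|right];
  by rewrite flat_le0// pmulr_rle0// subr_le0.
Qed.

Lemma test_function_bump (k : R) a b : 0 < k -> test_function (bump k a b).
Proof.
move=> k0; split; first by move=> m; apply: is_Ck_prodf => i; exact: smooth1_bump1.
pose B := [set x : 'rV[R]_n | forall i, [set` `[a ord0 i, b ord0 i]] (x ord0 i)].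
have cB : compact B.
  exact: (@rV_compact R n (fun i => [set` `[a ord0 i, b ord0 i]])
    (fun i => @segment_compact R _ _)).
apply: (subclosed_compact _ cB); first exact: closed_closure.
have clB : closed B.
  exact: (@compact_closed _ B (@norm_hausdorff R 'rV[R]_n) cB).
apply: (@subset_trans _ (closure B)); last exact: clB.
apply: closure_subset => x /= x0 i.
rewrite /= in_itv/=; apply: contraTT (x0) => h; rewrite negbK; apply/eqP.
apply: (@bump_eq0 k a b x i k0); apply: contra h => /andP[? ?].
by rewrite !ltW.
Qed.

(** Translates of bumps are bumps, hence test functions: the equation can be tested with all of
    them, which gives the convolution at every point. *)
Lemma bump_shift k a b z x : bump k a b (x - z) = bump k (a + z) (b + z) x.
Proof.
rewrite /bump /prodf; apply: eq_bigr => i _; rewrite /bump1 !mxE.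
by congr (flat 0 _ * flat 0 _); ring.
Qed.

Definition open_box a b : set 'rV[R]_n :=
  [set x | forall i, a ord0 i < x ord0 i < b ord0 i].

Lemma bump_cvg a b x : bump j.+1%:R a b x @[j --> \oo] --> (\1_(open_box a b) x : R).
Proof.
rewrite indicE; have [|xab] := boolP (x \in open_box a b).
  rewrite inE => xab /=.
  have h (r : seq 'I_n) : \prod_(i <- r) bump1 j.+1%:R (a ord0 i) (b ord0 i) (x ord0 i) @[j --> \oo] --> (1 : R).
    elim: r => [|i r IH].
      by under eq_fun do rewrite big_nil; exact: cvg_cst.
    have /andP[] := xab i; rewrite -subr_gt0 => ax; rewrite -subr_gt0 => xb.
    have c1 : bump1 j.+1%:R (a ord0 i) (b ord0 i) (x ord0 i) @[j --> \oo] --> (1 * 1 : R).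
      by apply: cvgM; exact: flat0_cvg1.
    have c2 : bump1 j.+1%:R (a ord0 i) (b ord0 i) (x ord0 i) *
        \prod_(i <- r) bump1 j.+1%:R (a ord0 i) (b ord0 i) (x ord0 i) @[j --> \oo] -->
        (1 * 1 * 1 : R) by exact: cvgM.
    by rewrite !mulr1 in c2; under eq_fun do rewrite big_cons.
  exact: h.
have [i hi] : exists i, ~~ (a ord0 i < x ord0 i < b ord0 i).
  apply: contrapT => /forallNP h; move: xab; rewrite notin_setE; apply => i.
  by have /negP := h i; rewrite negbK.
rewrite (_ : (fun j => _) = cst 0); first exact: cvg_cst.
by apply/funext => j; apply: (bump_eq0 _ hi).
Qed.

End bumps.

(** * Uniqueness *)

Lemma Rintegral_EFin_eq d d' (T : measurableType d) (T' : measurableType d')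
    (R : realType) (mu : {measure set T -> \bar R}) (mu' : {measure set T' -> \bar R})
    (f : T -> R) (g : T' -> R) :
  (\int[mu]_x (f x)%:E = \int[mu']_x (g x)%:E)%E -> \int[mu]_x f x = \int[mu']_x g x.
Proof. by rewrite /Rintegral => ->. Qed.

Section integrable_jump.
Context d (T : measurableType d) (R : realType).
Variable mu : {sigma_finite_measure set T -> \bar R}.

Lemma integrable_jump_op (k : T -> T -> R) psi : measurable2 k ->
  (forall x y, 0 <= k x y) -> jump_integrable mu k psi ->
  mu.-integrable setT (EFin \o jump_op mu k psi).
Proof.
move=> mk k0 [mpsi _ ij foo].
pose F := fun p : T * T => ((psi p.1 - psi p.2) * k p.1 p.2)%:E.
have md : measurable2 (fun x y => (psi x - psi y) * k x y).
  apply: measurable2M mk; apply: measurable2B.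
    exact: measurable2_fst.
  exact: measurable2_snd.
have iF : (mu \x mu)%E.-integrable setT F.
  apply/integrable12ltyP.
    by apply/measurable_EFinP; exact: (measurable2P md).
  move: foo; rewrite dint.unlock.
  under eq_integral do under eq_integral do rewrite -[k _ _]ger0_norm// -normrM.
  exact.
have -> : EFin \o jump_op mu k psi = fubini_F mu F.
  by apply/funext => x; rewrite /jump_op /= EFin_Rintegral.
exact: integrable_fubini_F.
Qed.

End integrable_jump.

Section maximum_principle.
Context {R : realType} (n : nat) (s : R).
Hypotheses (n0 : (0 < n)%N) (s0 : 0 < s) (s1 : s < 1).
Local Notation mu := (@lebesgue_rV R n).
Local Notation K := (@frac_kernel R n s).
Local Notation kernel0 := (@kernel0 R n s).
Variables (phi : 'rV[R]_n -> R) (M lam : R).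
Hypotheses (mphi : measurable_fun setT phi) (phiM : forall x, `|phi x| <= M).
Hypothesis lam0 : 0 <= lam.

Let M0 : 0 <= M. Proof. by apply: le_trans (phiM 0). Qed.

Lemma jump_op_shift psi C r x : 0 <= r -> lip_box psi C r ->
  jump_op mu K psi x = \int[mu]_h ((psi x - psi (x + h)) * kernel0 h).
Proof.
move=> r0 lb; have [_ _ ij _] := jump_integrable_lip_box n0 s0 s1 r0 lb.
have [mpsi _ _ _] := lb.
rewrite /jump_op /Rintegral; congr fine.
rewrite -(integral_rV_shift (- x) (f := fun h => ((psi x - psi (x + h)) * kernel0 h)%:E)).
  apply: eq_integral => y _; congr (_%:E).
  have -> : x + (y - x) = y by rewrite addrC subrK.
  by rewrite kernel0E -[kernel0 (x - y)]kernel0N opprB.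
apply/measurable_EFinP; apply: measurable_funM; last exact: measurable_kernel0.
apply: measurable_funB; first exact: measurable_cst.
apply: (measurableT_comp mpsi).
by apply: measurable_fun_rVD; [exact: measurable_cst|exact: measurable_id].
Qed.

(** With [u z = \int phi y * psi (y - z)], the right side is [\int kernel0 h * (u 0 - u (- h))],
    that is [L_K u] at the origin; other points are reached by translating [psi]. Fubini is
    justified by integrating in [y] first, where [|phi| <= M] and the [L^1] modulus of [psi] give a
    multiple of [min(|h|, 1)]. *)
Lemma conv_jump_op psi C r : 0 <= r -> lip_box psi C r ->
  let g h := kernel0 h *
    (\int[mu]_y (phi y * psi y) - \int[mu]_y (phi y * psi (y + h))) in
  measurable_fun setT g /\
  \int[mu]_y (phi y * jump_op mu K psi y) = \int[mu]_h g h.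
Proof.
move=> r0 lb g; have [mpsi psiC psiL _] := lb.
have mk0 := @measurable_kernel0 R n s.
have ipsi := integrable_lip_box r0 lb.
have mps : measurable2 (fun y h : 'rV[R]_n => psi (y + h)).
  split; apply: (measurableT_comp mpsi).
  by apply: measurable_fun_rVD; [exact: measurable_fst|exact: measurable_snd].
have mF2 : measurable2 (fun y h : 'rV[R]_n =>
    phi y * ((psi y - psi (y + h)) * kernel0 h)).
  apply: measurable2M; first exact: measurable2_fst.
  apply: measurable2M; last exact: (measurable2_snd mk0).
  by apply: measurable2B => //; exact: measurable2_fst.
pose F (p : 'rV[R]_n * 'rV[R]_n) :=
  (phi p.1 * ((psi p.1 - psi (p.1 + p.2)) * kernel0 p.2))%:E.
have mF : measurable_fun setT F.
  by apply/measurable_EFinP; exact: (measurable2P mF2).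
have mpsih h : measurable_fun setT (fun y : 'rV[R]_n => psi (y + h)).
  exact: (measurableT_comp mpsi (measurable_addr h)).
have mdiff h : measurable_fun setT (fun y : 'rV[R]_n => `|psi (y + h) - psi y|).
  by apply: measurableT_comp => //; apply: measurable_funB.
pose B : R := 2 * (r *+ 2) ^+ n * C.
have C0 : 0 <= C by apply: le_trans (psiC 0).
have B0 : 0 <= B by rewrite mulr_ge0 ?exprn_ge0 ?mulrn_wge0 // mulr_ge0 ?exprn_ge0 ?mulrn_wge0.
have mmin := @measurable_min_enorm R n.
have iF : (mu \x mu)%E.-integrable setT F.
  apply/integrable21ltyP => //.
  apply: (@le_lt_trans _ _ (\int[mu]_h ((M * B) * (Num.min (enorm h) 1 * kernel0 h))%:E)%E).
    apply: ge0_le_integral => //.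
    + by move=> h _; apply: integral_ge0 => y _; rewrite abse_ge0.
    + apply: (measurable_fun_fubini_tonelli_G (fun p => `|F p|%E)) => //.
      exact: measurableT_comp.
    + apply/measurable_EFinP; apply: measurable_funM; first exact: measurable_cst.
      by apply: measurable_funM => //; exact: mmin.
    + move=> h _.
      apply: (@le_trans _ _ (\int[mu]_y ((M * kernel0 h) * `|psi (y + h) - psi y|)%:E)%E).
        apply: ge0_le_integral_EFin => //.
        * apply: measurableT_comp => //.
          exact: (measurable2_app h (measurable2_swap mF2)).
        * by apply: measurable_funM; [exact: measurable_cst|exact: mdiff].
        * by move=> y /=; rewrite !normrM (ger0_norm (kernel0_ge0 _ _)) distrC
            -mulrA [kernel0 h * _]mulrC ler_wpM2r// mulr_ge0 ?kernel0_ge0.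
      rewrite ge0_integralZ_EFin//; last by rewrite mulr_ge0 ?kernel0_ge0.
      have := integral_lip_box_diff r0 lb h; rewrite -/B => hB.
      apply: (@le_trans _ _ ((M * kernel0 h)%:E * (B * Num.min (enorm h) 1)%:E)%E).
        by rewrite lee_wpmul2l// lee_fin mulr_ge0 ?kernel0_ge0.
      by rewrite -EFinM lee_fin le_eqVlt; apply/orP; left; apply/eqP; ring.
  rewrite ge0_integralZ_EFin ?(mulr_ge0 M0 B0)//.
  + by apply: lte_mul_pinfty => //; [rewrite lee_fin (mulr_ge0 M0 B0)|exact: kernel0_fin].
  + by apply: measurable_funM => //; exact: mmin.
  + by move=> h; rewrite mulr_ge0 ?kernel0_ge0 ?min_enorm_ge0.
have ipsih h : mu.-integrable setT (EFin \o (fun y : 'rV[R]_n => psi (y + h))).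
  apply: integrable_norm_lty => //.
  have [_ ioo] := integrableP _ _ _ ipsi.
  have mn : measurable_fun setT (fun y => (`|psi y|)%:E).
    by apply/measurable_EFinP; exact: measurableT_comp.
  have n00 y : (0 <= (`|psi y|)%:E)%E by rewrite lee_fin.
  by rewrite (ge0_integral_rV_shift h mn n00).
have ishift y : mu.-integrable setT
    (EFin \o (fun h => (psi y - psi (y + h)) * kernel0 h)).
  apply: le_integrable (integrableZ_real C (integrable_kernel0_min n0 s0 s1)) => //.
    apply/measurable_EFinP; apply: measurable_funM; last exact: mk0.
    apply: measurable_funB; first exact: measurable_cst.
    exact: (measurable2_app y mps).
  move=> h _ /=; rewrite lee_fin normrM (ger0_norm (kernel0_ge0 _ _)) distrC.
  rewrite [leRHS]ger0_norm ?mulr_ge0 ?kernel0_ge0 ?min_enorm_ge0//.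
  by rewrite mulrA ler_wpM2r ?kernel0_ge0.
have gE : fubini_G mu F = EFin \o g.
  apply/funext => h; rewrite /fubini_G /g /=.
  have i1 := integrableMl_bounded mphi phiM ipsi.
  have i2 := integrableMl_bounded mphi phiM (ipsih h).
  rewrite -RintegralB// EFinM EFin_Rintegral; last exact: integrableB_real.
  rewrite -integralZl//; last exact: integrableB_real.
  by apply: eq_integral => y _; rewrite /F /= -EFinM; congr (_%:E); ring.
have mG : measurable_fun setT (fubini_G mu F) by exact: (measurable_fubini_G iF).
split; first by move: mG; rewrite gE => /measurable_EFinP.
apply: Rintegral_EFin_eq; rewrite [RHS](_ : _ = \int[mu]_h (EFin \o g) h)%E//.
rewrite -gE; transitivity (\int[mu]_y fubini_F mu F y)%E; last exact: Fubini.
apply: eq_integral => y _; rewrite (jump_op_shift y r0 lb).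
rewrite EFinM (EFin_Rintegral (ishift y)).
by rewrite /fubini_F -(integralZl measurableT (ishift y)).
Qed.

(** The convolution inherits its modulus of continuity from [psi], although [phi] is only bounded
    and measurable. *)
Lemma conv_diff psi C r z h : 0 <= r -> lip_box psi C r ->
  `|\int[mu]_y (phi y * psi (y - z)) - \int[mu]_y (phi y * psi (y - (z - h)))| <=
  M * (2 * (r *+ 2) ^+ n * C) * Num.min (enorm h) 1.
Proof.
move=> r0 lb; have [mpsi psiC psiL _] := lb.
have ipsi := integrable_lip_box r0 lb.
have ipsiz a : mu.-integrable setT (EFin \o (fun y : 'rV[R]_n => psi (y - a))).
  apply: integrable_norm_lty.
    exact: (measurableT_comp mpsi (measurable_addr (- a))).
  have [_ ioo] := integrableP _ _ _ ipsi.
  have mn : measurable_fun setT (fun y => (`|psi y|)%:E).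
    by apply/measurable_EFinP; exact: measurableT_comp.
  have n00 y : (0 <= (`|psi y|)%:E)%E by rewrite lee_fin.
  by rewrite (ge0_integral_rV_shift (- a) mn n00).
have iz := integrableMl_bounded mphi phiM (ipsiz z).
have izh := integrableMl_bounded mphi phiM (ipsiz (z - h)).
have id := integrableB_real iz izh.
rewrite -RintegralB//; apply: le_trans (le_normr_Rintegral _ id) _ => //.
rewrite -lee_fin EFin_Rintegral; last exact: (integrable_norm id).
have mdiff : measurable_fun setT (fun y : 'rV[R]_n => `|psi (y + h) - psi y|).
  apply: measurableT_comp => //; apply: (measurable_funB _ mpsi).
  exact: (measurableT_comp mpsi (measurable_addr h)).
apply: (@le_trans _ _ (\int[mu]_y (M * `|psi (y - z + h) - psi (y - z)|)%:E)%E).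
  apply: ge0_le_integral_EFin => //.
  - by have /measurable_EFinP := measurable_int _ (integrable_norm id).
  - apply: measurable_funM; first exact: measurable_cst.
    exact: (measurableT_comp mdiff (measurable_addr (- z))).
  - move=> y /=; rewrite -mulrBr normrM distrC opprB addrA -[y + h - z]addrAC.
    by rewrite ler_wpM2r.
rewrite ge0_integralZ_EFin//; last exact: (measurableT_comp mdiff (measurable_addr (- z))).
rewrite (ge0_integral_rV_shift (- z) (f := fun y => (`|psi (y + h) - psi y|)%:E)) //.
- rewrite -mulrA [leRHS]EFinM lee_wpmul2l//.
  exact: integral_lip_box_diff r0 lb h.
- exact/measurable_EFinP.
Qed.

(* The convolution [fun z => \int[mu]_y (phi y * psi (y - z))] solves the same
   equation classically; at a near-maximum point its jump operator is almost
   nonnegative, so that its supremum cannot be positive. *)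
Lemma conv_le0 psi C r : 0 <= r -> lip_box psi C r ->
  (forall z, exists C' r', 0 <= r' /\ lip_box (fun x => psi (x - z)) C' r') ->
  (forall z, \int[mu]_y (phi y * (psi (y - z) +
     lam * jump_op mu K (fun x => psi (x - z)) y)) = 0) ->
  \int[mu]_y (phi y * psi y) <= 0.
Proof.
move=> r0 lb lbz eq0; rewrite leNgt; apply/negP => pos.
pose u z := \int[mu]_y (phi y * psi (y - z)).
have u0 : 0 < u 0.
  by move: pos; rewrite /u; under [X in _ -> 0 < X]eq_Rintegral do rewrite subr0.
pose D := M * (2 * (r *+ 2) ^+ n * C).
have uD z h : `|u z - u (z - h)| <= D * Num.min (enorm h) 1 by exact: conv_diff.
have D0 : 0 <= D.
  have [_ psiC _ _] := lb; have C0 : 0 <= C by apply: le_trans (psiC 0).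
  apply: mulr_ge0 => //; apply: mulr_ge0 => //; apply: mulr_ge0 => //.
  by apply: exprn_ge0; rewrite mulrn_wge0.
have u_eq z : exists2 g, measurable_fun setT g /\
    (forall h, g h = kernel0 h * (u z - u (z - h))) & u z = - (lam * \int[mu]_h g h).
  have [C' [r' [r'0 lb']]] := lbz z.
  have [mg ige] := conv_jump_op r'0 lb'.
  eexists; first by split; [exact: mg|move=> h /=; congr (_ * (_ - _));
    apply: eq_Rintegral => y _; congr (_ * psi _); rewrite opprB addrA addrAC].
  rewrite -ige; have := eq0 z.
  under eq_Rintegral do rewrite mulrDr mulrCA.
  have i1 := integrableMl_bounded mphi phiM (integrable_lip_box r'0 lb').
  have i2 := integrableMl_bounded mphi phiM (integrable_jump_op
    (@measurable2_frac_kernel R n s) (@frac_kernel_ge0 R n s)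
    (jump_integrable_lip_box n0 s0 s1 r'0 lb')).
  rewrite RintegralD//; last exact: integrableZ_real.
  by rewrite RintegralZl// => /eqP; rewrite addr_eq0 => /eqP.
pose U := u 0 + D.
have uU z : u z <= U.
  have := uD z z; rewrite subrr => h.
  rewrite /U -lerBlDl (le_trans (ler_norm _))// (le_trans h)//.
  by rewrite -[leRHS]mulr1 ler_wpM2l// ge_min lexx orbT.
have supu : has_sup (range u) by split; [exists (u 0); exists 0|exists U => _ [z _ <-]].
pose S := sup (range u).
have uS z : u z <= S by apply: ub_le_sup; [case: supu|exists z].
have S0 : 0 < S by apply: lt_le_trans (uS 0).
have /choice[z hz] j : exists z, S - j.+1%:R^-1 < u z.
  have [|_ [z _ <-] hz] := @sup_adherent _ (range u) j.+1%:R^-1 _ supu.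
    by rewrite invr_gt0.
  by exists z.
(* By the choice of [z j], [u (z j - h) - u (z j)] is at most [S - u (z j) < 1/(j+1)], and by [uD]
   at most [D * min(|h|, 1)]. So [w j] bounds minus the integrand of the jump operator at [z j]; it
   is dominated by an integrable function and tends to [0]. *)
pose w (j : nat) h := kernel0 h * Num.min (j.+1%:R^-1) (D * Num.min (enorm h) 1).
have mmin := @measurable_min_enorm R n.
have mk0 := @measurable_kernel0 R n s.
have mw j : measurable_fun setT (w j).
  apply: measurable_funM; first exact: mk0.
  apply: measurable_realfun.measurable_minr; first exact: measurable_cst.
  by apply: measurable_funM; [exact: measurable_cst|exact: mmin].
have w_ge0 j h : 0 <= w j h.
  by rewrite mulr_ge0 ?kernel0_ge0// le_min invr_ge0 ler0n mulr_ge0 ?min_enorm_ge0.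
have igD := integrableZ_real D (integrable_kernel0_min n0 s0 s1).
have wD j h : `|w j h| <= D * (Num.min (enorm h) 1 * kernel0 h).
  rewrite ger0_norm// /w mulrA mulrC ler_wpM2r ?kernel0_ge0//.
  by rewrite ge_min lexx orbT.
have iw j : mu.-integrable setT (EFin \o w j).
  apply: le_integrable igD => //; first exact/measurable_EFinP.
  move=> h _ /=; rewrite lee_fin (le_trans (wD j h))//; exact: ler_norm.
have uw j : S - j.+1%:R^-1 <= lam * \int[mu]_h w j h.
  apply: (le_trans (ltW (hz j))).
  have [g [mg gE] ->] := u_eq (z j).
  rewrite -mulrN ler_wpM2l//.
  have ig : mu.-integrable setT (EFin \o g).
    apply: le_integrable igD => //; first exact/measurable_EFinP.
    move=> h _ /=; rewrite lee_fin gE normrM ger0_norm ?kernel0_ge0//.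
    rewrite (le_trans _ (ler_norm _))// mulrA mulrC.
    by rewrite ler_wpM2r ?kernel0_ge0.
  rewrite -mulN1r -RintegralZl//; apply: le_Rintegral => //.
    exact: integrableZ_real.
  move=> h _; rewrite gE mulN1r -mulrN ler_wpM2l ?kernel0_ge0// opprB le_min.
  apply/andP; split.
    rewrite lerBlDl; apply: le_trans (uS _) _.
    by rewrite -lerBlDr ltW.
  by apply: le_trans (ler_norm _) _; rewrite distrC.
have w_cvg : \int[mu]_h w j h @[j --> \oo] --> \int[mu]_h 0.
  apply: (dominated_cvg_Rintegral mw _ _ igD wD); first exact: measurable_cst.
  apply: aeW => h.
  apply: (@squeeze_cvgr _ _ _ _ (fun=> 0) (fun j => kernel0 h * j.+1%:R^-1)).
  - apply: nearW => j; rewrite w_ge0 /= ler_wpM2l ?kernel0_ge0//.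
    by rewrite ge_min lexx.
  - exact: cvg_cst.
  - by rewrite -[X in _ --> X](mulr0 (kernel0 h)); apply: cvgMr; exact: cvg_harmonic.
have lim0 : S - j.+1%:R^-1 - lam * \int[mu]_h w j h @[j --> \oo] -->
    S - 0 - lam * \int[mu]_h 0.
  apply: cvgB; last exact: cvgMr.
  by apply: cvgB; [exact: cvg_cst|exact: cvg_harmonic].
have : S - 0 - lam * \int[mu]_h 0 <= 0.
  by apply: (cvgr_to_le lim0); apply: nearW => j; rewrite subr_le0.
by rewrite Rintegral_cst// mul0r mulr0 !subr0 leNgt S0.
Qed.

End maximum_principle.

(** * Open boxes as a generating pi-system *)

Section open_boxes.
Context {R : realType} (n : nat).
Implicit Types (a b x : 'rV[R]_n).

Let boxes : set (set 'rV[R]_n) := [set A | exists a b, A = open_box a b].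

Lemma measurable_open_box a b : measurable (open_box a b).
Proof.
rewrite (_ : open_box a b = \bigcap_(i in [set: 'I_n])
  ((fun x : 'rV[R]_n => x ord0 i) @^-1` `]a ord0 i, b ord0 i[%classic)).
  apply: fin_bigcap_measurable => // i _.
  by rewrite -[X in measurable X]setTI; apply: measurable_coord.
apply/seteqP; split => x /=; first by move=> h i _; rewrite /= in_itv; exact: h.
by move=> h i; have := h i I; rewrite /= in_itv.
Qed.

Lemma open_boxI a b c d : open_box a b `&` open_box c d =
  open_box (\row_i Num.max (a ord0 i) (c ord0 i)) (\row_i Num.min (b ord0 i) (d ord0 i)).
Proof.
apply/seteqP; split => x /= h => [i|].
  case: h => /(_ i)/andP[h1 h2] /(_ i)/andP[h3 h4].
  by rewrite !mxE gt_max lt_min h1 h2 h3 h4.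
by split=> i; have := h i; rewrite !mxE gt_max lt_min =>
  /andP[/andP[h1 h2] /andP[h3 h4]]; apply/andP.
Qed.

Definition cube (N : nat) : set 'rV[R]_n :=
  open_box (const_mx (- N%:R)) (const_mx N%:R).

Lemma cubeP N x : enorm x < N%:R -> cube N x.
Proof.
move=> xN i; rewrite !mxE -ltr_norml; apply: le_lt_trans xN.
exact: le_coord_enorm.
Qed.

Lemma measurable_open_boxes : @measurable _ 'rV[R]_n = <<s boxes >>.
Proof.
apply/seteqP; split; last first.
  apply: smallest_sub; first exact: sigma_algebra_measurable.
  by move=> _ [a [b ->]]; exact: measurable_open_box.
apply: smallest_sub; first exact: smallest_sigma_algebra.
move=> A; rewrite -bigcup_seq => -[i _]; move: A.
suff mi : @measurable_fun _ _ (g_sigma_algebraType boxes) (measurableTypeR R)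
    setT (fun x : 'rV[R]_n => x ord0 i).
  by move=> _ [B mB <-]; exact: mi.
apply: (measurability _ (RGenOpens.measurableE R)) => _ [_ [c [d ->]] <-].
(* A slab in the [i]-th direction is the increasing union of the boxes that cut the other
   coordinates at [N]. *)
rewrite setTI (_ : _ @^-1` _ = \bigcup_N open_box
    (\row_j (if j == i then c else - N%:R) : 'rV[R]_n)
    (\row_j (if j == i then d else N%:R))).
  by apply: bigcupT_measurable => N; apply: sub_sigma_algebra; do 2 eexists.
apply/seteqP; split => x /=.
  rewrite in_itv/= => xi; exists (Num.truncn (enorm x)).+1 => //= j.
  rewrite !mxE; case: eqP => [->//|_].
  have := cubeP (truncnS_gt (enorm x)); rewrite /cube => /(_ j).
  by rewrite !mxE.
by move=> [N _ /(_ i)]; rewrite !mxE eqxx in_itv.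
Qed.

End open_boxes.

Section uniqueness.
Context {R : realType} (n : nat) (s : R).
Hypotheses (n0 : (0 < n)%N) (s0 : 0 < s) (s1 : s < 1).
Local Notation mu := (@lebesgue_rV R n).
Local Notation K := (@frac_kernel R n s).
Variables (phi : 'rV[R]_n -> R) (M lam : R).
Hypotheses (mphi : measurable_fun setT phi) (phiM : forall x, `|phi x| <= M).
Hypothesis lam0 : 0 <= lam.
Hypothesis phi_eq : forall psi, test_function psi ->
  \int[mu]_x (phi x * (psi x + lam * jump_op mu K psi x)) = 0.

(** The one-sided bound [conv_le0] for [phi] and for [- phi], both of which solve the homogeneous
    equation. *)
Lemma integral_bump_eq0 k a b : 0 < k -> \int[mu]_x (phi x * bump k a b x) = 0.
Proof.
move=> k0.
have shiftE z : (fun x => bump k a b (x - z)) = bump k (a + z) (b + z).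
  by apply/funext => x; exact: bump_shift.
have lbz z : exists C r, 0 <= r /\ lip_box (fun x => bump k a b (x - z)) C r.
  by rewrite shiftE; apply: test_function_lip_box; exact: test_function_bump.
have [C [r [r0 lb]]] := test_function_lip_box (test_function_bump a b k0).
have eqz z : \int[mu]_y (phi y * (bump k a b (y - z) +
    lam * jump_op mu K (fun x => bump k a b (x - z)) y)) = 0.
  rewrite shiftE; under eq_Rintegral do rewrite bump_shift.
  exact: (phi_eq (test_function_bump _ _ k0)).
have ib := integrable_lip_box r0 lb.
apply/eqP; rewrite eq_le (conv_le0 n0 s0 s1 mphi phiM lam0 r0 lb lbz eqz) /=.
have mNphi : measurable_fun setT (fun x => - phi x) by exact: measurableT_comp.
have phiNM x : `|- phi x| <= M by rewrite normrN.
have eqNz z : \int[mu]_y (- phi y * (bump k a b (y - z) +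
    lam * jump_op mu K (fun x => bump k a b (x - z)) y)) = 0.
  have [C' [r' [r'0 lb']]] := lbz z.
  rewrite (eq_Rintegral _ (g := fun y => -1 * (phi y * (bump k a b (y - z) +
    lam * jump_op mu K (fun x => bump k a b (x - z)) y)))); last first.
    by move=> y _; rewrite mulN1r mulNr.
  rewrite RintegralZl ?eqz ?mulr0//.
  apply: (integrableMl_bounded mphi phiM); apply: integrableD_real.
    exact: (integrable_lip_box r'0 lb').
  apply: integrableZ_real; apply: integrable_jump_op.
  - exact: measurable2_frac_kernel.
  - exact: frac_kernel_ge0.
  - exact: (jump_integrable_lip_box n0 s0 s1 r'0 lb').
have := conv_le0 n0 s0 s1 mNphi phiNM lam0 r0 lb lbz eqNz.
rewrite (eq_Rintegral _ (g := fun y => -1 * (phi y * bump k a b y))); last first.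
  by move=> y _; rewrite mulN1r mulNr.
rewrite RintegralZl//; last exact: integrableMl_bounded mphi phiM ib.
by rewrite mulN1r oppr_le0.
Qed.

Lemma integrable_open_box a b :
  mu.-integrable setT (EFin \o (\1_(open_box a b) : 'rV[R]_n -> R)).
Proof.
have mind : measurable_fun setT (\1_(open_box a b) : 'rV[R]_n -> R).
  by apply: measurable_indic; exact: measurable_open_box.
apply: integrable_norm_lty => //.
pose r := \sum_i (`|a ord0 i| + `|b ord0 i|).
have r0 : 0 <= r by apply: sumr_ge0 => i _; rewrite addr_ge0.
apply: (@le_lt_trans _ _ (\int[mu]_x (\1_(@rV_box R n r) x)%:E)%E); last first.
  rewrite integral_indic//; last exact: measurable_rV_box.
  rewrite setIT; have := ltry ((r *+ 2) ^+ n).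
  by rewrite -(lebesgue_rV_box n r0).
apply: ge0_le_integral_EFin => //.
- by apply: (measurableT_comp _ mind).
- by apply: measurable_indic; exact: measurable_rV_box.
- move=> x; rewrite ger0_norm// !indicE.
  case: (boolP (x \in open_box a b)); last by rewrite ler0n.
  rewrite inE => xab; rewrite mem_set// => i; rewrite /r (bigD1 i)//=.
  have h : 0 <= \sum_(j | j != i) (`|a ord0 j| + `|b ord0 j|).
    by apply: sumr_ge0 => j _; rewrite addr_ge0.
  have /andP[ax xb] := xab i.
  rewrite ler_norml; apply/andP; have := ler_norm (b ord0 i); have := ler_norm (- a ord0 i).
  by rewrite normrN; have := normr_ge0 (a ord0 i); have := normr_ge0 (b ord0 i); split; lra.
Qed.

Lemma integral_open_box_eq0 a b : \int[mu]_x (phi x * \1_(open_box a b) x) = 0.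
Proof.
have mbox := measurable_open_box a b.
have mind : measurable_fun setT (\1_(open_box a b) : _ -> R) by exact: measurable_indic.
have tf j := test_function_bump a b (ltr0Sn R j).
have mb j : measurable_fun setT (fun x => phi x * bump j.+1%:R a b x).
  apply: measurable_funM => //; have [C [r [_ [m _ _ _]]]] := test_function_lip_box (tf j).
  exact: m.
have : \int[mu]_x (phi x * bump j.+1%:R a b x) @[j --> \oo] -->
    \int[mu]_x (phi x * \1_(open_box a b) x).
  apply: (dominated_cvg_Rintegral mb _ _
    (integrableZ_real M (integrable_open_box a b))).
  - exact: measurable_funM.
  - by apply: aeW => x; apply: cvgMr; exact: bump_cvg.
  - move=> j x; rewrite normrM; apply: ler_pM => //.
    have /andP[b0 b1] := bump_ge0 j.+1%:R a b x.
    rewrite ger0_norm// indicE; case: (boolP (x \in open_box a b)) => //.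
    rewrite notin_setE => /existsNP[i /negP xi].
    by rewrite (bump_eq0 (ltr0Sn _ _) xi).
rewrite (_ : (fun j => _) = (fun=> 0)); last first.
  by apply/funext => j; exact: integral_bump_eq0.
by move=> /cvg_lim <- //; rewrite lim_cst.
Qed.

(** As [phi] is bounded but perhaps not integrable, it is first cut off by a cube. The sets over
    which the cut-off function integrates to [0] form a Dynkin system containing the open boxes,
    hence all measurable sets; countably many cubes cover the space. *)
Lemma bounded_ae_eq0 : {ae mu, forall x, phi x = 0}.
Proof.
have Q N : {ae mu, forall x, cube N x -> phi x = 0}.
  set Q : set 'rV[R]_n := cube N.
  have mQ : measurable Q by exact: measurable_open_box.
  pose g x := phi x * (\1_Q x : R).
  have ig : mu.-integrable setT (EFin \o g).
    by apply: integrableMl_bounded mphi phiM _; exact: integrable_open_box.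
  have g0 : (\int[mu]_x (g x)%:E = 0)%E.
    by rewrite -EFin_Rintegral// integral_open_box_eq0.
  have mg : measurable_fun setT (EFin \o g) by exact: measurable_int ig.
  have igS (A : set 'rV[R]_n) : measurable A -> mu.-integrable A (EFin \o g).
    by move=> mA; exact: integrableS ig.
  have PA (A : set 'rV[R]_n) : measurable A -> (\int[mu]_(x in A) (g x)%:E = 0)%E.
    rewrite [in X in X -> _]measurable_open_boxes => mA; move: A mA.
    apply: (dynkin_induction (measurable_open_boxes n)) => //.
    - by move=> _ _ [a [b ->]] [c [d ->]]; do 2 eexists; exact: open_boxI.
    - move=> _ [a [b ->]] /=; rewrite integral_mkcond -[RHS]/(0%:E).
      transitivity (\int[mu]_x (phi x * \1_(open_box a b `&` Q) x)%:E)%E.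
        apply: eq_integral => x _; rewrite patchE /g indicI /=.
        by case: ifPn; rewrite !indicE => h; rewrite ?h ?(negbTE h) ?mul1r ?mul0r ?mulr0.
      rewrite /Q /cube open_boxI -EFin_Rintegral ?integral_open_box_eq0//.
      by apply: integrableMl_bounded mphi phiM _; exact: integrable_open_box.
    (* Complements: the integral over the whole space vanishes by [g0]. *)
    - move=> A mA A0.
      have := integral_setU mu mA (measurableC mA) (f := EFin \o g).
      rewrite setUv g0 A0 add0e => <- //.
      by rewrite disj_set2E setICr.
    - move=> F mF tF F0; rewrite integral_bigcup//.
        by apply: eseries0 => i _ _; exact: F0.
      by apply: igS; exact: bigcupT_measurable.
  have := integral_ae_eq measurableT ig (measurable_cst (0%E : \bar R)).
  move=> /(_ _)/= H.
  have : ae_eq mu setT (EFin \o g) (cst 0%E).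
    by apply: H => A _ mA; rewrite PA// integral0.
  apply: filterS => x /= /(_ I) [gx] Qx.
  by move: gx; rewrite /g indicE mem_set// mulr1.
have := ae_foralln Q; apply: filterS => x /(_ (Num.truncn (enorm x)).+1); apply.
exact: cubeP (truncnS_gt _).
Qed.

End uniqueness.

(** * Lebesgue measurable sets *)

Section integral_off_null.
Local Open Scope ereal_scope.
Context d (T : measurableType d) (R : realType) (mu : {measure set T -> \bar R}).
Variable N : set T.
Hypotheses (mN : measurable N) (N0 : mu N = 0).

Import HBNNSimple.

(* The integral of a nonnegative function is a supremum over the simple functions
   below it, and these keep their integral when multiplied by [\1_(~` N)]. *)
Lemma ge0_le_integral_off_null (f g : T -> \bar R) : (forall x, 0 <= f x) ->
  (forall x, 0 <= g x) -> (forall x, ~ N x -> f x <= g x) ->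
  \int[mu]_x f x <= \int[mu]_x g x.
Proof.
move=> f0 g0 fg; rewrite !ge0_integralTE//; apply: ge_ereal_sup => _ [h /= hf <-].
apply: ereal_sup_ubound; exists (proj_nnsfun h (measurableC mN)) => [x|] /=.
  rewrite mindicE; case: (boolP (x \in ~` N)); last by rewrite mulr0.
  by rewrite inE mulr1 => /fg; exact: le_trans.
rewrite -2!integralT_nnsfun; apply: ge0_ae_eq_integral => //.
- by apply/measurable_EFinP.
- by apply/measurable_EFinP.
- by move=> x _; rewrite lee_fin.
- by move=> x _; rewrite lee_fin.
exists N; split => // x /= /not_implyP[_]; apply: contra_notP => Nx.
by congr (_%:E); rewrite mindicE mem_set ?mulr1.
Qed.

(** Applied below to integrands built on indicators of Lebesgue measurable sets, which may fail to
    be Borel functions. *)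
Lemma eq_integral_off_null (f g : T -> \bar R) : (forall x, ~ N x -> f x = g x) ->
  \int[mu]_x f x = \int[mu]_x g x.
Proof.
move=> fg; rewrite integralE [RHS]integralE; congr (_ - _); apply/eqP;
  rewrite eq_le; apply/andP; split; apply: ge0_le_integral_off_null => // x /fg.
- by rewrite !funeposE => ->.
- by rewrite !funeposE => ->.
- by rewrite !funenegE => ->.
- by rewrite !funenegE => ->.
Qed.

End integral_off_null.

Section borel_representative.
Context {R : realType} {n : nat}.
Local Notation mu := (@lebesgue_rV R n).
Implicit Types (E A N : set 'rV[R]_n).

Definition borel_rep E A N :=
  [/\ measurable A, measurable N, mu N = 0%E &
      forall x, ~ N x -> (\1_E x : R) = \1_A x].

Lemma borel_rep_exists E : lebesgue_measurable E -> exists A N, borel_rep E A N.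
Proof.
move=> [A mA [N [mN N0 sub]]]; exists A, N; split => // x Nx.
have : ~ (A `+` E) x by move=> /sub.
rewrite /setY /= !indicE => h; case: (boolP (x \in E)) => xE; case: (boolP (x \in A)) => xA //;
  exfalso; apply: h; [right|left]; split; by [exact/set_mem|move: xE xA; rewrite ?notin_setE].
Qed.

Lemma borel_rep_integral E A N (f : R -> 'rV[R]_n -> \bar R) : borel_rep E A N ->
  (\int[mu]_x f (\1_E x) x = \int[mu]_x f (\1_A x) x)%E.
Proof.
by move=> [_ mN N0 EA]; apply: (eq_integral_off_null mN N0) => x /EA ->.
Qed.

Lemma borel_rep_indicator_L1 E A N : borel_rep E A N ->
  (\int[mu]_x (\1_E x : R)%:E)%E = mu A.
Proof.
move=> h; have [mA _ _ _] := h.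
by rewrite (borel_rep_integral (fun t _ => t%:E) h) integral_indic// setIT.
Qed.

(** Differences of indicator values are [-1], [0] or [1], so their absolute value equals their
    square. The set is replaced in one variable at a time, the inner integral first. *)
Lemma borel_rep_perimeter s E A N : borel_rep E A N ->
  s_perimeter s E = (2^-1%:E * energy mu (@frac_kernel R n s) (\1_A))%E.
Proof.
move=> h; rewrite /s_perimeter; congr (_ * _)%E.
transitivity (\int[mu]_x \int[mu]_y (`|\1_E x - \1_A y| * frac_kernel s x y)%:E)%E.
  apply: eq_integral => x _.
  exact: (borel_rep_integral (fun t y => (`|\1_E x - t| * frac_kernel s x y)%:E) h).
rewrite (borel_rep_integral (fun t x =>
  (\int[mu]_y (`|t - \1_A y| * frac_kernel s x y)%:E)%E) h).
rewrite /energy dint.unlock; apply: eq_integral => x _; apply: eq_integral => y _.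
congr (_%:E); rewrite mulrC !indicE.
by case: (x \in A); case: (y \in A); rewrite /= ?subrr ?subr0 ?sub0r ?normrN ?normr0 ?normr1 ?sqrrN ?expr1n ?expr0n.
Qed.

End borel_representative.

(** * The functional *)

Lemma c_ns_ge0 {R : realType} (n : nat) (s : R) : 0 < s -> 0 <= c_ns n s.
Proof.
move=> s0; rewrite /c_ns; apply: divr_ge0; last first.
  by rewrite mulr_ge0 ?powR_ge0.
rewrite mulr_ge0 ?powR_ge0// /Gamma.
have z0 : 0 < (n%:R + s) / 2 by rewrite divr_gt0// ltr_wpDl.
rewrite z0 big_ord0 divr1; apply: Rintegral_ge0 => t _.
by rewrite mulr_ge0 ?powR_ge0 ?expR_ge0.
Qed.

Section bounded_solution.
Context {R : realType} (n : nat) (s : R).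
Hypotheses (n0 : (0 < n)%N) (s0 : 0 < s) (s1 : s < 1).
Local Notation mu := (@lebesgue_rV R n).
Local Notation K := (@frac_kernel R n s).
Local Notation c := (@c_ns R n s).
Implicit Types (phi psi : 'rV[R]_n -> R) (eps : R) (E A N : set 'rV[R]_n).

Let lam eps := eps `^ s * c.

Let lam0 eps : 0 <= lam eps.
Proof. by rewrite mulr_ge0 ?powR_ge0 ?c_ns_ge0. Qed.

Lemma bounded_solutionE eps E A N phi : borel_rep E A N ->
  bounded_solution s eps E phi <->
  [/\ measurable_fun setT phi, exists M : R, forall x, `|phi x| <= M &
      forall psi, test_function psi ->
        \int[mu]_x (phi x * (psi x + lam eps * jump_op mu K psi x)) =
        \int[mu]_x (\1_A x * psi x)].
Proof.
move=> h; have E1 psi : test_function psi ->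
    \int[mu]_x (phi x * (psi x + eps `^ s * frac_laplacian s psi x)) =
    \int[mu]_x (phi x * (psi x + lam eps * jump_op mu K psi x)).
  move=> /test_function_lip_box[C [r [r0 lb]]]; apply: eq_Rintegral => x _.
  by rewrite (frac_laplacian_lip_box n0 s0 s1 r0 lb) mulrA.
have E2 psi : \int[mu]_x (\1_E x * psi x) = \int[mu]_x (\1_A x * psi x).
  exact/Rintegral_EFin_eq/(borel_rep_integral (fun t x => (t * psi x)%:E) h).
by split=> -[m b eq]; split => // psi tpsi; have := eq psi tpsi; rewrite E1// E2.
Qed.

(** The difference of the two solutions is bounded and solves the homogeneous equation, so
    [bounded_ae_eq0] applies. *)
Lemma bounded_solution_unique eps E phi psi : lebesgue_measurable E ->
  bounded_solution s eps E phi -> bounded_solution s eps E psi ->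
  {ae mu, forall x, phi x = psi x}.
Proof.
move=> /borel_rep_exists[A [N h]].
move=> /(bounded_solutionE eps phi h)[mphi [M phiM] phi_eq].
move=> /(bounded_solutionE eps psi h)[mpsi [M' psiM] psi_eq].
have md : measurable_fun setT (fun x => phi x - psi x) by exact: measurable_funB.
have dM x : `|phi x - psi x| <= M + M'.
  by apply: le_trans (ler_normB _ _) _; exact: lerD.
have : {ae mu, forall x, phi x - psi x = 0}; last first.
  by apply: filterS => x /eqP; rewrite subr_eq0 => /eqP.
apply: (bounded_ae_eq0 n0 s0 s1 md dM (lam0 eps)) => u tu.
have [C [r [r0 lb]]] := test_function_lip_box tu.
have iu : mu.-integrable setT
    (EFin \o (fun x => u x + lam eps * jump_op mu K u x)).
  apply: integrableD_real; first exact: integrable_lip_box r0 lb.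
  apply: integrableZ_real; apply: integrable_jump_op.
  - exact: measurable2_frac_kernel.
  - exact: frac_kernel_ge0.
  - exact: jump_integrable_lip_box r0 lb.
under eq_Rintegral do rewrite mulrBl.
rewrite RintegralB//; [|exact: integrableMl_bounded mphi phiM iu|
  exact: integrableMl_bounded mpsi psiM iu].
by rewrite phi_eq// psi_eq// subrr.
Qed.

Lemma bounded_solution_exists eps E : indicator_L1 E -> exists phi A,
  [/\ bounded_solution s eps E phi, measurable_fun setT phi,
      measurable A /\ exists N, borel_rep E A N &
  let I := (\int[mu]_x (\1_A x * (1 - phi x))%:E)%E in
  [/\ (0 <= I)%E, (I < +oo)%E, (\int[mu]_x ((\1_A x - phi x) ^+ 2)%:E <= I)%E,
      ((lam eps / 2)%:E * energy mu K phi <= I)%E &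
      (I <= (lam eps / 2)%:E * energy mu K (\1_A))%E]].
Proof.
move=> [/borel_rep_exists[A [N h]] Eoo]; have [mA _ _ _] := h.
have Aoo : (mu A < +oo)%E by rewrite -(borel_rep_indicator_L1 h).
have [phi [mphi phi01 eq [c1 c2 b]]] := frac_resolvent_exists n0 s0 s1 (lam0 eps) mA Aoo.
exists phi, A; split => //=.
- apply/(bounded_solutionE eps phi h); split => //.
    by exists 1 => x; have /andP[p0 p1] := phi01 x; rewrite ger0_norm.
  move=> psi /test_function_lip_box[C [r [r0 lb]]]; apply: eq.
  exact: jump_integrable_lip_box r0 lb.
- by split => //; exists N.
have p1 x : 0 <= \1_A x * (1 - phi x) :> R.
  by have /andP[_ p1] := phi01 x; rewrite mulr_ge0// subr_ge0.
have mind : measurable_fun setT (\1_A : 'rV[R]_n -> R) by exact: measurable_indic.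
split => //.
  by apply: integral_ge0 => x _; rewrite lee_fin.
apply: (@le_lt_trans _ _ (\int[mu]_x (\1_A x)%:E)%E).
  apply: ge0_le_integral_EFin => //.
    by apply: measurable_funM => //; apply: measurable_funB mphi; exact: measurable_cst.
  move=> x; rewrite -[leRHS]mulr1 ler_wpM2l// lerBlDr lerDl.
  by have /andP[] := phi01 x.
by rewrite integral_indic// setIT.
Qed.

(* [\1_A] and [phi] stand for [\1_E] and [phi_sol s eps E], up to null sets. *)
Lemma J_functional_spec eps E : 0 < eps -> indicator_L1 E -> exists phi A N,
  [/\ borel_rep E A N, measurable_fun setT phi,
      (\int[mu]_x ((\1_A x - phi x) ^+ 2)%:E <= (eps `^ s)%:E * J_functional s eps E)%E,
      ((c / 2)%:E * energy mu K phi <= J_functional s eps E)%E &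
      (0 <= J_functional s eps E <= c%:E * s_perimeter s E)%E].
Proof.
move=> eps0 EL1.
have [phi [A [sol mphi [mA [N h]] [I0 Ioo c1 c2 b]]]] := bounded_solution_exists eps EL1.
(* Existence makes the choice in [phi_sol] a true solution rather than the default [0]; uniqueness
   then identifies it with [phi] almost everywhere. *)
have solJ : bounded_solution s eps E (phi_sol s eps E).
  by apply: (@xgetPex _ (fun=> 0) [set phi | bounded_solution s eps E phi]); exists phi.
have [mpsol _ _] := solJ.
have mind : measurable_fun setT (\1_A : 'rV[R]_n -> R) by exact: measurable_indic.
have m1 (f : 'rV[R]_n -> R) : measurable_fun setT f ->
    measurable_fun setT (fun x => (\1_A x * (1 - f x))%:E : \bar R).
  move=> mf; apply/measurable_EFinP; apply: measurable_funM => //.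
  by apply: measurable_funB mf; exact: measurable_cst.
set I := (\int[mu]_x (\1_A x * (1 - phi x))%:E)%E in I0 Ioo c1 c2 b.
have JE : J_functional s eps E = ((eps `^ (- s))%:E * I)%E.
  rewrite /J_functional; congr (_ * _)%E.
  rewrite (borel_rep_integral (fun t x => (t * (1 - phi_sol s eps E x))%:E) h).
  apply: ae_eq_integral; [by []|exact: m1|exact: m1|].
  have := bounded_solution_unique EL1.1 solJ sol.
  by apply: filterS => x /= -> _.
have es0 : 0 < eps `^ s by rewrite powR_gt0.
have eVs : eps `^ (- s) = (eps `^ s)^-1 by rewrite powRN.
have IJ : I = ((eps `^ s)%:E * J_functional s eps E)%E.
  by rewrite JE muleA -EFinM eVs divff ?mul1e// gt_eqF.
have scale (e : \bar R) : (0 <= e)%E ->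
    ((eps `^ (- s))%:E * ((lam eps / 2)%:E * e) = (c / 2)%:E * e)%E.
  by move=> e0; rewrite muleA -EFinM /lam eVs; congr (_%:E * _)%E; field; rewrite gt_eqF.
have eVs0 : (0 <= (eps `^ (- s))%:E)%E by rewrite lee_fin powR_ge0.
have eK0 u : (0 <= energy mu K u)%E by apply: energy_ge0; exact: frac_kernel_ge0.
exists phi, A, N; split => //; rewrite -?IJ//.
- by rewrite JE -scale// lee_wpmul2l.
- rewrite JE mule_ge0//= (borel_rep_perimeter s h) muleA -EFinM -scale//.
  by rewrite lee_wpmul2l.
Qed.

End bounded_solution.

(** * The limit as eps tends to 0 *)

Section liminf_right.
Context {R : realType}.
Implicit Types (f : R -> \bar R) (l : \bar R).

Lemma limf_einf_right_ge0 f : (forall e, 0 < e -> (0 <= f e)%E) ->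
  (0 <= limf_einf f 0^'+)%E.
Proof.
move=> f0; rewrite limf_einfE.
apply: (@le_trans _ _ (ereal_inf (f @` [set e : R | 0 < e]))).
  by apply: le_ereal_inf_tmp => _ [e /= /f0 ? <-].
apply: ereal_sup_ubound; exists [set e : R | 0 < e] => //.
exact: nbhs_right_gt.
Qed.

Lemma limf_esup_right_le f l : (forall e, 0 < e -> (f e <= l)%E) ->
  (limf_esup f 0^'+ <= l)%E.
Proof.
move=> fl; rewrite limf_esupE.
apply: (@le_trans _ _ (ereal_sup (f @` [set e : R | 0 < e]))).
  apply: ereal_inf_lbound; exists [set e : R | 0 < e] => //.
  exact: nbhs_right_gt.
by apply: ge_ereal_sup => _ [e /= /fl ? <-].
Qed.

(** The bound by [l] at every [e] takes the place of an upper limit, and a finite [l] allows an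
    argument with real distances. *)
Lemma limf_einf_right_cvg f (l : R) : (forall e, 0 < e -> (0 <= f e <= l%:E)%E) ->
  (l%:E <= limf_einf f 0^'+)%E -> f e @[e --> 0^'+] --> l%:E.
Proof.
move=> fl linf.
have ffin e : 0 < e -> f e = (fine (f e))%:E.
  move=> /fl /andP[f0 fle]; rewrite fineK// ge0_fin_numE//.
  exact: le_lt_trans fle (ltry _).
apply/fine_cvgP; split.
  near=> e; have e0 : 0 < e by near: e; exact: nbhs_right_gt.
  by rewrite ffin.
apply/cvgrPdist_lt => d d0.
have : ((l - d)%:E < limf_einf f 0^'+)%E.
  by apply: lt_le_trans linf; rewrite lte_fin ltrBlDr ltrDl.
rewrite limf_einfE => /ereal_sup_gt[_ [V FV <-] dV].
near=> e; have e0 : 0 < e by near: e; exact: nbhs_right_gt.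
have Ve : V e by near: e.
have h1 : ((l - d)%:E < f e)%E.
  by apply: lt_le_trans dV _; apply: ereal_inf_lbound; exists e.
have /andP[_ h2] := fl _ e0.
move: h1 h2; rewrite [f e]ffin// lte_fin lee_fin /= => h1 h2.
by rewrite ger0_norm ?subr_ge0// ltrBlDr -ltrBlDl.
Unshelve. all: by end_near.
Qed.

End liminf_right.

Lemma powR_right_small {R : realType} (s d : R) : 0 < s -> 0 < d ->
  \forall e \near 0^'+, e `^ s <= d.
Proof.
move=> s0 d0; near=> e.
have e0 : 0 < e by near: e; exact: nbhs_right_gt.
have ed : e < d `^ s^-1 by near: e; apply: nbhs_right_lt; rewrite powR_gt0.
apply: (@le_trans _ _ ((d `^ s^-1) `^ s)).
  by apply: ge0_ler_powR; rewrite ?nnegrE ?powR_ge0 ?ltW.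
by rewrite -powRrM mulVf ?gt_eqF// powRr1// ltW.
Unshelve. all: by end_near.
Qed.

Section gamma_limit.
Context {R : realType} (n : nat) (s : R).
Hypotheses (n0 : (0 < n)%N) (s0 : 0 < s) (s1 : s < 1).
Local Notation mu := (@lebesgue_rV R n).
Local Notation K := (@frac_kernel R n s).
Local Notation c := (@c_ns R n s).

Lemma J_functional_liminf (F : R -> set 'rV[R]_n) (E : set 'rV[R]_n) :
  (forall eps, 0 < eps -> indicator_L1 (F eps)) -> indicator_L1 E -> cvg_L1 F E ->
  (c%:E * s_perimeter s E
     <= limf_einf (fun eps => J_functional s eps (F eps)) 0^'+)%E.
Proof.
move=> F1 E1 FE.
set J := fun eps => J_functional s eps (F eps).
have J0 eps : 0 < eps -> (0 <= J eps)%E.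
  by move=> eps0; have [_ [_ [_ [_ _ _ _ /andP[]]]]] := J_functional_spec n0 s0 s1 eps0 (F1 _ eps0).
have : (0 <= limf_einf J 0^'+)%E by exact: limf_einf_right_ge0.
(* A lower limit [+oo] leaves nothing to prove, and [-oo] is excluded by nonnegativity. *)
case linf : (limf_einf J 0^'+) => [l| |]; [rewrite lee_fin => l0|by move=> _; rewrite leey|by []].
have [A [N hA]] := borel_rep_exists E1.1; have [mA _ _ _] := hA.
(* The rate [4^-j] makes both series, for [(1_(B j) - phi_ j)^2] and for [|1_(B j) - 1_A|],
   geometric. It is kept abstract while the sequence is chosen. *)
have [a a0 aE] : exists2 a : nat -> R, (forall j, 0 < a j) & a = (fun j => 4^-1 ^+ j).
  by exists (fun j => 4^-1 ^+ j) => // j; rewrite exprn_gt0// invr_gt0.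
have /choice[e_ e_spec] j : exists e, [/\ 0 < e, e `^ s <= a j,
    (\int[mu]_x (`|\1_(F e) x - \1_E x|)%:E <= (a j)%:E)%E &
    (J e <= (l + j.+1%:R^-1)%:E)%E].
  (* [V] is a right neighbourhood of [0], so the infimum of [J] on it is at most the lower limit
     [l]; some [e] in [V] therefore has [J e < l + 1/(j+1)]. *)
  pose V := [set e : R | [/\ 0 < e, e `^ s <= a j &
    (\int[mu]_x (`|\1_(F e) x - \1_E x|)%:E <= (a j)%:E)%E]].
  have aj0 : (0 < (a j)%:E)%E by rewrite lte_fin.
  have Fa := FE _ (open_ereal_lt' aj0).
  have FV : nbhs 0^'+ V.
    near=> e; split.
    - by near: e; exact: nbhs_right_gt.
    - by near: e; exact: powR_right_small.
    - by apply: ltW; near: e.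
  have : (ereal_inf (J @` V) < (l + j.+1%:R^-1)%:E)%E.
    apply: (@le_lt_trans _ _ l%:E); last by rewrite lte_fin ltrDl invr_gt0.
    by rewrite -linf limf_einfE; apply: ereal_sup_ubound; exists V.
  by move=> /ereal_inf_lt[_ [e [e0 es ei] <-] /ltW Je]; exists e.
have /choice[phi_ phi_spec] j : exists phi : 'rV[R]_n -> R, exists B M,
    [/\ borel_rep (F (e_ j)) B M, measurable_fun setT phi,
      (\int[mu]_x ((\1_B x - phi x) ^+ 2)%:E <= ((l + 1) * a j)%:E)%E &
      ((c / 2)%:E * energy mu K phi <= (l + j.+1%:R^-1)%:E)%E].
  have [e0 es _ Je] := e_spec j.
  have [phi [B [M [hB mphi h1 h2 /andP[h3 _]]]]] :=
    J_functional_spec n0 s0 s1 e0 (F1 _ e0).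
  exists phi, B, M; split => //; last exact: le_trans h2 Je.
  apply: (le_trans h1); rewrite mulrC EFinM.
  apply: (@le_trans _ _ ((a j)%:E * J (e_ j))%E); first by rewrite lee_wpmul2r// lee_fin.
  rewrite lee_wpmul2l ?lee_fin// ?(ltW (a0 j))//.
  apply: (le_trans Je); rewrite lee_fin lerD2l invf_le1// ?ler1n//.
have /choice[B B_spec] j := phi_spec j.
(* [B_spec] provides a null set for each [j] under an existential; [xget] selects it as a function
   of [j]. *)
have hB j : borel_rep (F (e_ j)) (B j) (xget set0 [set M | borel_rep (F (e_ j)) (B j) M]).
  by have [M [hM _ _ _]] := B_spec j; apply: (@xgetPex _ set0
    [set M | borel_rep (F (e_ j)) (B j) M]); exists M.
have mB j : measurable (B j) by have [] := hB j.
have mphi j : measurable_fun setT (phi_ j) by have [M []] := B_spec j.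
have mindA : measurable_fun setT (\1_A : 'rV[R]_n -> R) by exact: measurable_indic.
have mindB j : measurable_fun setT (\1_(B j) : 'rV[R]_n -> R) by exact: measurable_indic.
have q01 : 0 <= (4^-1 : R) < 1 by apply/andP; split; lra.
have sq_cvg0 : {ae mu, forall x, (\1_(B j) x - phi_ j x) ^+ 2 @[j --> \oo] --> (0 : R)}.
  apply: summable_ae_cvg0.
  - by move=> j; apply: measurable_funX; exact: measurable_funB.
  - by move=> j x; exact: sqr_ge0.
  apply: (@geometric_sum_lty R _ (l + 1) 4^-1 q01).
  - by move=> j; apply: integral_ge0 => x _; rewrite lee_fin sqr_ge0.
  - by move=> j; have [M [_ _ + _]] := B_spec j; rewrite aE.
have ind_cvg0 : {ae mu, forall x, `|\1_(B j) x - \1_A x| @[j --> \oo] --> (0 : R)}.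
  apply: summable_ae_cvg0 => //.
  - by move=> j; apply: measurableT_comp => //; exact: measurable_funB.
  apply: (@geometric_sum_lty R _ 1 4^-1 q01).
  - by move=> j; apply: integral_ge0.
  - move=> j; have [_ _ + _] := e_spec j.
    rewrite (borel_rep_integral (fun t x => (`|t - \1_E x|)%:E) (hB j)).
    by rewrite (borel_rep_integral (fun t x => (`|\1_(B j) x - t|)%:E) hA) mul1r aE.
have phi_cvg : {ae mu, forall x, phi_ j x @[j --> \oo] --> (\1_A x : R)}.
  (* [phi_ j = 1_A + (1_(B j) - 1_A) - (1_(B j) - phi_ j)], and both differences tend to [0], the
     second after a square root. *)
  apply: filterS2 sq_cvg0 ind_cvg0 => x h1 h2.
  have h3 : `|\1_(B j) x - phi_ j x| @[j --> \oo] --> (0 : R).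
    have := cvg_comp _ _ h1 (@sqrt_continuous R 0); rewrite sqrtr0.
    rewrite (_ : Num.sqrt \o _ = fun j => `|\1_(B j) x - phi_ j x|)//.
    by apply/funext => j /=; rewrite sqrtr_sqr.
  have h4 : (\1_(B j) x - \1_A x) - (\1_(B j) x - phi_ j x) @[j --> \oo] --> (0 - 0 : R).
    by apply: cvgB; exact/norm_cvg0P.
  have h5 : \1_A x + ((\1_(B j) x - \1_A x) - (\1_(B j) x - phi_ j x)) @[j --> \oo]
      --> (\1_A x + (0 - 0) : R) by apply: cvgD => //; exact: cvg_cst.
  move: h5; rewrite subr0 addr0; apply: cvg_trans; apply: near_eq_cvg.
  by apply: nearW => j; ring.
rewrite (borel_rep_perimeter s hA) muleA -EFinM.
have c20 : 0 <= c / 2 by rewrite divr_ge0// c_ns_ge0.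
(* The constant is absorbed in the kernel, so that Fatou applies to the very energies that [J]
   bounds. *)
pose k x y := c / 2 * K x y.
have mk : measurable2 k.
  by apply: measurable2M; [exact: measurable2_cst|exact: measurable2_frac_kernel].
have k0 x y : 0 <= k x y by rewrite mulr_ge0 ?frac_kernel_ge0.
have energyZ u : measurable_fun setT u ->
    energy mu k u = ((c / 2)%:E * energy mu K u)%E.
  move=> mu1; have me := measurable2_energy (measurable2_frac_kernel s) mu1.
  have e0 x y : 0 <= K x y * (u x - u y) ^+ 2.
    by rewrite mulr_ge0 ?sqr_ge0 ?frac_kernel_ge0.
  rewrite /energy -(dintZ mu me e0 c20).
  by congr (dint mu _); apply/funext => x; apply/funext => y; rewrite /k -mulrA.
rewrite -energyZ//.
apply: le_trans (energy_fatou (k_ := fun=> k) (fun=> mk) mk (fun=> k0) k0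
  (fun x y => @cvg_cst _ _ _ _ _) mphi mindA phi_cvg) _.
apply: (@limn_einf_le_cvg _ _ (fun j => (l + j.+1%:R^-1)%:E)).
  by move=> j; rewrite energyZ//; have [M [_ _ _]] := B_spec j.
apply: cvg_EFin; first exact: nearW.
rewrite -[X in _ --> X]addr0; apply: cvgD; [exact: cvg_cst|exact: cvg_harmonic].
Unshelve. all: by end_near.
Qed.

Lemma J_functional_le eps (E : set 'rV[R]_n) : 0 < eps -> indicator_L1 E ->
  (0 <= J_functional s eps E <= c%:E * s_perimeter s E)%E.
Proof.
by move=> eps0 E1; have [_ [_ [_ [_ _ _ _]]]] := J_functional_spec n0 s0 s1 eps0 E1.
Qed.

Lemma cvg_L1_cst (E : set 'rV[R]_n) : cvg_L1 (fun=> E) E.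
Proof.
rewrite /cvg_L1.
under eq_fun do under eq_integral do rewrite subrr normr0.
by rewrite integral0; exact: cvg_cst.
Qed.

(** The lower bound along the constant family meets the upper bound of [J_functional_le]. *)
Lemma J_functional_cvg (E : set 'rV[R]_n) : indicator_L1 E ->
  (s_perimeter s E < +oo)%E ->
  J_functional s eps E @[eps --> 0^'+] --> (c%:E * s_perimeter s E)%E.
Proof.
move=> E1 Poo.
have P0 : (0 <= s_perimeter s E)%E.
  rewrite /s_perimeter mule_ge0 ?lee_fin// integral_ge0// => x _.
  by rewrite integral_ge0// => y _; rewrite lee_fin mulr_ge0 ?frac_kernel_ge0.
have := J_functional_liminf (fun _ _ => E1) E1 (cvg_L1_cst E).
have := fun eps eps0 => @J_functional_le eps E eps0 E1.
rewrite -(@fineK _ (s_perimeter s E)) ?ge0_fin_numE// -EFinM => h1 h2.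
exact: limf_einf_right_cvg.
Qed.

End gamma_limit.

Theorem theorem2p1 (R : realType) (n : nat) (hn : (0 < n)%N)
    (s : R) (hs0 : 0 < s) (hs1 : s < 1) :
  [/\
   (* existence and uniqueness (up to null sets) of the bounded solution *)
   forall (eps : R) (E : set 'rV[R]_n), 0 < eps -> indicator_L1 E ->
     exists phi : 'rV[R]_n -> R, bounded_solution s eps E phi /\
       forall psi : 'rV[R]_n -> R, bounded_solution s eps E psi ->
         {ae lebesgue_rV n, forall x, phi x = psi x},
   (* (i) *)
   forall E : set 'rV[R]_n, indicator_L1 E -> (s_perimeter s E < +oo)%E ->
     J_functional s eps E @[eps --> 0^'+] --> ((c_ns n s)%:E * s_perimeter s E)%E,
   (* (ii) *)
   forall (F : R -> set 'rV[R]_n) (E : set 'rV[R]_n),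
     (forall eps, 0 < eps -> indicator_L1 (F eps)) -> indicator_L1 E ->
     cvg_L1 F E ->
     ((c_ns n s)%:E * s_perimeter s E
        <= limf_einf (fun eps => J_functional s eps (F eps)) 0^'+)%E &
   (* Gamma-convergence *)
   Gamma_converges (fun (eps : R) (E : set 'rV[R]_n) => J_functional s eps E)
     (fun E => ((c_ns n s)%:E * s_perimeter s E)%E)].
Proof.
split.
- move=> eps E eps0 E1.
  have [phi [A [sol _ _ _]]] := bounded_solution_exists hn hs0 hs1 eps E1.
  exists phi; split => // psi solpsi.
  exact: bounded_solution_unique hn hs0 hs1 _ _ _ _ E1.1 sol solpsi.
- by move=> E; exact: J_functional_cvg.
- by move=> F E; exact: J_functional_liminf.
split; first by move=> F E; exact: J_functional_liminf.
(* A constant family is a recovery family, since the upper bound holds for every [eps] and not only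
   in the limit. *)
move=> E E1; exists (fun=> E); split => //; first exact: cvg_L1_cst.
apply: limf_esup_right_le => eps eps0.
by have /andP[] := J_functional_le hn hs0 hs1 eps0 E1.
Qed.
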